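(* Let $T$ be a band operator on $\mathbb{R}^N$ with band parameter $r\in\mathbb{Z}_+$, and let $u,v\ge0$ with $u,v\in L^1_{\mathrm{loc}}(\mathbb{R}^N)$. Then the operator $M_v^{1/2}TM_u^{1/2}$ extends to a bounded operator in $L^2(\mathbb{R}^N)$ if and only if there is a constant $C<\infty$ such that the following two conditions hold: (1) for all dyadic cubes $Q,R$ satisfying $2^{-r}\ell(Q)\le\ell(R)\le2^r\ell(Q)$, $$|\langle T(\chi_Qu),\chi_Rv\rangle|\le C\left(\int_Qu\,dx\right)^{1/2}\left(\int_Rv\,dx\right)^{1/2};$$ (2) for all dyadic cubes $Q$, $$\int_Q|T(\chi_Qu)|^2\,v\,dx\le C\int_Qu\,dx,\qquad\int_Q|T^*(\chi_Qv)|^2\,u\,dx\le C\int_Qv\,dx.$$ Moreover, the norm of the operator $M_v^{1/2}TM_u^{1/2}$ can be estimated by a constant depending only on the dimension $N$, the number $r$, and the constant $C$ in conditions (1) and (2).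
   Context: Dyadic cubes: $\mathcal{D}$ is the standard dyadic lattice in $\mathbb{R}^N$, i.e. the union over $k\in\mathbb{Z}$ of the families of all translates of $[0,2^k)^N$ by vectors with coordinates of the form $j\cdot 2^k$, $j\in\mathbb{Z}$. $\ell(Q)$ is the side length of $Q$. Each dyadic cube has $2^N$ children (the dyadic cubes of half its side length contained in it) and a unique parent. $\mathcal{D}$ is viewed as a non-oriented graph in which each cube is joined by an edge to each of its $2^N$ children; $d_{\text{tree}}(Q,R)$ is the graph distance, every edge having length $1$ (it is $\infty$ if $Q$ and $R$ are not connected). Haar functions: a Haar function on a dyadic cube $Q$ is a function $h_Q$ supported on $Q$, constant on each child of $Q$, with $\int_Q h_Q\,dx=0$. Band operator: a bounded operator $T$ on $L^2(\mathbb{R}^N)$ for which there is $r\in\mathbb{Z}_+=\{0,1,2,\dots\}$ (the band parameter) such that $\langle Th_Q,h_R\rangle=0$ for all Haar functions $h_Q$ on $Q$ and $h_R$ on $R$ whenever $Q,R$ are dyadic cubes with $d_{\text{tree}}(Q,R)>r$. Here $\langle f,g\rangle=\int f\overline{g}\,dx$, and $T^*$ is the adjoint of $T$ in $L^2(\mathbb{R}^N)$. $M_\phi$ is multiplication by $\phi$, $M_v^{1/2}=M_{v^{1/2}}$, and $\chi_Q$ is the indicator function of $Q$. The statement that $M_v^{1/2}TM_u^{1/2}$ extends to a bounded operator in $L^2$ with norm at most $B$ means that $\|v^{1/2}T(u^{1/2}f)\|_{L^2}\le B\|f\|_{L^2}$ for all $f\in L^2(\mathbb{R}^N)$ with $u^{1/2}f\in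 L^2(\mathbb{R}^N)$. Interpretation of (1) and (2) when $u,v$ are only in $L^1_{\mathrm{loc}}$: let $u_n=\min\{u,n\}$, $v_n=\min\{v,n\}$. Whenever $\chi_Qu\in L^2$, the expression $T(\chi_Qu)$ is read literally; when $\chi_Qu\notin L^2$, an inequality containing $T(\chi_Qu)$ means that it holds, with the same right-hand side and the same $C$, with $T(\chi_Qu)$ replaced by $T(\chi_Qu_n)$ for all $n\ge1$. The same convention applies to $T^*(\chi_Qv)$ (replaced by $T^*(\chi_Qv_n)$ for all $n\ge 1$) and to $\chi_Rv$ in the pairing in (1) (replaced by $\chi_Rv_m$ for all $m\ge1$ when $\chi_Rv\notin L^2$, independently of $n$). *)

(* Defs.v *)
From HB Require Import structures.
From mathcomp Require Import all_boot all_order all_algebra.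
From mathcomp Require Import all_classical all_reals all_analysis.
From mathcomp Require Import complex.

Set Implicit Arguments.
Unset Strict Implicit.
Unset Printing Implicit Defensive.

Import Order.TTheory GRing.Theory Num.Theory.
Import numFieldNormedType.Exports.

Local Open Scope classical_set_scope.
Local Open Scope ring_scope.
Local Open Scope complex_scope.

(* Points of R^N are N-tuples of reals, with the product of the Borel
   sigma-algebras. *)
Definition Rn (R : realType) (N : nat) : Type := N.-tuple (measurableTypeR R).
HB.instance Definition _ (R : realType) (N : nat) :=
  Measurable.copy (Rn R N) (N.-tuple (measurableTypeR R)).

Definition consRn (R : realType) (n : nat) (p : measurableTypeR R * Rn R n) :
  Rn R n.+1 := [tuple of p.1 :: p.2].

Lemma measurable_consRn (R : realType) (n : nat) :
  measurable_fun [set: measurableTypeR R * Rn R n] (@consRn R n).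
Proof. exact: measurable_cons. Qed.

Definition lebesgueS (R : realType) (n : nat)
    (mu : {sigma_finite_measure set (Rn R n) -> \bar R}) :
    set (Rn R n.+1) -> \bar R :=
  pushforward (@lebesgue_measure R \x mu)%E (@consRn R n).

Section lebesgueS_measure.
Local Open Scope ereal_scope.
Context (R : realType) (n : nat)
        (mu : {sigma_finite_measure set (Rn R n) -> \bar R}).

Let lebesgueS0 : lebesgueS mu set0 = 0.
Proof. by rewrite /lebesgueS /pushforward preimage_set0 measure0. Qed.

Let lebesgueS_ge0 A : 0 <= lebesgueS mu A.
Proof. by rewrite /lebesgueS /pushforward measure_ge0. Qed.

Let lebesgueS_sigma_additive : semi_sigma_additive (lebesgueS mu).
Proof.
move=> F mF tF mUF; rewrite /lebesgueS /pushforward preimage_bigcup.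
apply: measure_semi_sigma_additive.
- by move=> k; rewrite -[X in measurable X]setTI; exact: measurable_consRn.
- apply/trivIsetP => /= i j _ _ ij; rewrite -preimage_setI.
  by move/trivIsetP : tF => /(_ _ _ _ _ ij) ->//; rewrite preimage_set0.
- rewrite -preimage_bigcup -[X in measurable X]setTI.
  exact: measurable_consRn.
Qed.

HB.instance Definition _ := isMeasure.Build _ _ _
  (lebesgueS mu) lebesgueS0 lebesgueS_ge0 lebesgueS_sigma_additive.

Let lebesgueS_sigma_finite : sigma_finite setT (lebesgueS mu).
Proof.
have /sigma_finiteP[A [AT ndA Aoo]] := sigma_finiteT (@lebesgue_measure R).
have /sigma_finiteP[B [BT ndB Boo]] := sigma_finiteT mu.
pose F k := A k `*` B k.
have FT : [set: measurableTypeR R * Rn R n] = \bigcup_k F k.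
  rewrite -setXTT AT BT predeqE => -[x y]; split.
    move=> [/= [i _ Aix] [j _ Bjy]]; exists (maxn i j) => //; split.
    - by move: x Aix; exact/subsetPset/ndA/leq_maxl.
    - by move: y Bjy; exact/subsetPset/ndB/leq_maxr.
  by move=> [i _ []/= ? ?]; split; exists i.
have Foo k : measurable (F k) /\ (lebesgue_measure \x mu) (F k) < +oo.
  have [? ?] := Aoo k; have [? ?] := Boo k; split; first exact: measurableX.
  by rewrite product_measure1E// lte_mul_pinfty// ge0_fin_numE.
pose g (x : Rn R n.+1) : measurableTypeR R * Rn R n :=
  (thead x, [tuple of behead x]).
have gK : cancel (@consRn R n) g.
  by move=> [a t]; congr (_, _); exact/val_inj.
have Kg : cancel g (@consRn R n).
  by move=> x; rewrite [RHS]tuple_eta; exact/val_inj.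
have mg : measurable_fun setT g.
  apply: measurable_fun_pair; last exact: measurable_behead.
  exact: measurable_tnth.
exists (fun k => g @^-1` F k) => [|k].
  by rewrite -preimage_bigcup -FT preimage_setT.
have [mF Fk] := Foo k; split.
  by rewrite -[X in measurable X]setTI; exact: mg.
rewrite /lebesgueS /pushforward -comp_preimage.
by rewrite (_ : g \o _ = id)//; apply/funext => p /=; rewrite gK.
Qed.

HB.instance Definition _ := Measure_isSigmaFinite.Build _ _ _
  (lebesgueS mu) lebesgueS_sigma_finite.

End lebesgueS_measure.

(* Lebesgue measure on R^N, as an iterated product of the one-dimensional one;
   [lebesgue_box] below gives its value on boxes. *)
Fixpoint lebesgue (R : realType) (N : nat) :
    {sigma_finite_measure set (Rn R N) -> \bar R} :=
  match N with
  | 0%N => \d_([tuple] : Rn R 0)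
  | n.+1 => lebesgueS (lebesgue R n)
  end.

Lemma lebesgue_box (R : realType) (N : nat)
    (A : 'I_N -> set (measurableTypeR R)) :
  (forall i, measurable (A i)) ->
  lebesgue R N [set x | forall i, A i (tnth x i)] =
  (\prod_(i < N) lebesgue_measure (A i))%E.
Proof.
elim: N A => [|n IH] A mA /=.
  rewrite big_ord0 diracE mem_set//; by case.
rewrite big_ord_recl -(IH (fun i => A (lift ord0 i)))//.
rewrite /lebesgueS /pushforward -product_measure1E//; last first.
  rewrite (_ : mkset _ = \bigcap_(i in [set: 'I_n])
     ((@tnth n (measurableTypeR R) ^~ i) @^-1` A (lift ord0 i))); last first.
    by apply/seteqP; split=> x /= h i => [_|]; exact: h.
  apply: fin_bigcap_measurable; first exact: finite_finset.
  move=> i _; rewrite -[X in measurable X]setTI.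
  exact: measurable_tnth.
congr (_ _); apply/seteqP; split=> -[a t] /=.
  move=> h; split; first by have := h ord0; rewrite tnth0.
  by move=> i; have := h (lift ord0 i); rewrite tnthS.
move=> [ha ht] i; case: (unliftP ord0 i) => [j|] ->; last by rewrite tnth0.
by rewrite tnthS; exact: ht.
Qed.

Section complex_valued_functions.
Context (R : realType) (N : nat).
Local Notation mu := (lebesgue R N).
Implicit Types f g : Rn R N -> R[i].

Definition cmeasurable f :=
  measurable_fun setT (fun x => complex.Re (f x)) /\
  measurable_fun setT (fun x => complex.Im (f x)).

Definition cintegral (D : set (Rn R N)) f : R[i] :=
  (\int[mu]_(x in D) complex.Re (f x)) +i*
  (\int[mu]_(x in D) complex.Im (f x)).

Definition L2norm f : \bar R :=
  ('N[mu]_(2%:E)[(fun x => (Normc.normc (f x))%:E)])%E.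

Definition L2 f := cmeasurable f /\ (L2norm f < +oo)%E.

Definition inner f g : R[i] := cintegral setT (fun x => f x * conjc (g x)).

End complex_valued_functions.

(* Operators on L^2 are maps on representatives.  The second and third clauses
   together imply that they respect equality almost everywhere. *)
Definition bounded_operator (R : realType) (N : nat)
    (T : (Rn R N -> R[i]) -> (Rn R N -> R[i])) : Prop :=
  [/\ forall f, L2 f -> L2 (T f),
      forall (a : R[i]) f g, L2 f -> L2 g ->
        {ae lebesgue R N, forall x,
          T (fun y => a * f y + g y) x = a * T f x + T g x}
    & exists K : R, forall f, L2 f -> (L2norm (T f) <= K%:E * L2norm f)%E].

(* This determines [Tstar] on L^2 up to equality almost everywhere. *)
Definition is_adjoint (R : realType) (N : nat)
    (T Tstar : (Rn R N -> R[i]) -> (Rn R N -> R[i])) : Prop :=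
  (forall g, L2 g -> L2 (Tstar g)) /\
  (forall f g, L2 f -> L2 g -> inner (T f) g = inner f (Tstar g)).

(* The cube with level k and position j is the product over i of the intervals
   [j_i 2^k, (j_i + 1) 2^k). *)
Record dyadic (N : nat) := Dyadic { level : int; pos : N.-tuple int }.

Section dyadic_lattice.
Context (R : realType) (N : nat).
Implicit Types Q S : dyadic N.

Definition side Q : R := 2 ^ level Q.

Definition cube Q : set (Rn R N) :=
  [set x | forall i : 'I_N,
    (tnth (pos Q) i)%:~R * side Q <= tnth x i
                                  < ((tnth (pos Q) i)%:~R + 1) * side Q].

Definition child S Q : Prop := side S = side Q / 2 /\ cube S `<=` cube Q.

Fixpoint walk (n : nat) Q S : Prop :=
  match n with
  | 0%N => Q = S
  | m.+1 => exists2 P, child P Q \/ child Q P & walk m P S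
  end.

(* The infimum of the empty set is +oo, so cubes that are not connected are at
   infinite distance. *)
Definition dtree Q S : \bar R :=
  ereal_inf [set n%:R%:E | n in [set n : nat | walk n Q S]].

Definition haar Q (h : Rn R N -> R[i]) : Prop :=
  [/\ forall x, ~ cube Q x -> h x = 0,
      forall S, child S Q -> exists c, forall x, cube S x -> h x = c
    & cintegral (cube Q) h = 0].

End dyadic_lattice.

Definition band_operator (R : realType) (N r : nat)
    (T : (Rn R N -> R[i]) -> (Rn R N -> R[i])) : Prop :=
  bounded_operator T /\
  forall (Q S : dyadic N) hQ hS, (r%:R%:E < dtree R Q S)%E ->
    haar Q hQ -> haar S hS -> inner (T hQ) hS = 0.

Section weights.
Context (R : realType) (N : nat).
Local Notation mu := (lebesgue R N).
Implicit Types (u v w : Rn R N -> R) (Q S : dyadic N).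

Definition L1loc w : Prop :=
  measurable_fun setT w /\
  forall K : set (Rn R N), measurable K ->
    (exists M : R, forall x, K x -> forall i, `|tnth x i : R| <= M) ->
    mu.-integrable K (EFin \o w).

Definition weight w : Prop := (forall x, 0 <= w x) /\ L1loc w.

Definition restr Q w : Rn R N -> R[i] := fun x => (\1_(cube Q) x * w x)%:C.

Definition trunc w (n : nat) : Rn R N -> R := fun x => Num.min (w x) n%:R.

(* An inequality containing T(chi_Q w) has to hold with chi_Q w replaced by each
   element of [readings Q w]: by chi_Q w itself if it is in L^2, and otherwise
   by each of the functions chi_Q min(w, n), n >= 1. *)
Definition readings Q w : set (Rn R N -> R[i]) :=
  [set g | (L2 (restr Q w) /\ g = restr Q w) \/
           (~ L2 (restr Q w) /\
            exists2 n : nat, (0 < n)%N & g = restr Q (trunc w n))].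

Definition weak_bound (r : nat) (T : (Rn R N -> R[i]) -> (Rn R N -> R[i]))
    u v (C : R) : Prop :=
  forall Q S, 2 ^- r * side R Q <= side R S <= 2 ^+ r * side R Q ->
  forall g h, readings Q u g -> readings S v h ->
    Normc.normc (inner (T g) h) <=
    C * Num.sqrt (\int[mu]_(x in cube Q) u x)
      * Num.sqrt (\int[mu]_(x in cube S) v x).

Definition testing (T : (Rn R N -> R[i]) -> (Rn R N -> R[i])) u v (C : R) :=
  forall Q g, readings Q u g ->
    (\int[mu]_(x in cube Q) (Normc.normc (T g x) ^+ 2 * v x)%:E <=
     C%:E * \int[mu]_(x in cube Q) (u x)%:E)%E.

Definition mult (phi : Rn R N -> R) (f : Rn R N -> R[i]) : Rn R N -> R[i] :=
  fun x => (phi x)%:C * f x.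

Definition sqrtw w : Rn R N -> R := fun x => Num.sqrt (w x).

(* The norm of M_v^{1/2} T M_u^{1/2} is at most B. *)
Definition two_weight_bound (T : (Rn R N -> R[i]) -> (Rn R N -> R[i]))
    u v (B : R) : Prop :=
  forall f, L2 f -> L2 (mult (sqrtw u) f) ->
    (L2norm (mult (sqrtw v) (T (mult (sqrtw u) f))) <= B%:E * L2norm f)%E.

End weights.

(* Main.v *)
From HB Require Import structures.
Require Import Defs.
From mathcomp Require Import all_boot all_order all_algebra.
From mathcomp Require Import all_classical all_reals all_analysis.
From mathcomp Require Import measurable_realfun complex.
From mathcomp Require Import ring lra zify.

(** The operator is split into its real and imaginary parts. Each part is a
pair (S, S') of maps on real square integrable functions, adjoint to each
other, bounded, and such that a function with mean zero on a cube Q and zero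
off Q is sent to a function that is zero off the r-th dyadic ancestor of Q
([localized]); this is all that is kept of the band condition.

Necessity is duality. If w is chi_Q u or a truncation of it, then f = w /
u^(1/2) satisfies u^(1/2) f = w and int f^2 <= int_Q u, so the norm inequality
for f is the first testing condition; pairing with z / v^(1/2) for a
truncation z of chi_R v gives the weak bound, and the condition on the adjoint
follows by testing against truncations of u^(1/2) S'(z).

The core of sufficiency is a statement about a finite set X with nested
partitions and a matrix t ([discrete_two_weight]). Both vectors are expanded
in weighted martingale differences. Products of differences whose generations
are at most r apart are block diagonal and are controlled by the weak bound.
What is left are two paraproducts; a paraproduct is controlled by the Carleson
embedding theorem, and the Carleson condition that it needs is the testing
condition.

To use it, a large box is cut into small cubes, the leaves, and t is the
matrix of S between truncations of chi_x u and chi_y v. The hypotheses speak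
of chi_Q u itself when it is square integrable and of truncations otherwise,
so on some cubes they give no direct information on truncations. There are
finitely many cubes, and on each of them the error made by truncating tends to
zero ([leaf_tail]): near the diagonal by the testing condition or by
boundedness, and off the diagonal because the kernel is bounded there. The
errors are absorbed since the nonzero masses of leaves are bounded from below.
The outcome ([step_bound]) is the norm inequality for step functions, tested
against an arbitrary function h: the part of h with mean zero on the leaves
only sees the block below which it lies, and there testing applies.

A bounded function f can be approximated by step functions only in L^1(u). The
Calderon-Zygmund decomposition turns this into information on S: outside a set
of small measure, S(b) is small in L^2 when b is small in L^1 ([weak_type]).
The exceptional set costs nothing in the limit because S(f u)^2 is integrable
([bounded_in_box]). Truncating in f and monotone convergence in v finish the
proof ([real_sufficiency], [sufficiency]). *)

Set Implicit Arguments.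
Unset Strict Implicit.
Unset Printing Implicit Defensive.
Import Order.TTheory GRing.Theory Num.Theory.
Import numFieldNormedType.Exports.
Local Open Scope ring_scope.

(** * Weighted conditional expectations on a finite set and the Carleson embedding *)

(** The function a^2 / b is convex: each summand on the right lies above its
tangent 2 s a - s^2 b, and the slope s = A / B makes the tangents sum to the
left-hand side. *)
Lemma sum_sqr_div_ge (R : realFieldType) (I : finType) (P : pred I)
    (a b : I -> R) :
  (forall i, P i -> 0 <= b i) -> (forall i, P i -> b i = 0 -> a i = 0) ->
  (\sum_(i | P i) a i) ^+ 2 / (\sum_(i | P i) b i) <=
  \sum_(i | P i) a i ^+ 2 / b i.
Proof.
move=> b0 ab0; set A := \sum_(i | P i) a i; set B := \sum_(i | P i) b i.
pose s := A / B.
have -> : A ^+ 2 / B = \sum_(i | P i) (2 * s * a i - s ^+ 2 * b i).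
  rewrite big_split /= sumrN -!mulr_sumr -/A -/B /s.
  have [->|Bn0] := eqVneq B 0; first by rewrite invr0; ring.
  by field.
apply: ler_sum => i Pi; have [bi0|bn0] := eqVneq (b i) 0.
  by rewrite (ab0 _ Pi bi0) bi0; lra.
have bi : 0 < b i by rewrite lt_neqAle eq_sym bn0 b0.
rewrite -subr_ge0.
have -> : a i ^+ 2 / b i - (2 * s * a i - s ^+ 2 * b i) =
   (a i - s * b i) ^+ 2 / b i by field.
by rewrite divr_ge0 ?sqr_ge0// ltW.
Qed.

Lemma ler_abs_sqrt (R : rcfType) (a b : R) : a ^+ 2 <= b -> `|a| <= Num.sqrt b.
Proof. by move=> ab; rewrite -sqrtr_sqr ler_wsqrtr. Qed.

Lemma sum_CS2 (R : realFieldType) (I : finType) (P : pred I) (w a b : I -> R) :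
  (forall i, P i -> 0 <= w i) ->
  (\sum_(i | P i) w i * a i * b i) ^+ 2 <=
  (\sum_(i | P i) w i * a i ^+ 2) * (\sum_(i | P i) w i * b i ^+ 2).
Proof.
move=> w0.
have h1 i : P i -> 0 <= w i * b i ^+ 2.
  by move=> Pi; rewrite mulr_ge0 ?w0 ?sqr_ge0.
have h2 i : P i -> w i * b i ^+ 2 = 0 -> w i * a i * b i = 0.
  by move=> _ /eqP; rewrite mulf_eq0 sqrf_eq0 => /orP[] /eqP ->; ring.
have := sum_sqr_div_ge h1 h2.
have : 0 <= \sum_(i | P i) w i * b i ^+ 2 by apply: sumr_ge0.
set A := (\sum_(i | P i) _); set B := (\sum_(i | P i) _).
have : \sum_(i | P i) (w i * a i * b i) ^+ 2 / (w i * b i ^+ 2) <=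
    \sum_(i | P i) w i * a i ^+ 2.
  apply: ler_sum => i Pi; have [->|bn0] := eqVneq (b i) 0.
    by rewrite mulr0 expr0n /= mul0r mulr_ge0 ?w0 ?sqr_ge0.
  have [->|wn0] := eqVneq (w i) 0; first by rewrite !mul0r expr0n /= mul0r.
  by rewrite le_eqVlt; apply/orP; left; apply/eqP; field; rewrite bn0 wn0.
set s1 := (\sum_(i | P i) _); set s2 := (\sum_(i | P i) _) => s12 A0 s21.
have [A00|An0] := eqVneq A 0; last first.
  rewrite -ler_pdivrMr; first exact: le_trans s21 s12.
  by rewrite lt_neqAle eq_sym An0.
rewrite A00 mulr0.
have -> : B = 0; last by rewrite expr0n.
rewrite /B big1// => i Pi; apply: h2 => //.
have /eqP := A00; rewrite /A psumr_eq0// => /allP /(_ i).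
by rewrite mem_index_enum Pi => /(_ isT)/= /eqP.
Qed.

Lemma sum_CS (R : rcfType) (I : finType) (P : pred I) (w a b : I -> R) :
  (forall i, P i -> 0 <= w i) ->
  `|\sum_(i | P i) w i * a i * b i| <=
  Num.sqrt (\sum_(i | P i) w i * a i ^+ 2) *
  Num.sqrt (\sum_(i | P i) w i * b i ^+ 2).
Proof.
move=> w0; rewrite -sqrtrM; first exact/ler_abs_sqrt/sum_CS2.
by apply: sumr_ge0 => i Pi; rewrite mulr_ge0 ?w0 ?sqr_ge0.
Qed.

Lemma sum_sqrt_CS (R : rcfType) (I : finType) (P : pred I) (a b : I -> R) :
  (forall i, P i -> 0 <= a i) -> (forall i, P i -> 0 <= b i) ->
  \sum_(i | P i) Num.sqrt (a i) * Num.sqrt (b i) <=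
  Num.sqrt (\sum_(i | P i) a i) * Num.sqrt (\sum_(i | P i) b i).
Proof.
move=> a0 b0.
have := @sum_CS R I P (fun=> 1) (fun i => Num.sqrt (a i))
  (fun i => Num.sqrt (b i)) (fun _ _ => ler01).
under eq_bigr do rewrite mul1r.
under [X in Num.sqrt X * _]eq_bigr => i Pi do rewrite mul1r sqr_sqrtr ?a0//.
under [X in _ * Num.sqrt X]eq_bigr => i Pi do rewrite mul1r sqr_sqrtr ?b0//.
exact/le_trans/ler_norm.
Qed.

Section tower.
Variables (R : rcfType) (X : finType) (p : nat -> X -> X).
Hypothesis pS : forall k x, p k.+1 (p k x) = p k.+1 x.
Hypothesis pid : forall k x, p k (p k x) = p k x.

Lemma rep_coarser j k x y : (j <= k)%N -> p j x = p j y -> p k x = p k y.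
Proof.
move=> /subnK <-; elim: (k - j)%N => [//|n IH] /IH h.
by rewrite addSn -pS h pS.
Qed.

Lemma rep_finer j k x : (j <= k)%N -> p k (p j x) = p k x.
Proof. by move=> jk; apply: (rep_coarser jk); rewrite pid. Qed.

(** [p k x] stands for the class of [x] in the k-th of a sequence of
partitions that get coarser as [k] grows; classes are named by one of their
elements. *)
Definition mass (w : X -> R) k q := \sum_(x | p k x == q) w x.

Lemma mass_refine w j k q : (j <= k)%N ->
  mass w k q = \sum_(q' | p k q' == q) mass w j q'.
Proof.
move=> jk; rewrite /mass (partition_big (p j) (fun q' => p k q' == q))/=; last first.
  by move=> x; rewrite rep_finer.
apply: eq_bigr => q' /eqP kq'; apply: eq_bigl => x.
apply/andP/idP => [[]//|/eqP e]; split; last exact/eqP.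
by rewrite -kq' -e rep_finer.
Qed.

Lemma mass_sum w k : \sum_x w x = \sum_q mass w k q.
Proof. by rewrite /mass (partition_big (p k) predT). Qed.

Lemma mass_ge0 w k q : (forall x, 0 <= w x) -> 0 <= mass w k q.
Proof. by move=> w0; apply: sumr_ge0. Qed.

Lemma mass_eq0 w k x : (forall x, 0 <= w x) -> mass w k (p k x) = 0 -> w x = 0.
Proof.
move=> w0 /eqP; rewrite /mass psumr_eq0// => /allP /(_ x).
by rewrite mem_index_enum eqxx => /(_ isT)/= /eqP.
Qed.

Definition isconst k (g : X -> R) := forall x y, p k x = p k y -> g x = g y.

Lemma isconst_le j k g : (j <= k)%N -> isconst k g -> isconst j g.
Proof. by move=> jk gk x y xy; apply: gk; exact: rep_coarser xy. Qed.

Lemma isconstM k f g : isconst k f -> isconst k g ->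
  isconst k (fun x => f x * g x).
Proof. by move=> fk gk x y xy; rewrite (fk _ _ xy) (gk _ _ xy). Qed.

Lemma isconstB k f g : isconst k f -> isconst k g ->
  isconst k (fun x => f x - g x).
Proof. by move=> fk gk x y xy; rewrite (fk _ _ xy) (gk _ _ xy). Qed.

Section expectation.
Variable u : X -> R.
Hypothesis u0 : forall x, 0 <= u x.

(** Division by zero gives 0 on a class of mass zero, which agrees with the
vanishing of every weighted sum over such a class ([mass_weighted0]). *)
Definition cexp k f x := mass (fun z => u z * f z) k (p k x) / mass u k (p k x).
Definition cdiff k f x := cexp k f x - cexp k.+1 f x.

Lemma cexp_const k f : isconst k (cexp k f).
Proof. by move=> x y; rewrite /cexp => ->. Qed.

Lemma cdiff_const k f : isconst k (cdiff k f).
Proof.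
apply: isconstB; first exact: cexp_const.
by apply: (isconst_le (leqnSn k)); exact: cexp_const.
Qed.

Lemma mass_weighted0 f k q : mass u k q = 0 -> mass (fun z => u z * f z) k q = 0.
Proof.
move=> m0; rewrite /mass big1// => x /eqP xq.
by rewrite -xq in m0; rewrite (mass_eq0 u0 m0) mul0r.
Qed.

(** [cexp k] is the orthogonal projection onto functions constant on the k-th
classes: both sides agree class by class. *)
Lemma sum_cexp k f g : isconst k g ->
  \sum_x u x * cexp k f x * g x = \sum_x u x * f x * g x.
Proof.
move=> gk; rewrite (mass_sum _ k) [RHS](mass_sum _ k); apply: eq_bigr => q _.
have /= h : forall (h : X -> R), mass (fun x => h x * g x) k q = g q * mass h k q.
  move=> h; rewrite /mass mulr_sumr; apply: eq_bigr => x /eqP xq.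
  by rewrite mulrC; congr (_ * _); apply: gk; rewrite -xq pid.
rewrite !h; congr (_ * _).
have -> : mass (fun x => u x * cexp k f x) k q =
    mass u k q * (mass (fun z => u z * f z) k q / mass u k q).
  rewrite {1 2}/mass mulr_suml; apply: eq_bigr => x /eqP xq.
  by rewrite /cexp xq.
have [m0|m0] := eqVneq (mass u k q) 0; first by rewrite m0 mul0r mass_weighted0.
by rewrite mulrC divfK.
Qed.

Lemma sum_cexp_sqr k f g : isconst k g ->
  \sum_x u x * cexp k f x ^+ 2 * g x = \sum_x u x * f x * cexp k f x * g x.
Proof.
move=> gk; have h := @sum_cexp k f (fun x => cexp k f x * g x) (isconstM (@cexp_const k f) gk).
transitivity (\sum_x u x * cexp k f x * (cexp k f x * g x)).
  by apply: eq_bigr => x _; ring.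
by rewrite h; apply: eq_bigr => x _; ring.
Qed.

Lemma cdiff_orthogonal k f g : isconst k.+1 g -> \sum_x u x * cdiff k f x * g x = 0.
Proof.
move=> gk; have gk' := isconst_le (leqnSn k) gk.
under eq_bigr do rewrite /cdiff mulrBr mulrBl.
by rewrite big_split /= sumrN !sum_cexp// subrr.
Qed.

(** The difference of the two sides is the weighted norm of [f - cexp k f]. *)
Lemma cexp_contraction k f g : isconst k g -> (forall x, 0 <= g x) ->
  \sum_x u x * cexp k f x ^+ 2 * g x <= \sum_x u x * f x ^+ 2 * g x.
Proof.
move=> gk g0; rewrite -subr_ge0.
have -> : \sum_x u x * f x ^+ 2 * g x - \sum_x u x * cexp k f x ^+ 2 * g x =
   \sum_x u x * (f x - cexp k f x) ^+ 2 * g x; last first.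
  by apply: sumr_ge0 => x _; do 2!apply: mulr_ge0 => //; exact: sqr_ge0.
have -> : \sum_x u x * (f x - cexp k f x) ^+ 2 * g x =
  \sum_x u x * f x ^+ 2 * g x + \sum_x u x * cexp k f x ^+ 2 * g x
   - 2 * \sum_x u x * f x * cexp k f x * g x.
  rewrite mulr_sumr -sumrN -!big_split /=; apply: eq_bigr => x _; ring.
rewrite -sum_cexp_sqr//; ring.
Qed.

Lemma cdiff_pythagoras k f g : isconst k.+1 g ->
  \sum_x u x * cexp k f x ^+ 2 * g x =
  \sum_x u x * cexp k.+1 f x ^+ 2 * g x + \sum_x u x * cdiff k f x ^+ 2 * g x.
Proof.
move=> gk.
have := @cdiff_orthogonal k f (fun x => cexp k.+1 f x * g x) (isconstM (@cexp_const k.+1 f) gk).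
move=> h; apply/eqP; rewrite -subr_eq0; apply/eqP.
rewrite -[RHS](mulr0 2) -[in RHS]h mulr_sumr -big_split -sumrB /=.
by apply: eq_bigr => x _; rewrite /cdiff; ring.
Qed.

(** Differences of different generations are orthogonal, so the sum
telescopes; the factor [g] localizes the inequality to a union of classes. *)
Lemma cdiff_bessel n f g : (forall x, 0 <= g x) -> isconst n g ->
  \sum_(k < n) \sum_x u x * cdiff k f x ^+ 2 * g x <= \sum_x u x * f x ^+ 2 * g x.
Proof.
move=> g0 gn.
have -> : \sum_(k < n) \sum_x u x * cdiff k f x ^+ 2 * g x =
    \sum_x u x * cexp 0 f x ^+ 2 * g x - \sum_x u x * cexp n f x ^+ 2 * g x.
  elim: n gn => [|n IH] gn; first by rewrite big_ord0 subrr.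
  rewrite big_ord_recr /= IH; last exact: (isconst_le (leqnSn n)).
  by rewrite (cdiff_pythagoras _ gn); ring.
apply: (@le_trans _ _ (\sum_x u x * cexp 0 f x ^+ 2 * g x)).
  rewrite gerBl; apply: sumr_ge0 => x _.
  by do 2!apply: mulr_ge0 => //; exact: sqr_ge0.
by apply: cexp_contraction => //; apply: isconst_le gn.
Qed.

(** Proof by a Bellman function. With W the mass of a class, M the amount of w
collected below it so far and phi the weighted sum of f, the quantity [S k],
the sum of phi^2 / (W + M) over the k-th classes, decreases in k: merging
classes does not increase it by convexity ([sum_sqr_div_ge]), and adding the
next term m to M lowers it by at least m (phi / W)^2 / 4, because M + m <= W
by hypothesis. The shift [s] lets [w k] be attached to the classes of
generation [k + s]. *)
Lemma carleson_embedding s n (w : nat -> X -> R) f :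
  (forall k x, 0 <= w k x) ->
  (forall j q, (j < n)%N ->
     mass (fun x => \sum_(k < j.+1) w k x) (j + s) q <= mass u (j + s) q) ->
  \sum_(k < n) \sum_x w k x * cexp (k + s) f x ^+ 2 <= 4 * \sum_x u x * f x ^+ 2.
Proof.
move=> w0 carl.
pose phi k q := mass (fun z => u z * f z) (k + s) q.
pose W k q := mass u (k + s) q.
pose M k q := mass (fun x => \sum_(j < k.+1) w j x) (k + s) q.
pose S k := \sum_q phi k q ^+ 2 / (W k q + M k q).
have W0 k q : 0 <= W k q by exact: mass_ge0.
have M0 k q : 0 <= M k q by apply: mass_ge0 => x; apply: sumr_ge0.
have phi0 k q : W k q = 0 -> phi k q = 0 by exact: mass_weighted0.
(* one step of the Bellman argument, on a single class *)
have gain (F A B m : R) : 0 <= A -> 0 <= B -> 0 <= m -> B + m <= A ->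
  (A = 0 -> F = 0) ->
  F ^+ 2 / (A + (B + m)) + 4^-1 * (m * (F / A) ^+ 2) <= F ^+ 2 / (A + B).
  move=> A0 B0 m0 BmA AF; have [AE|An0] := eqVneq A 0.
    by rewrite AF// AE; lra.
  have Ap : 0 < A by rewrite lt_neqAle eq_sym An0.
  have p1 : 0 < A + B by lra.
  have p2 : 0 < A + (B + m) by lra.
  rewrite -lerBrDl.
  have -> : F ^+ 2 / (A + B) - F ^+ 2 / (A + (B + m)) =
     (m * F ^+ 2) * ((A + B)^-1 * (A + (B + m))^-1).
    by field; rewrite !lt0r_neq0.
  rewrite expr_div_n.
  have -> : 4^-1 * (m * (F ^+ 2 / A ^+ 2)) = (m * F ^+ 2) * (4 * A ^+ 2)^-1.
    by field.
  apply: ler_wpM2l; first by rewrite mulr_ge0 ?sqr_ge0.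
  rewrite -invfM lef_pV2 ?posrE ?mulr_gt0 ?exprn_gt0//.
  rewrite (_ : 4 * A ^+ 2 = (2 * A) * (2 * A)); last by ring.
  by apply: ler_pM; lra.
have sumE k : \sum_x w k x * cexp (k + s) f x ^+ 2 =
    \sum_q mass (w k) (k + s) q * (phi k q / W k q) ^+ 2.
  rewrite (mass_sum _ (k + s)); apply: eq_bigr => q _.
  by rewrite {1 2}/mass mulr_suml; apply: eq_bigr => x /eqP xq; rewrite /cexp xq.
have MS k q : M k.+1 q =
    (\sum_(q' | p (k.+1 + s) q' == q) M k q') + mass (w k.+1) (k.+1 + s) q.
  rewrite /M {1}/mass; under eq_bigr do rewrite big_ord_recr /=.
  rewrite big_split /=; congr (_ + _).
  rewrite -[LHS]/(mass (fun x => \sum_(j < k.+1) w j x) (k.+1 + s) q).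
  by apply: mass_refine; rewrite addSn.

have step k : (k.+1 < n)%N ->
  S k.+1 + 4^-1 * (\sum_x w k.+1 x * cexp (k.+1 + s) f x ^+ 2) <= S k.
  move=> kn; rewrite sumE /S mulr_sumr -big_split /=.
  rewrite [leRHS](partition_big (p (k.+1 + s)) predT)//=.
  apply: ler_sum => q _.
  apply: le_trans (sum_sqr_div_ge _ _); last 2 first.
  - by move=> q' _; rewrite addr_ge0.
  - move=> q' _ h; apply: phi0; apply/eqP; rewrite eq_le W0 andbT.
    by rewrite -h lerDl.
  rewrite big_split /= MS.
  have kk : (k + s <= k.+1 + s)%N by rewrite addSn.
  rewrite -(mass_refine u q kk) -(mass_refine _ q kk).
  have -> : \sum_(q' | p (k.+1 + s) q' == q) phi k q' = phi k.+1 q.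
    by rewrite /phi -mass_refine.
  apply: gain => //.
  - by apply: mass_ge0 => x; apply: sumr_ge0.
  - exact: mass_ge0.
  - have := carl k.+1 q kn; rewrite -/(M k.+1 q) MS -mass_refine//.
  - exact: phi0.
have base : (0 < n)%N ->
  S 0%N + 4^-1 * (\sum_x w 0%N x * cexp (0 + s) f x ^+ 2) <= \sum_x u x * f x ^+ 2.
  move=> n0; rewrite sumE /S mulr_sumr -big_split /= [leRHS](mass_sum _ (0 + s)).
  apply: ler_sum => q _.
  have M0E : M 0%N q = mass (w 0%N) (0 + s) q.
    by rewrite /M; apply: eq_bigr => x _; rewrite big_ord1.
  have := @gain (phi 0%N q) (W 0%N q) 0 (M 0%N q) (W0 _ _) (lexx _) (M0 _ _).
  rewrite add0r addr0 => /(_ (carl _ _ n0) (phi0 _ _)).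
  rewrite -M0E => /le_trans; apply.
  rewrite /phi /W /mass; apply: le_trans (sum_sqr_div_ge _ _) _ => //.
  - by move=> x _ ->; rewrite mul0r.
  - apply: ler_sum => x _; have [->|ux] := eqVneq (u x) 0.
      by rewrite !mul0r expr0n/= mul0r.
    by rewrite le_eqVlt; apply/orP; left; apply/eqP; field.
have S0 k : 0 <= S k.
  by apply: sumr_ge0 => q _; rewrite divr_ge0 ?sqr_ge0// addr_ge0.
case: n carl step base => [|n] carl step base.
  rewrite big_ord0 mulr_ge0// sumr_ge0// => x _.
  by rewrite mulr_ge0 ?sqr_ge0.
have tot j : (j <= n)%N -> S j + 4^-1 *
  (\sum_(k < j.+1) \sum_x w k x * cexp (k + s) f x ^+ 2) <= \sum_x u x * f x ^+ 2.
  elim: j => [_|j IH jn]; first by rewrite big_ord1; exact: base.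
  rewrite big_ord_recr /= mulrDr [_ + 4^-1 * _]addrC addrA.
  apply: le_trans (IH (ltnW jn)); rewrite lerD2r.
  exact: step.
have := tot n (leqnn n); have := S0 n.
set Z := (\sum_(k < _) _); set Y := (\sum_x _); lra.
Qed.

End expectation.
End tower.

(** * The two-weight estimate for a matrix with band structure *)

Section form.
Variables (R : rcfType) (X : finType) (p : nat -> X -> X).
Hypothesis pS : forall k x, p k.+1 (p k x) = p k.+1 x.
Hypothesis pid : forall k x, p k (p k x) = p k x.

Definition bil (t : X -> X -> R) (F G : X -> R) :=
  \sum_x \sum_y t x y * F x * G y.

Lemma bilBl t F1 F2 G :
  bil t (fun x => F1 x - F2 x) G = bil t F1 G - bil t F2 G.
Proof.
rewrite /bil -sumrB; apply: eq_bigr => x _; rewrite -sumrB.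
by apply: eq_bigr => y _; ring.
Qed.

Lemma bilC t F G : bil t F G = bil (fun x y => t y x) G F.
Proof.
rewrite /bil exchange_big; apply: eq_bigr => x _; apply: eq_bigr => y _; ring.
Qed.

Lemma bilBr t F G1 G2 :
  bil t F (fun x => G1 x - G2 x) = bil t F G1 - bil t F G2.
Proof. by rewrite bilC bilBl -!(bilC t). Qed.

Variables (r Mc : nat) (c : R).
Hypothesis c0 : 0 < c.
Variables (u v : X -> R) (t : X -> X -> R).
Hypotheses (u0 : forall x, 0 <= u x) (v0 : forall x, 0 <= v x).
Hypothesis t_v : forall x y, v y = 0 -> t x y = 0.
Hypothesis weak : forall k1 k2 q1 q2, (k1 <= k2 + r)%N -> (k2 <= k1 + r)%N ->
  `|\sum_(x | p k1 x == q1) \sum_(y | p k2 y == q2) t x y| <=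
  c * (Num.sqrt (mass p u k1 q1) * Num.sqrt (mass p v k2 q2)).
Hypothesis test : forall k q h,
  `|\sum_(x | p k x == q) \sum_(y | p k y == q) t x y * h y| <=
  c * (Num.sqrt (mass p u k q) *
       Num.sqrt (mass p (fun y => v y * h y ^+ 2) k q)).
(* the band condition: far from the diagonal, entries are proportional to v on
   each class *)
Hypothesis loc : forall k x y z, p k y = p k z -> p (k + r) x != p (k + r) y ->
  t x y * v z = t x z * v y.
Hypothesis count : forall k j q, (k <= j)%N -> (j <= k + r.+1)%N ->
  (#|[set p k x | x in [pred x | p j x == q]]| <= Mc)%N.

Notation nm w f := (Num.sqrt (\sum_x w x * f x ^+ 2)).

(** By [loc], the row of [x] seen on a k-class outside the (k + r)-class of
[x] is proportional to [v], so it annihilates functions of mean zero. *)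
Lemma off_diagonal k G : (forall q, mass p (fun y => v y * G y) k q = 0) ->
  forall x q, p (k + r) x != p (k + r) q ->
  mass p (fun y => t x y * G y) k q = 0.
Proof.
move=> G0 x q xq.
have [V0|Vn0] := eqVneq (mass p v k q) 0.
  rewrite /mass big1// => y /eqP yq; rewrite -yq in V0.
  by rewrite t_v ?mul0r//; apply: (mass_eq0 v0 V0).
apply: (mulfI Vn0); rewrite mulr0 {1}/mass mulr_suml.
transitivity (\sum_(z | p k z == q) t x z * mass p (fun y => v y * G y) k q).
  apply: eq_bigr => z /eqP zq; rewrite /mass !mulr_sumr.
  apply: eq_bigr => y /eqP yq.
  have xy : p (k + r) x != p (k + r) y.
    by rewrite -(rep_finer pS pid y (leq_addr r k)) yq.
  have e : t x y * v z = t x z * v y by apply: loc xy; rewrite yq zq.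
  have -> : v z * (t x y * G y) = (t x y * v z) * G y by ring.
  by rewrite e; ring.
by rewrite big1// => z _; rewrite G0 mulr0.
Qed.

Lemma bil_block_diagonal k F G : (forall q, mass p (fun y => v y * G y) k q = 0) ->
  bil t F G =
  \sum_x \sum_(y | p (k + r) y == p (k + r) x) t x y * F x * G y.
Proof.
move=> G0; rewrite /bil; apply: eq_bigr => x _.
have h (P : pred X) : \sum_(y | P y) t x y * F x * G y =
    F x * \sum_(y | P y) t x y * G y.
  by rewrite mulr_sumr; apply: eq_bigr => y _; ring.
rewrite !h; congr (_ * _).
rewrite -[RHS]/(mass p (fun y => t x y * G y) (k + r) (p (k + r) x)).
rewrite (mass_sum p _ k) (mass_refine pS pid _ _ (leq_addr r k)).
rewrite (bigID (fun q => p (k + r) q == p (k + r) x)) /= [X in _ + X]big1.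
  by rewrite addr0.
by move=> q xq; apply: off_diagonal => //; rewrite eq_sym.
Qed.

Lemma block_sum_bound (Y : finType) (e : X -> Y) k (w F : X -> R) P :
  (forall x, 0 <= w x) ->
  (forall x y, p k x = p k y -> e x = e y) -> isconst p k F ->
  (#|[set p k x | x in [pred x | e x == P]]| <= Mc)%N ->
  \sum_(q in [set p k x | x in [pred x | e x == P]])
     `|F q| * Num.sqrt (mass p w k q) <=
  Num.sqrt Mc%:R * Num.sqrt (\sum_(x | e x == P) w x * F x ^+ 2).
Proof.
move=> w0 ek kF cnt; set I := [set _ | _ in _].
have -> : \sum_(x | e x == P) w x * F x ^+ 2 =
    \sum_(q in I) F q ^+ 2 * mass p w k q.
  rewrite (partition_big (p k) (mem I))/=; last first.
    by move=> x xP; apply/imsetP; exists x.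
  apply: eq_bigr => q /imsetP[z]; rewrite inE => /eqP zP ->.
  rewrite /mass mulr_sumr; apply: eq_big => x.
    apply/andP/idP => [[]//|/eqP xz]; split; last exact/eqP.
    by rewrite (ek _ _ xz) zP.
  move=> /andP[_ /eqP xz]; rewrite mulrC; congr (_ ^+ 2 * _).
  by apply: kF; rewrite pid.
apply: (@le_trans _ _ (\sum_(q in I) Num.sqrt 1 *
    Num.sqrt (F q ^+ 2 * mass p w k q))).
  by apply: ler_sum => q _; rewrite sqrtr1 mul1r sqrtrM ?sqr_ge0// sqrtr_sqr.
apply: le_trans (sum_sqrt_CS _ _) _ => //.
  by move=> q _; rewrite mulr_ge0 ?sqr_ge0 ?mass_ge0.
apply: ler_wpM2r; first exact: sqrtr_ge0.
by rewrite sumr_const ler_wsqrtr// ler_nat.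
Qed.

(** A class of [e] contains at most [Mc] classes of each of the two
generations, so summing the weak bound over pairs of them by Cauchy-Schwarz
costs the factor [Mc]. *)
Lemma block_bound (Y : finType) (e : X -> Y) k1 k2 F G :
  (k1 <= k2 + r)%N -> (k2 <= k1 + r)%N ->
  (forall x y, p k1 x = p k1 y -> e x = e y) ->
  (forall x y, p k2 x = p k2 y -> e x = e y) ->
  (forall P, (#|[set p k1 x | x in [pred x | e x == P]]| <= Mc)%N) ->
  (forall P, (#|[set p k2 x | x in [pred x | e x == P]]| <= Mc)%N) ->
  isconst p k1 F -> isconst p k2 G ->
  bil t F G = \sum_x \sum_(y | e y == e x) t x y * F x * G y ->
  `|bil t F G| <= c * Mc%:R * (nm u F * nm v G).
Proof.
move=> k12 k21 e1 e2 n1 n2 F1 G2 ->.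
pose A P := \sum_(x | e x == P) u x * F x ^+ 2.
pose B P := \sum_(x | e x == P) v x * G x ^+ 2.
have A0 P : 0 <= A P by apply: sumr_ge0 => x _; rewrite mulr_ge0 ?sqr_ge0.
have B0 P : 0 <= B P by apply: sumr_ge0 => x _; rewrite mulr_ge0 ?sqr_ge0.
rewrite (partition_big e predT)//=.
rewrite [\sum_x u x * _](partition_big e predT)//=.
rewrite [\sum_x v x * _](partition_big e predT)//= -/(A _) -/(B _).
apply: le_trans (ler_norm_sum _ _ _) _.
apply: (@le_trans _ _ (\sum_P c * Mc%:R * (Num.sqrt (A P) * Num.sqrt (B P)))).
  2: { rewrite -mulr_sumr; apply: ler_wpM2l; first by rewrite mulr_ge0 ?(ltW c0).
       exact: sum_sqrt_CS. }
apply: ler_sum => P _.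
pose I1 := [set p k1 x | x in [pred x | e x == P]].
pose I2 := [set p k2 x | x in [pred x | e x == P]].
have -> : \sum_(x | e x == P) \sum_(y | e y == e x) t x y * F x * G y =
    \sum_(q in I1) \sum_(q' in I2) F q * G q' *
      \sum_(x | p k1 x == q) \sum_(y | p k2 y == q') t x y.
  rewrite (partition_big (p k1) (mem I1))/=; last first.
    by move=> x xP; apply/imsetP; exists x.
  apply: eq_bigr => q /imsetP[z]; rewrite inE => /eqP zP ->.
  under [RHS]eq_bigr do rewrite mulr_sumr.
  rewrite exchange_big /=; apply: eq_big => x.
    apply/andP/idP => [[]//|/eqP xz]; split; last exact/eqP.
    by rewrite (e1 _ _ xz) zP.
  move=> /andP[/eqP -> /eqP xz].
  rewrite (partition_big (p k2) (mem I2))/=; last first.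
    by move=> y yP; apply/imsetP; exists y.
  apply: eq_bigr => q' /imsetP[z']; rewrite inE => /eqP zP' ->.
  rewrite mulr_sumr; apply: eq_big => y.
    apply/andP/idP => [[]//|/eqP yz]; split; last exact/eqP.
    by rewrite (e2 _ _ yz) zP'.
  move=> /andP[_ /eqP yz].
  rewrite (F1 x (p k1 z)) ?pid// (G2 y (p k2 z')) ?pid//; ring.
apply: (@le_trans _ _ (c * ((\sum_(q in I1) `|F q| * Num.sqrt (mass p u k1 q)) *
    (\sum_(q' in I2) `|G q'| * Num.sqrt (mass p v k2 q'))))).
  apply: le_trans (ler_norm_sum _ _ _) _.
  rewrite mulr_suml mulr_sumr; apply: ler_sum => q _.
  apply: le_trans (ler_norm_sum _ _ _) _.
  rewrite !mulr_sumr; apply: ler_sum => q' _.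
  rewrite 2!normrM; have := weak q q' k12 k21.
  move=> /(ler_wpM2l (mulr_ge0 (normr_ge0 (F q)) (normr_ge0 (G q')))).
  move/le_trans; apply; rewrite le_eqVlt; apply/orP; left; apply/eqP; ring.
rewrite -mulrA ler_pM2l//.
have -> : Mc%:R = Num.sqrt Mc%:R * Num.sqrt Mc%:R :> R.
  by rewrite -expr2 sqr_sqrtr.
rewrite mulrACA; apply: ler_pM.
- by apply: sumr_ge0 => q _; rewrite mulr_ge0 ?normr_ge0 ?sqrtr_ge0.
- by apply: sumr_ge0 => q _; rewrite mulr_ge0 ?normr_ge0 ?sqrtr_ge0.
- exact: block_sum_bound.
- exact: block_sum_bound.
Qed.

Notation cexp_u := (cexp p u).
Notation cexp_v := (cexp p v).
Notation cdiff_u := (cdiff p u).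
Notation cdiff_v := (cdiff p v).

Lemma cdiff_mean0 (w : X -> R) k f q : (forall x, 0 <= w x) ->
  mass p (fun y => w y * cdiff p w k f y) k.+1 q = 0.
Proof.
move=> w0; have := @cdiff_orthogonal _ _ _ pS pid w w0 k f (fun x => (p k.+1 x == q)%:R).
move=> h; rewrite -[RHS]h; last by move=> x y ->.
rewrite /mass [LHS]big_mkcond; apply: eq_bigr => x _.
by case: eqP; rewrite ?mulr1 ?mulr0.
Qed.

Lemma sum_shift_le n i (a : nat -> R) : (forall k, 0 <= a k) ->
  \sum_(k < n) a (k + i)%N <= \sum_(k < n + i) a k.
Proof.
move=> a0; rewrite addnC big_split_ord /= addrC.
under [X in _ <= X + _]eq_bigr do rewrite addnC.
by rewrite lerDl sumr_ge0.
Qed.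

Lemma cdiff_bessel_from (w : X -> R) n i f : (forall x, 0 <= w x) ->
  \sum_(k < n) \sum_x w x * cdiff p w (k + i) f x ^+ 2 <= \sum_x w x * f x ^+ 2.
Proof.
move=> w0.
apply: le_trans (@sum_shift_le n i (fun k => \sum_x w x * cdiff p w k f x ^+ 2) _) _.
  by move=> k; apply: sumr_ge0 => x _; rewrite mulr_ge0 ?sqr_ge0.
have := @cdiff_bessel _ _ _ pS pid w w0 (n + i) f (fun=> 1) (fun=> ler01)
  (fun _ _ _ => erefl).
under eq_bigr do under eq_bigr do rewrite mulr1.
by under [X in _ <= X]eq_bigr do rewrite mulr1.
Qed.

(** Differences whose generations are at most [r] apart only interact inside a
common class of generation [k.+1 + r] ([bil_block_diagonal]); Bessel's
inequality sums the blocks. *)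
Lemma diagonal_bound n i f g : (i <= r)%N ->
  `|\sum_(k < n) bil t (cdiff_u (k + i) f) (cdiff_v k g)| <=
  c * Mc%:R * (nm u f * nm v g).
Proof.
move=> ir; apply: le_trans (ler_norm_sum _ _ _) _.
apply: (@le_trans _ _ (\sum_(k < n) c * Mc%:R *
    (nm u (cdiff_u (k + i) f) * nm v (cdiff_v k g)))).
  apply: ler_sum => k _; apply: (@block_bound _ (p (k.+1 + r)) (k + i) k).
  - by rewrite leq_add2l.
  - by rewrite -addnA leq_addr.
  - by move=> x y; apply: (rep_coarser pS); rewrite addSn -addnS leq_add2l leqW.
  - by move=> x y; apply: (rep_coarser pS); rewrite addSn -addnS leq_addr.
  - move=> P; apply: count; first by rewrite addSn -addnS leq_add2l leqW.
    by rewrite addSn -addnS -addnA leq_add2l leq_addl.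
  - by move=> P; apply: count; rewrite addSn -addnS// leq_addr.
  - exact: cdiff_const.
  - exact: cdiff_const.
  - by apply: bil_block_diagonal => q; exact: cdiff_mean0.
rewrite -mulr_sumr; apply: ler_wpM2l; first by rewrite mulr_ge0 ?(ltW c0).
apply: le_trans (sum_sqrt_CS _ _) _.
- by move=> k _; apply: sumr_ge0 => x _; rewrite mulr_ge0 ?sqr_ge0.
- by move=> k _; apply: sumr_ge0 => x _; rewrite mulr_ge0 ?sqr_ge0.
apply: ler_pM; rewrite ?sqrtr_ge0 ?ler_wsqrtr//; first exact: cdiff_bessel_from.
by have := @cdiff_bessel_from v n 0 g v0; under eq_bigr do rewrite addn0.
Qed.

(** The operator applied to the indicator of a class, as a density with
respect to [v]. *)
Definition tau k q y := (\sum_(x | p k x == q) t x y) / v y.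

Lemma tauE k q y : v y * tau k q y = \sum_(x | p k x == q) t x y.
Proof.
rewrite /tau; have [vy|vy] := eqVneq (v y) 0; last by rewrite mulrC divfK.
by rewrite vy mul0r big1// => x _; rewrite t_v.
Qed.

(** The testing condition, with [tau] itself as the test function. *)
Lemma tau_norm k q : mass p (fun y => v y * tau k q y ^+ 2) k q <=
  c ^+ 2 * mass p u k q.
Proof.
set N := mass _ _ _ _.
have N0 : 0 <= N by apply: mass_ge0 => y; rewrite mulr_ge0 ?sqr_ge0.
have : `|N| <= c * (Num.sqrt (mass p u k q) * Num.sqrt N).
  rewrite {1}/N; have := test k q (tau k q); rewrite exchange_big /= -/N.
  congr (`|_| <= _); rewrite /mass; apply: eq_bigr => y _.
  by rewrite -mulr_suml -tauE; ring.
rewrite ger0_norm// -[X in X <= _](sqr_sqrtr N0) => h.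
have := sqrtr_ge0 N; rewrite le_eqVlt => /orP[/eqP e|sN].
  by rewrite -[X in X <= _](sqr_sqrtr N0) -e expr0n/= mulr_ge0 ?sqr_ge0 ?mass_ge0.
have : Num.sqrt N <= c * Num.sqrt (mass p u k q).
  by rewrite -(ler_pM2r sN) -expr2 -mulrA.
move=> h2.
rewrite -[X in X <= _](sqr_sqrtr N0) -[X in _ * X]sqr_sqrtr ?mass_ge0//.
rewrite -exprMn ler_pXn2r// nnegrE ?sqrtr_ge0//.
by rewrite mulr_ge0 ?(ltW c0) ?sqrtr_ge0.
Qed.

(** The martingale difference is a self-adjoint projection for the weight [v],
and [h] is a constant for it. *)
Lemma cdiff_self_adjoint k f g h : isconst p k.+1 h ->
  \sum_x v x * f x * cdiff_v k g x * h x =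
  \sum_x v x * cdiff_v k f x * cdiff_v k g x * h x.
Proof.
move=> hc; have hc' := isconst_le pS (leqnSn k) hc.
have Ec j := @cexp_const R X p v j.
have Ec1 f' := isconst_le pS (leqnSn k) (Ec k.+1 f').
have e1 := @sum_cexp _ _ _ pid v v0 k f (fun x => cexp_v k g x * h x)
  (isconstM (Ec _ _) hc').
have e2 := @sum_cexp _ _ _ pid v v0 k.+1 f (fun x => cexp_v k.+1 g x * h x)
  (isconstM (Ec _ _) hc).
have e3 := @sum_cexp _ _ _ pid v v0 k f (fun x => cexp_v k.+1 g x * h x)
  (isconstM (Ec1 _) hc').
have e4 := @sum_cexp _ _ _ pid v v0 k g (fun x => cexp_v k.+1 f x * h x)
  (isconstM (Ec1 _) hc').
have e5 := @sum_cexp _ _ _ pid v v0 k.+1 g (fun x => cexp_v k.+1 f x * h x)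
  (isconstM (Ec _ _) hc).
transitivity (\sum_x v x * f x * (cexp_v k g x * h x)
    - \sum_x v x * f x * (cexp_v k.+1 g x * h x)).
  by rewrite -sumrB; apply: eq_bigr => x _; rewrite /cdiff; ring.
transitivity (\sum_x v x * cexp_v k f x * (cexp_v k g x * h x)
    - \sum_x v x * cexp_v k f x * (cexp_v k.+1 g x * h x)
    - \sum_x v x * cexp_v k g x * (cexp_v k.+1 f x * h x)
    + \sum_x v x * cexp_v k.+1 f x * (cexp_v k.+1 g x * h x)).
  rewrite e1 e3 e4 -e5 e2.
  have -> : \sum_x v x * cexp_v k.+1 g x * (cexp_v k.+1 f x * h x) =
    \sum_x v x * cexp_v k.+1 f x * (cexp_v k.+1 g x * h x).
    by apply: eq_bigr => x _; ring.
  rewrite e2; ring.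
by rewrite -!sumrB -big_split/=; apply: eq_bigr => x _; rewrite /cdiff; ring.
Qed.

Lemma cexp_id k s y : v y != 0 ->
  (forall z, v z != 0 -> p k z = p k y -> s z = s y) -> cexp_v k s y = s y.
Proof.
move=> vy sc; rewrite /cexp.
have -> : mass p (fun z => v z * s z) k (p k y) = mass p v k (p k y) * s y.
  rewrite /mass mulr_suml; apply: eq_bigr => z /eqP zy.
  have [->|vz] := eqVneq (v z) 0; first by rewrite !mul0r.
  by rewrite (sc _ vz zy).
rewrite mulrC mulKf//; apply: contra vy => /eqP h.
by rewrite (mass_eq0 v0 h).
Qed.

(** The indicators of the two nested classes differ by a function that lives
outside the (k.+1 + r)-class of [y]. By [loc] its image has constant density
on the (k.+1)-class of [y], so the k-th difference does not see it. Hence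
differences of the functions [tau] that vary with [k] are differences of one
fixed function, to which Bessel's inequality applies: this is where the
testing condition becomes a Carleson condition. *)
Lemma cdiff_tau k j y : (k <= j)%N -> v y != 0 ->
  cdiff_v k (fun z => tau (k.+1 + r) (p (k.+1 + r) z) z) y =
  cdiff_v k (tau (j.+1 + r) (p (j.+1 + r) y)) y.
Proof.
move=> kj vy; set K := (k.+1 + r)%N; set J := (j.+1 + r)%N.
have KJ : (K <= J)%N by rewrite /K /J leq_add2r.
have kK : (k.+1 <= K)%N by rewrite leq_addr.
set f1 := (fun z => _); set f2 := tau J _.
pose s z := f2 z - f1 z.
have sc z : v z != 0 -> p k.+1 z = p k.+1 y -> s z = s y.
  move=> vz zy; have zyK : p K z = p K y by exact: (rep_coarser pS) zy.
  have ss z' : p K z' = p K y -> s z' =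
      \sum_(x | (p J x == p J y) && (p K x != p K y)) t x z' / v z'.
    move=> zz; rewrite /s /f2 /f1 /tau zz -mulrBl -mulr_suml; congr (_ / _).
    rewrite (bigID (fun x => p K x == p K y))/=.
    rewrite [X in X + _ - _](eq_bigl (fun x => p K x == p K y)).
      by rewrite addrAC subrr add0r.
    move=> x; apply/andP/idP => [[]//|/eqP xy]; split; last exact/eqP.
    by apply/eqP; exact: rep_coarser xy.
  rewrite !ss//; apply: eq_bigr => x /andP[_ xy].
  apply/eqP; rewrite eqr_div//; apply/eqP; apply: (@loc k.+1) => //.
  by rewrite zyK.
have sD : cdiff_v k s y = 0.
  rewrite /cdiff !cexp_id// ?subrr// => z vz zy; apply: sc => //.
  exact: (rep_coarser pS (leqnSn k)).
have Es i : cexp_v i s y = cexp_v i f2 y - cexp_v i f1 y.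
  rewrite /cexp -mulrBl /mass -sumrB; congr (_ / _).
  by apply: eq_bigr => z _; rewrite /s; ring.
by move: sD; rewrite /cdiff !Es; lra.
Qed.

(** The k-th term equals the sum of v (cdiff tau) (cdiff g) (cexp f). By
Cauchy-Schwarz it is enough to bound the sum over [k] of v (cdiff tau)^2 (cexp
f)^2, which is the Carleson embedding with weights v (cdiff tau)^2 / c^2. *)
Lemma paraproduct_bound n f g :
  `|\sum_(k < n) bil t (cexp_u (k.+1 + r) f) (cdiff_v k g)| <=
  2 * c * (nm u f * nm v g).
Proof.
pose tk k z := tau (k.+1 + r) (p (k.+1 + r) z) z.
pose w k y := (v y * cdiff_v k (tk k) y ^+ 2) / c ^+ 2.
have w0 k y : 0 <= w k y.
  by apply: divr_ge0; [apply: mulr_ge0|]; rewrite ?sqr_ge0.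
have addE k : (k + r.+1 = k.+1 + r)%N by rewrite addnS.
have carl j q : (j < n)%N -> mass p (fun x => \sum_(k < j.+1) w k x) (j + r.+1) q
    <= mass p u (j + r.+1) q.
  move=> jn; rewrite addE; set J := (j.+1 + r)%N.
  have jJ : (j.+1 <= J)%N by rewrite leq_addr.
  have := @cdiff_bessel _ _ _ pS pid v v0 j.+1 (tau J q) (fun x => (p J x == q)%:R).
  have h1 x : 0 <= (p J x == q)%:R :> R by [].
  have h2 : isconst p j.+1 (fun x => (p J x == q)%:R : R).
    by move=> x y xy; rewrite (rep_coarser pS jJ xy).
  have := @tau_norm J q.
  rewrite (_ : mass p (fun y => v y * tau J q y ^+ 2) J q =
    \sum_x v x * tau J q x ^+ 2 * (p J x == q)%:R); last first.
    rewrite /mass [LHS]big_mkcond; apply: eq_bigr => x _.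
    by case: eqP; rewrite ?mulr1 ?mulr0.
  move=> h3 /(_ h1 h2) /le_trans /(_ h3) h4.
  rewrite -ler_pdivrMl ?exprn_gt0//  mulrC in h4.
  apply: le_trans h4; rewrite exchange_big /= mulr_suml.
  rewrite /mass big_mkcond; apply: ler_sum => x _.
  rewrite mulr_suml.
  case: eqP => [xq|]; last first.
    by rewrite big1// => k _; rewrite mulr0 mul0r.
  apply: ler_sum => k _; rewrite /w mulr1.
  have [->|vx] := eqVneq (v x) 0; first by rewrite !mul0r.
  by rewrite (@cdiff_tau k j)// ?xq// -ltnS.
have := carleson_embedding pS pid u0 (s := r.+1) (n := n) f w0 carl.
set S := (\sum_(k < n) _) => hS.
have each k : `|bil t (cexp_u (k.+1 + r) f) (cdiff_v k g)| <=
   c * (Num.sqrt (\sum_x w k x * cexp_u (k + r.+1) f x ^+ 2) * nm v (cdiff_v k g)).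
  rewrite (@bil_block_diagonal k.+1); last by move=> q; exact: cdiff_mean0.
  rewrite addE.
  rewrite (exchange_big_dep predT)//=.
  have -> : \sum_y \sum_(x | p (k.+1 + r) y == p (k.+1 + r) x)
      t x y * cexp_u (k.+1 + r) f x * cdiff_v k g y =
      \sum_y v y * tk k y * cdiff_v k g y * cexp_u (k.+1 + r) f y.
    apply: eq_bigr => y _; rewrite tauE !mulr_suml.
    apply: eq_big => [x|x /eqP xy]; first by rewrite eq_sym.
    by rewrite /cexp xy; ring.
  have Kc : isconst p k.+1 (cexp_u (k.+1 + r) f).
    by apply: (isconst_le pS (leq_addr r k.+1)); exact: cexp_const.
  rewrite cdiff_self_adjoint//.
  rewrite (eq_bigr (fun y => v y * (cdiff_v k (tk k) y * cexp_u (k.+1 + r) f y) *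
    cdiff_v k g y)); last by move=> y _; ring.
  apply: le_trans (sum_CS _ _ (fun i _ => v0 i)) _.
  rewrite mulrA; apply: ler_wpM2r; first exact: sqrtr_ge0.
  rewrite -[X in _ <= X * _]ger0_norm ?(ltW c0)// -sqrtr_sqr -sqrtrM ?sqr_ge0//.
  rewrite ler_wsqrtr// mulr_sumr; apply: ler_sum => x _.
  rewrite /w exprMn le_eqVlt; apply/orP; left; apply/eqP; field.
  by rewrite lt0r_neq0.
apply: le_trans (ler_norm_sum _ _ _) _.
apply: le_trans; first by apply: ler_sum => k _; exact: each.
rewrite -mulr_sumr [2 * c]mulrC -mulrA; apply: ler_wpM2l; first exact: ltW.
apply: le_trans (sum_sqrt_CS _ _) _.
- by move=> k _; apply: sumr_ge0 => x _; rewrite mulr_ge0 ?sqr_ge0.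
- by move=> k _; apply: sumr_ge0 => x _; rewrite mulr_ge0 ?sqr_ge0.
rewrite mulrA; apply: ler_pM; rewrite ?sqrtr_ge0//.
  apply: le_trans (ler_wsqrtr hS) _.
  rewrite sqrtrM// (_ : 4 = 2 ^+ 2) ?sqrtr_sqr ?ger0_norm//.
  by rewrite expr2; ring.
rewrite ler_wsqrtr//.
by have := @cdiff_bessel_from v n 0 g v0; under eq_bigr do rewrite addn0.
Qed.

(** Replacing [cexp k.+1] by [cexp (k.+1 + r)], as the paraproduct needs,
costs [r] diagonal sums. *)
Lemma half_bound n f g :
  `|\sum_(k < n) bil t (cexp_u k.+1 f) (cdiff_v k g)| <=
  c * (2 + r%:R * Mc%:R) * (nm u f * nm v g).
Proof.
have shift m k : bil t (cexp_u k.+1 f) (cdiff_v k g) = bil t (cexp_u (k.+1 + m) f) (cdiff_v k g)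
    + \sum_(i < m) bil t (cdiff_u (k + i.+1) f) (cdiff_v k g).
  elim: m => [|m ->]; first by rewrite addn0 big_ord0 addr0.
  rewrite big_ord_recr /= addrA addrAC; congr (_ + _).
  by rewrite /cdiff bilBl !addnS addSn addrC subrK.
under eq_bigr do rewrite (shift r).
rewrite big_split /= [X in _ + X]exchange_big /=.
apply: le_trans (ler_normD _ _) _.
rewrite mulrDr mulrDl; apply: lerD.
  by apply: le_trans (paraproduct_bound n f g) _; rewrite [c * 2]mulrC.
apply: le_trans (ler_norm_sum _ _ _) _.
apply: (@le_trans _ _ (\sum_(i < r) c * Mc%:R * (nm u f * nm v g))).
  by apply: ler_sum => i _; exact: diagonal_bound.
by rewrite sumr_const card_ord -mulr_natl; rewrite le_eqVlt; apply/orP; left; apply/eqP; ring.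
Qed.

End form.

Section discrete.
Variables (R : rcfType) (X : finType) (p : nat -> X -> X).
Hypothesis pS : forall k x, p k.+1 (p k x) = p k.+1 x.
Hypothesis pid : forall k x, p k (p k x) = p k x.
Hypothesis p0 : forall x, p 0 x = x.
Notation nm w f := (Num.sqrt (\sum_x w x * f x ^+ 2)).

(** Writing [f] and [g] as telescoping sums of differences splits the form
into the two triangular parts, the diagonal, and the averages of the last
generation, which the weak bound controls since there are few classes left. *)
Theorem discrete_two_weight (r Mc L : nat) (c : R) (u v : X -> R)
    (t : X -> X -> R) (f g : X -> R) :
  0 < c -> (forall x, 0 <= u x) -> (forall x, 0 <= v x) ->
  (forall x y, u x = 0 -> t x y = 0) -> (forall x y, v y = 0 -> t x y = 0) ->
  (forall k1 k2 q1 q2, (k1 <= k2 + r)%N -> (k2 <= k1 + r)%N ->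
    `|\sum_(x | p k1 x == q1) \sum_(y | p k2 y == q2) t x y| <=
    c * (Num.sqrt (mass p u k1 q1) * Num.sqrt (mass p v k2 q2))) ->
  (forall k q h,
    `|\sum_(x | p k x == q) \sum_(y | p k y == q) t x y * h y| <=
    c * (Num.sqrt (mass p u k q) *
         Num.sqrt (mass p (fun y => v y * h y ^+ 2) k q))) ->
  (forall k q h,
    `|\sum_(x | p k x == q) \sum_(y | p k y == q) t x y * h x| <=
    c * (Num.sqrt (mass p (fun y => u y * h y ^+ 2) k q) *
         Num.sqrt (mass p v k q))) ->
  (forall k x y z, p k y = p k z -> p (k + r) x != p (k + r) y ->
    t x y * v z = t x z * v y) ->
  (forall k x y z, p k y = p k z -> p (k + r) x != p (k + r) y ->
    t y x * u z = t z x * u y) ->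
  (forall k j q, (k <= j)%N -> (j <= k + r.+1)%N ->
    (#|[set p k x | x in [pred x | p j x == q]]| <= Mc)%N) ->
  (#|[set p L x | x in X]| <= Mc)%N ->
  `|bil t f g| <= c * (4 + 2 * (r%:R + 1) * Mc%:R) * (nm u f * nm v g).
Proof.
move=> c0 u0 v0 t_u t_v weak testv testu locv locu count countL.
pose t' x y := t y x.
have weak' k1 k2 q1 q2 : (k1 <= k2 + r)%N -> (k2 <= k1 + r)%N ->
    `|\sum_(x | p k1 x == q1) \sum_(y | p k2 y == q2) t' x y| <=
    c * (Num.sqrt (mass p v k1 q1) * Num.sqrt (mass p u k2 q2)).
  by move=> h1 h2; rewrite exchange_big /= [X in c * X]mulrC; exact: weak.
have testu' k q h : `|\sum_(x | p k x == q) \sum_(y | p k y == q) t' x y * h y|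
    <= c * (Num.sqrt (mass p v k q) *
         Num.sqrt (mass p (fun y => u y * h y ^+ 2) k q)).
  by rewrite exchange_big /= [X in c * X]mulrC; exact: testu.
have tv' x y : u y = 0 -> t' x y = 0 by exact: t_u.
have -> : bil t f g = bil t (cexp p u 0 f) (cexp p v 0 g).
  apply: eq_bigr => x _; apply: eq_bigr => y _.
  have [ux|ux] := eqVneq (u x) 0; first by rewrite t_u// !mul0r.
  have [vy|vy] := eqVneq (v y) 0; first by rewrite t_v// !mul0r.
  by rewrite !cexp_id// => z _; rewrite !p0 => ->.
have tel n : bil t (cexp p u 0 f) (cexp p v 0 g) = bil t (cexp p u n f) (cexp p v n g)
    + (\sum_(k < n) bil t (cdiff p u k f) (cexp p v k.+1 g)
    + \sum_(k < n) bil t (cexp p u k.+1 f) (cdiff p v k g)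
    + \sum_(k < n) bil t (cdiff p u (k + 0) f) (cdiff p v k g)).
  elim: n => [|n ->]; first by rewrite !big_ord0 !addr0.
  rewrite !big_ord_recr /= addn0 /cdiff !bilBl !bilBr; ring.
rewrite (tel L).
have b1 : `|\sum_(k < L) bil t (cdiff p u k f) (cexp p v k.+1 g)| <=
    c * (2 + r%:R * Mc%:R) * (nm u f * nm v g).
  under eq_bigr do rewrite bilC.
  by rewrite [nm u f * _]mulrC; apply: half_bound.
have b2 : `|\sum_(k < L) bil t (cexp p u k.+1 f) (cdiff p v k g)| <=
    c * (2 + r%:R * Mc%:R) * (nm u f * nm v g) by apply: half_bound.
have b3 : `|\sum_(k < L) bil t (cdiff p u (k + 0) f) (cdiff p v k g)| <=
    c * Mc%:R * (nm u f * nm v g) by apply: (@diagonal_bound _ _ _ pS pid r).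
have contr w h : (forall x, 0 <= w x) -> nm w (cexp p w L h) <= nm w h.
  move=> w0; rewrite ler_wsqrtr//.
  have := @cexp_contraction _ _ _ pid w w0 L h (fun=> 1) (fun _ _ _ => erefl)
    (fun=> ler01).
  under eq_bigr do rewrite mulr1.
  by under [X in _ <= X]eq_bigr do rewrite mulr1.
have b4 : `|bil t (cexp p u L f) (cexp p v L g)| <=
    c * Mc%:R * (nm u f * nm v g).
  apply: (@le_trans _ _ (c * Mc%:R * (nm u (cexp p u L f) * nm v (cexp p v L g)))).
    have cnt (P : unit) :
        (#|[set p L x | x in [pred x : X | tt == P]]| <= Mc)%N.
      apply: leq_trans countL; apply: subset_leq_card.
      by apply/fintype.subsetP => q /imsetP[x _ ->]; apply/imsetP; exists x.
    apply: (@block_bound _ _ _ pid r Mc c c0 u v t u0 v0 weak _ (fun=> tt) L L);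
      rewrite ?leq_addr//; exact: cexp_const.
  apply: ler_wpM2l; first by rewrite mulr_ge0 ?(ltW c0).
  by apply: ler_pM; rewrite ?sqrtr_ge0// contr.
set N := nm u f * _ in b1 b2 b3 b4 *.
apply: le_trans (ler_normD _ _) _; apply: le_trans (lerD b4 _) _.
  apply: le_trans (ler_normD _ _) _; apply: lerD b3.
  apply: le_trans (ler_normD _ _) _; exact: (lerD b1 b2).
by rewrite le_eqVlt; apply/orP; left; apply/eqP; ring.
Qed.

End discrete.

Local Open Scope classical_set_scope.
Local Open Scope ring_scope.

(** * Dyadic cubes and the tree distance *)

Section dyadic_eq.
Variable N : nat.
Definition dyadic_code (Q : dyadic N) := (level Q, pos Q).
Definition dyadic_decode (c : int * N.-tuple int) := Dyadic c.1 c.2.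
Lemma dyadic_codeK : cancel dyadic_code dyadic_decode.
Proof. by case. Qed.
HB.instance Definition _ := Equality.copy (dyadic N) (can_type dyadic_codeK).
HB.instance Definition _ := Choice.copy (dyadic N) (can_type dyadic_codeK).
End dyadic_eq.

Lemma floor_half (R : archiRealFieldType) (y : R) :
  Num.floor (y / 2) = (Num.floor y %/ 2)%Z.
Proof.
apply: floor_def; set m := Num.floor y.
have /andP[h1 h2] : m%:~R <= y < (m + 1)%:~R by rewrite -floor_eq.
have e := divz_eq m 2.
have r0 := modz_ge0 m (isT : 2 != 0 :> int).
have r1 := ltz_pmod m (isT : 0 < 2 :> int).
set q := (m %/ 2)%Z in e *; set s := (m %% 2)%Z in e r0 r1.
have a1 : q%:~R * 2 <= m%:~R :> R.
  by rewrite -[2]/(2%:~R) -intrM ler_int; lia.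
have a2 : (m + 1)%:~R <= (q + 1)%:~R * 2 :> R.
  by rewrite -[2 in leRHS]/(2%:~R) -intrM ler_int; lia.
by rewrite ler_pdivlMr// ltr_pdivrMr//; lra.
Qed.

Section geometry.
Variables (R : realType) (N : nat).
Implicit Types (Q S P : dyadic N) (x : Rn R N) (k : int).

Definition cell k x : dyadic N :=
  Dyadic k [tuple Num.floor (tnth x i / 2 ^ k) | i < N].

Definition parent Q : dyadic N :=
  Dyadic (level Q + 1) [tuple (tnth (pos Q) i %/ 2)%Z | i < N].

Definition anc n Q := iter n parent Q.

Lemma side_gt0 Q : 0 < side R Q.
Proof. by rewrite exprz_gt0. Qed.

Lemma cubeP Q x : cube Q x <-> cell (level Q) x = Q.
Proof.
case: Q => k t; rewrite /cube /side /=; split => [h|[ht] i].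
  congr Dyadic; apply: eq_from_tnth => i; rewrite tnth_mktuple.
  have p : 0 < 2 ^ k :> R by rewrite exprz_gt0.
  have /andP[h1 h2] := h i.
  apply: floor_def; rewrite intrD.
  by rewrite ler_pdivlMr// ltr_pdivrMr// h1.
have p : 0 < 2 ^ k :> R by rewrite exprz_gt0.
rewrite -ht tnth_mktuple -ler_pdivlMr// -ltr_pdivrMr//.
have /eqP := erefl (Num.floor (tnth x i / 2 ^ k)).
by rewrite floor_eq intrD.
Qed.

Lemma cube_cell k x : cube (cell k x) x.
Proof. exact/cubeP. Qed.

Lemma cell_parent k x : cell (k + 1) x = parent (cell k x).
Proof.
congr Dyadic; apply: eq_from_tnth => i; rewrite !tnth_mktuple.
by rewrite -floor_half expfzDr// expr1z invfM mulrA.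
Qed.

Lemma level_anc n Q : level (anc n Q) = level Q + n%:Z.
Proof. by elim: n => [|n IH] /=; rewrite ?addr0// IH; lia. Qed.

Lemma cell_anc n k x : cell (k + n%:Z) x = anc n (cell k x).
Proof.
elim: n => [|n IH]; first by rewrite addr0.
by rewrite /anc iterS -/(anc _ _) -IH -cell_parent -addrA; congr cell; lia.
Qed.

Lemma anc_add m n Q : anc (m + n) Q = anc m (anc n Q).
Proof. by rewrite /anc iterD. Qed.

Lemma ancS n Q : anc n.+1 Q = anc n (parent Q).
Proof. by rewrite /anc iterSr. Qed.

Lemma cube_anc n Q x : cube Q x -> cube (anc n Q) x.
Proof.
by move=> /cubeP h; apply/cubeP; rewrite level_anc cell_anc h.
Qed.

Lemma cube_inj Q S x : cube Q x -> cube S x -> level Q = level S -> Q = S.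
Proof. by move=> /cubeP h1 /cubeP h2 e; rewrite -h1 -h2 e. Qed.

Lemma cube_nested Q S x n : cube Q x -> cube S x ->
  level S = level Q + n%:Z -> S = anc n Q.
Proof.
move=> h1 h2 e; apply: (cube_inj h2 (cube_anc n h1)).
by rewrite level_anc.
Qed.

Definition corner Q : Rn R N := [tuple (tnth (pos Q) i)%:~R * side R Q | i < N].

Lemma cube_corner Q : cube Q (corner Q).
Proof.
move=> i; rewrite tnth_mktuple lexx /= mulrDl mul1r ltrDl.
exact: side_gt0.
Qed.

Lemma child_parent S Q : child R S Q -> Q = parent S.
Proof.
move=> [sS sub]; have h := cube_corner S.
have h2 := sub _ h.
have lE : level Q = level S + 1.
  have p2 : (2 : R) != 0 by [].
  have e : 2 ^ (level S + 1) = 2 ^ level Q :> R.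
    by rewrite expfzDr// expr1z -/(side R S) sS divfK.
  case: (ltgtP (level Q) (level S + 1)) => // lt.
    have : 2 ^ level Q < 2 ^ (level S + 1) :> R by rewrite ltr_eXz2l// ltr1n.
    by rewrite e ltxx.
  have : 2 ^ (level S + 1) < 2 ^ level Q :> R by rewrite ltr_eXz2l// ltr1n.
  by rewrite e ltxx.
exact: (@cube_nested S Q _ 1 h h2 lE).
Qed.

Definition below Q P := exists n, anc n Q = P.

Lemma below_parent Q P : below (parent Q) P -> below Q P.
Proof. by move=> [n <-]; exists n.+1; rewrite ancS. Qed.
Lemma below_parentr Q P : below Q P -> below Q (parent P).
Proof. by move=> [n <-]; exists n.+1. Qed.
Lemma below_trans P Q S : below Q P -> below P S -> below Q S.
Proof. by move=> [n <-] [m <-]; exists (m + n)%N; rewrite anc_add. Qed.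
Lemma below_anc n Q : below Q (anc n Q). Proof. by exists n. Qed.
Lemma below_sub Q P x : below Q P -> cube Q x -> cube P x.
Proof. by move=> [n <-]; exact: cube_anc. Qed.

Lemma below_up Q P : below Q P -> below (parent Q) (parent P).
Proof. by move=> [n <-]; exists n; rewrite -ancS. Qed.

(** An edge to the parent or to a child takes a cube below [P] to a cube below
the parent of [P]. *)
Lemma walk_below n (A B P : dyadic N) : walk R n A B -> below A P -> below B (anc n P).
Proof.
elim: n A P => [|n IH] A P /=; first by move=> ->.
move=> [C AC wCB] AP; change (below B (anc n.+1 P)).
rewrite ancS; apply: IH wCB _.
case: AC => /child_parent e; last by rewrite e; exact: below_up.
by apply: below_parentr; apply: below_parent; rewrite -e.
Qed.

Lemma walk_sym n (A B : dyadic N) : walk R n A B -> walk R n B A.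
Proof.
have app m (C D E : dyadic N) : walk R m C D -> child R D E \/ child R E D -> walk R m.+1 C E.
  elim: m C => [|m IH] C /=; first by move=> -> h; exists E => //; case: h; [right|left].
  by move=> [P CP wP] h; exists P => //; exact: IH.
elim: n A => [|n IH] A /=; first by move=> ->.
move=> [P AP wP]; apply: (app _ _ _ _ (IH _ wP)).
by case: AP; [left|right].
Qed.

Lemma dtree_gt r (A B : dyadic N) : (forall n, walk R n A B -> (r < n)%N) ->
  (r%:R%:E < dtree R A B)%E.
Proof.
move=> h; apply: (@lt_le_trans _ _ r.+1%:R%:E); first by rewrite lte_fin ltr_nat.
apply: le_ereal_inf_tmp => _ [n wn <-].
by rewrite lee_fin ler_nat h.
Qed.

(** The tree distance enters the proof only in this form. *)
Lemma dtree_outside r (A B P : dyadic N) : below A P -> ~ below B (anc r P) ->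
  (r%:R%:E < dtree R A B)%E /\ (r%:R%:E < dtree R B A)%E.
Proof.
move=> AP BP.
have far n : walk R n A B -> (r < n)%N.
  move=> w; rewrite ltnNge; apply/negP => nr; apply: BP.
  have := walk_below w AP => /below_trans; apply.
  by exists (r - n)%N; rewrite -anc_add subnK.
by split; apply: dtree_gt => n; [exact: far|move=> /walk_sym; exact: far].
Qed.

Definition vol Q : R := side R Q ^+ N.

Lemma vol_gt0 Q : 0 < vol Q. Proof. by rewrite exprn_gt0 ?side_gt0. Qed.

Lemma vol_parent Q : vol (parent Q) = 2 ^+ N * vol Q.
Proof. by rewrite /vol /side /= expfzDr// expr1z mulrC exprMn. Qed.

Lemma vol_anc n Q : vol (anc n Q) = (2 ^+ N) ^+ n * vol Q.
Proof.
by elim: n => [|n IH] /=; rewrite ?expr0 ?mul1r// vol_parent IH mulrA exprS.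
Qed.

Lemma cubeE Q : cube Q = [set x : Rn R N | forall i : 'I_N,
  `[(tnth (pos Q) i)%:~R * side R Q, ((tnth (pos Q) i)%:~R + 1) * side R Q[%classic
    (tnth x i)].
Proof.
by apply/seteqP; split => x h i; have := h i; rewrite /= in_itv.
Qed.

Lemma measurable_cube Q : measurable (cube Q : set (Rn R N)).
Proof.
rewrite cubeE (_ : mkset _ = \bigcap_(i in [set: 'I_N])
     ((@tnth N (measurableTypeR R) ^~ i) @^-1`
     `[(tnth (pos Q) i)%:~R * side R Q, ((tnth (pos Q) i)%:~R + 1) * side R Q[%classic)).
  apply: fin_bigcap_measurable; first exact: finite_finset.
  move=> i _; rewrite -[X in measurable X]setTI.
  by apply: measurable_tnth => //; exact: measurable_itv.
by apply/seteqP; split=> x /= h i => [_|]; exact: h.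
Qed.

Lemma lebesgue_cube Q : lebesgue R N (cube Q) = (vol Q)%:E.
Proof.
rewrite cubeE (@lebesgue_box R N (fun i => `[(tnth (pos Q) i)%:~R * side R Q,
  ((tnth (pos Q) i)%:~R + 1) * side R Q[%classic)); last first.
  by move=> i; exact: measurable_itv.
have -> : vol Q = \prod_(i < N) side R Q by rewrite prodr_const card_ord.
rewrite -prodEFin; apply: eq_bigr => i _.
rewrite lebesgue_measure_itv /= lte_fin mulrDl mul1r ltrDl side_gt0.
by rewrite -EFinB addrAC subrr add0r.
Qed.

End geometry.

(** * Real integrals and the real L^2 calculus *)

Section calculus.
Variables (R : realType) (d : measure_display) (T : measurableType d).
Variable mu : {measure set T -> \bar R}.
Implicit Types (f g h : T -> R) (A : set T).

(** Integrals over sets are written as integrals over the whole space against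
indicator functions. *)
Definition inte f := mu.-integrable setT (EFin \o f).
Definition itg f : R := \int[mu]_x f x.
Definition L2r f := measurable_fun setT f /\ inte (fun x => f x ^+ 2).
Definition ip f g := itg (fun x => f x * g x).

Lemma itgE f : itg f = \int[mu]_x f x. Proof. by []. Qed.
Lemma ipE f g : ip f g = itg (fun x => f x * g x). Proof. by []. Qed.

Lemma inteM f : inte f -> measurable_fun setT f.
Proof. by move=> /measurable_int /measurable_EFinP. Qed.

Lemma inte_le f g : measurable_fun setT f -> inte g ->
  (forall x, `|f x| <= g x) -> inte f.
Proof.
move=> mf ig fg; apply: le_integrable ig => //; first exact/measurable_EFinP.
by move=> x _ /=; rewrite lee_fin (le_trans (fg x))// ler_norm.
Qed.

Lemma inteD f g : inte f -> inte g -> inte (fun x => f x + g x).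
Proof.
move=> i1 i2; rewrite /inte (_ : _ \o _ = (EFin \o f) \+ (EFin \o g))//.
exact: integrableD.
Qed.

Lemma inteZ a f : inte f -> inte (fun x => a * f x).
Proof. by move=> i; exact: (integrableZl measurableT a i). Qed.

Lemma inteN f : inte f -> inte (fun x => - f x).
Proof.
by move=> /(inteZ (-1)); congr inte; apply/funext => x; rewrite mulN1r.
Qed.

Lemma inteB f g : inte f -> inte g -> inte (fun x => f x - g x).
Proof. by move=> i1 i2; apply: inteD => //; exact: inteN. Qed.

Lemma inte0 : inte (fun=> 0).
Proof. exact: integrable0. Qed.

Lemma inte_sum (I : Type) (s : seq I) (P : pred I) (F : I -> T -> R) :
  (forall i, P i -> inte (F i)) -> inte (fun x => \sum_(i <- s | P i) F i x).
Proof.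
move=> iF; elim: s => [|i s IH].
  by under [X in inte X]eq_fun do rewrite big_nil; exact: inte0.
have [Pi|Pi] := boolP (P i).
  under [X in inte X]eq_fun do rewrite big_cons Pi.
  by apply: inteD => //; exact: iF.
by under [X in inte X]eq_fun do rewrite big_cons (negbTE Pi).
Qed.

Lemma inte_abs f : inte f -> inte (fun x => `|f x|).
Proof. by move=> /integrable_abse. Qed.

Lemma inte_ind A f : measurable A -> inte f -> inte (fun x => \1_A x * f x).
Proof.
move=> mA i; apply: (inte_le _ (inte_abs i)).
  by apply: measurable_funM; [exact: measurable_indic|exact: inteM].
by move=> x; rewrite normrM indicE; case: (_ \in _); rewrite ?normr1 ?normr0 ?mul1r ?mul0r.
Qed.

Lemma eq_itg f g : (forall x, f x = g x) -> itg f = itg g.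
Proof. by move=> fg; rewrite (_ : f = g)//; exact/funext. Qed.

Lemma itgD f g : inte f -> inte g -> itg (fun x => f x + g x) = itg f + itg g.
Proof. by move=> i1 i2; exact: RintegralD. Qed.

Lemma itgB f g : inte f -> inte g -> itg (fun x => f x - g x) = itg f - itg g.
Proof. by move=> i1 i2; exact: RintegralB. Qed.

Lemma itgZ a f : inte f -> itg (fun x => a * f x) = a * itg f.
Proof. by move=> i1; exact: RintegralZl. Qed.

Lemma itg0 : itg (fun=> 0) = 0.
Proof. by rewrite /itg /Rintegral integral0. Qed.

Lemma itgN f : inte f -> itg (fun x => - f x) = - itg f.
Proof.
move=> i; rewrite -mulN1r -itgZ//; apply: eq_itg => x; exact/esym/mulN1r.
Qed.

Lemma itg_sum (I : Type) (s : seq I) (P : pred I) (F : I -> T -> R) :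
  (forall i, P i -> inte (F i)) ->
  itg (fun x => \sum_(i <- s | P i) F i x) = \sum_(i <- s | P i) itg (F i).
Proof.
move=> iF; elim: s => [|i s IH].
  by rewrite big_nil -[RHS]itg0; apply: eq_itg => x; rewrite big_nil.
rewrite big_cons -IH; have [Pi|Pi] := boolP (P i).
  rewrite -itgD ?iF//; last exact: inte_sum.
  by apply: eq_itg => x; rewrite big_cons Pi.
by apply: eq_itg => x; rewrite big_cons (negbTE Pi).
Qed.

Lemma itg_ge0 f : (forall x, 0 <= f x) -> 0 <= itg f.
Proof. by move=> f0; exact: Rintegral_ge0. Qed.

Lemma itg_le f g : inte f -> inte g -> (forall x, f x <= g x) -> itg f <= itg g.
Proof. by move=> i1 i2 fg; apply: le_Rintegral. Qed.

Lemma itg_norm f : inte f -> `|itg f| <= itg (fun x => `|f x|).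
Proof. by move=> i; exact: le_normr_Rintegral. Qed.

Lemma itg_le_norm f g : inte f -> inte g -> (forall x, `|f x| <= g x) ->
  `|itg f| <= itg g.
Proof.
move=> i1 i2 fg; apply: le_trans (itg_norm i1) _.
by apply: itg_le => //; exact: inte_abs.
Qed.

Lemma itg_EFin f : inte f -> ((itg f)%:E = \int[mu]_x (f x)%:E)%E.
Proof.
move=> i; rewrite /itg /Rintegral fineK//; exact: integrable_fin_num.
Qed.

Lemma itg_restrict A f : \int[mu]_(x in A) f x = itg (fun x => \1_A x * f x).
Proof.
rewrite /itg Rintegral_mkcond; congr Rintegral; apply/funext => x.
by rewrite /patch indicE; case: ifP; rewrite ?mul1r ?mul0r.
Qed.

Lemma eint_restrict A f :
  (\int[mu]_(x in A) (f x)%:E = \int[mu]_x (\1_A x * f x)%:E)%E.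
Proof.
rewrite integral_mkcond; apply: eq_integral => x _.
by rewrite /patch indicE; case: ifP; rewrite ?mul1r ?mul0r.
Qed.

Lemma inte_le_fin f c : measurable_fun setT f -> (forall x, 0 <= f x) ->
  (\int[mu]_x (f x)%:E <= c%:E)%E -> inte f /\ itg f <= c.
Proof.
move=> mf f0 fc.
have i : inte f.
  apply/integrableP; split; first exact/measurable_EFinP.
  under eq_integral => x _ do rewrite /= ger0_norm//.
  exact: le_lt_trans fc (ltry _).
by split=> //; rewrite -lee_fin itg_EFin.
Qed.

Lemma L2rM f : L2r f -> measurable_fun setT f. Proof. by case. Qed.
Hint Resolve L2rM : core.

Lemma L2r_inte f g : L2r f -> L2r g -> inte (fun x => f x * g x).
Proof.
move=> [mf f2] [mg g2]; apply: (inte_le _ (inteD f2 g2)).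
  exact: measurable_funM.
move=> x; rewrite normrM -(real_normK (num_real (f x))).
rewrite -(real_normK (num_real (g x))).
by have := sqr_ge0 (`|f x| - `|g x|); nra.
Qed.

Lemma L2r_le f g : measurable_fun setT f -> L2r g ->
  (forall x, `|f x| <= `|g x|) -> L2r f.
Proof.
move=> mf [mg g2] fg; split=> //; apply: (inte_le _ g2).
  exact: measurable_funX.
move=> x; rewrite normrX -(real_normK (num_real (g x))).
by rewrite ler_pXn2r// nnegrE.
Qed.

Lemma L2rZ a f : L2r f -> L2r (fun x => a * f x).
Proof.
move=> [mf f2]; split; first exact: measurable_funM.
by under eq_fun do rewrite exprMn; exact: inteZ.
Qed.

Lemma L2rD f g : L2r f -> L2r g -> L2r (fun x => f x + g x).
Proof.
move=> [mf f2] [mg g2]; split; first exact: measurable_funD.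
apply: (inte_le _ (inteZ 2 (inteD f2 g2))).
  by apply: measurable_funX; exact: measurable_funD.
by move=> x; rewrite ger0_norm ?sqr_ge0//; have := sqr_ge0 (f x - g x); nra.
Qed.

Lemma L2rB f g : L2r f -> L2r g -> L2r (fun x => f x - g x).
Proof.
move=> f2 /(L2rZ (-1)) g2; under eq_fun do rewrite -mulN1r; exact: L2rD.
Qed.

Lemma L2r0 : L2r (fun=> 0).
Proof.
split; first exact: measurable_cst.
by under eq_fun do rewrite expr0n; exact: inte0.
Qed.

Lemma L2r_sum (I : Type) (s : seq I) (P : pred I) (F : I -> T -> R) :
  (forall i, P i -> L2r (F i)) -> L2r (fun x => \sum_(i <- s | P i) F i x).
Proof.
move=> iF; elim: s => [|i s IH].
  by under [X in L2r X]eq_fun do rewrite big_nil; exact: L2r0.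
have [Pi|Pi] := boolP (P i).
  under [X in L2r X]eq_fun do rewrite big_cons Pi.
  by apply: L2rD => //; exact: iF.
by under [X in L2r X]eq_fun do rewrite big_cons (negbTE Pi).
Qed.

Lemma norm_ind_le A (a : R) x : `|\1_A x * a| <= `|a|.
Proof.
by rewrite normrM indicE; case: (_ \in _); rewrite ?normr1 ?normr0 ?mul1r ?mul0r.
Qed.

Lemma L2r_ind A f : measurable A -> L2r f -> L2r (fun x => \1_A x * f x).
Proof.
move=> mA f2; apply: (L2r_le _ f2) => [|x]; last exact: norm_ind_le.
by apply: measurable_funM; [exact: measurable_indic|exact: L2rM].
Qed.

Lemma ipC f g : ip f g = ip g f.
Proof. by apply: eq_itg => x; rewrite mulrC. Qed.

Lemma ipDl f1 f2 g : L2r f1 -> L2r f2 -> L2r g ->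
  ip (fun x => f1 x + f2 x) g = ip f1 g + ip f2 g.
Proof.
move=> h1 h2 hg; rewrite -itgD; try exact: L2r_inte.
by apply: eq_itg => x; rewrite mulrDl.
Qed.

Lemma ipBl f1 f2 g : L2r f1 -> L2r f2 -> L2r g ->
  ip (fun x => f1 x - f2 x) g = ip f1 g - ip f2 g.
Proof.
move=> h1 h2 hg; rewrite -itgB; try exact: L2r_inte.
by apply: eq_itg => x; rewrite mulrBl.
Qed.

Lemma ipZl a f g : L2r f -> L2r g -> ip (fun x => a * f x) g = a * ip f g.
Proof.
move=> h1 hg; rewrite -itgZ; try exact: L2r_inte.
by apply: eq_itg => x; rewrite mulrA.
Qed.

Lemma ip_suml (I : Type) (s : seq I) (P : pred I) (F : I -> T -> R) g :
  (forall i, P i -> L2r (F i)) -> L2r g ->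
  ip (fun x => \sum_(i <- s | P i) F i x) g = \sum_(i <- s | P i) ip (F i) g.
Proof.
move=> hF hg; rewrite -itg_sum; last by move=> i Pi; apply: L2r_inte => //; exact: hF.
by apply: eq_itg => x; rewrite mulr_suml.
Qed.

Lemma ip_CS2 f g : L2r f -> L2r g -> ip f g ^+ 2 <= ip f f * ip g g.
Proof.
move=> f2 g2.
have pos a b : 0 <= a ^+ 2 * ip f f + 2 * a * b * ip f g + b ^+ 2 * ip g g.
  have -> : a ^+ 2 * ip f f + 2 * a * b * ip f g + b ^+ 2 * ip g g =
    itg (fun x => (a * f x + b * g x) ^+ 2).
    rewrite -!itgZ; try exact: L2r_inte.
    rewrite -!itgD; try (apply: inteZ; exact: L2r_inte).
      by apply: eq_itg => x; ring.
    by apply: inteD; apply: inteZ; exact: L2r_inte.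
  by apply: itg_ge0 => x; exact: sqr_ge0.
have f0 : 0 <= ip f f by apply: itg_ge0 => x; rewrite -expr2 sqr_ge0.
have g0 : 0 <= ip g g by apply: itg_ge0 => x; rewrite -expr2 sqr_ge0.
have [G0|Gn0] := eqVneq (ip g g) 0; last first.
  have Gp : 0 < ip g g by rewrite lt_neqAle eq_sym Gn0.
  have := pos (ip g g) (- ip f g).
  rewrite (_ : _ + _ + _ = ip g g * (ip f f * ip g g - ip f g ^+ 2)); last ring.
  by rewrite pmulr_rge0// subr_ge0.
rewrite G0 mulr0; have [->|x0] := eqVneq (ip f g) 0; first by rewrite expr0n.
have := pos 1 (- (ip f f + 1) / (2 * ip f g)); rewrite G0 mulr0 addr0.
have -> : 1 ^+ 2 * ip f f + 2 * 1 * (- (ip f f + 1) / (2 * ip f g)) * ip f g =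
    -1 by field.
by rewrite lerNr oppr0 ler10.
Qed.

Definition nrm f := Num.sqrt (ip f f).

Lemma nrmE f : nrm f = Num.sqrt (ip f f). Proof. by []. Qed.

Lemma ip_ge0 f : 0 <= ip f f.
Proof. by apply: itg_ge0 => x; rewrite -expr2 sqr_ge0. Qed.

Lemma nrm2 f : nrm f ^+ 2 = ip f f.
Proof. by rewrite sqr_sqrtr ?ip_ge0. Qed.

Lemma ip_CS f g : L2r f -> L2r g -> `|ip f g| <= nrm f * nrm g.
Proof.
by move=> f2 g2; rewrite -sqrtrM ?ip_ge0//; exact/ler_abs_sqrt/ip_CS2.
Qed.

(** Cauchy-Schwarz for [f * sqrt w] and [g * sqrt w]. *)
Lemma itg_CS (w f g : T -> R) : (forall x, 0 <= w x) -> measurable_fun setT f ->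
  measurable_fun setT g -> measurable_fun setT w ->
  inte (fun x => f x ^+ 2 * w x) -> inte (fun x => g x ^+ 2 * w x) ->
  `|itg (fun x => f x * g x * w x)| <=
  Num.sqrt (itg (fun x => f x ^+ 2 * w x)) *
  Num.sqrt (itg (fun x => g x ^+ 2 * w x)).
Proof.
move=> w0 mf mg mw i1 i2.
pose s x := Num.sqrt (w x).
have ms : measurable_fun setT s.
  apply: measurableT_comp mw; apply: continuous_measurable_fun.
  exact: sqrt_continuous.
have h (f' : T -> R) x : (f' x * s x) ^+ 2 = f' x ^+ 2 * w x.
  by rewrite exprMn sqr_sqrtr.
have L f' : measurable_fun setT f' -> inte (fun x => f' x ^+ 2 * w x) ->
    L2r (fun x => f' x * s x).
  move=> mf' i; split; first exact: measurable_funM.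
  by under eq_fun do rewrite h.
have := ip_CS (L _ mf i1) (L _ mg i2).
rewrite /nrm /ip.
under [X in `|X|]eq_itg => x do
  rewrite mulrACA -expr2 sqr_sqrtr//.
under [X in Num.sqrt X * _]eq_itg => x do rewrite -expr2 h.
by under [X in _ * Num.sqrt X]eq_itg => x do rewrite -expr2 h.
Qed.

Lemma ip_null f g : L2r f -> L2r g -> ip f f = 0 -> ip f g = 0.
Proof.
move=> f2 g2 f0; have := ip_CS2 f2 g2; rewrite f0 mul0r => h.
by apply/eqP; rewrite -sqrf_eq0 eq_le h sqr_ge0.
Qed.

Lemma itg_dominated (f_ : nat -> T -> R) (f g : T -> R) : inte g ->
  measurable_fun setT f ->
  (forall n, measurable_fun setT (f_ n)) ->
  (forall x, f_ ^~ x @ \oo --> f x) -> (forall n x, `|f_ n x| <= g x) ->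
  (fun n => itg (f_ n)) @ \oo --> itg f.
Proof.
move=> ig mf mf_ cf fg.
have h1 n : measurable_fun setT (EFin \o f_ n) by exact/measurable_EFinP.
have h2 : measurable_fun setT (EFin \o f) by exact/measurable_EFinP.
have h3 : {ae mu, forall x, setT x ->
    (fun n => (EFin \o f_ n) x) @ \oo --> (EFin \o f) x}.
  by apply/aeW => x _; apply/fine_cvgP; split; [exact: nearW|exact: cf].
have h4 : {ae mu, forall x n, setT x ->
    (`|(EFin \o f_ n) x| <= (EFin \o g) x)%E}.
  by apply/aeW => x n _; rewrite /= lee_fin.
have [if_ _ h] := dominated_convergence measurableT h1 h2 h3 ig h4.
have fin : (\int[mu]_x (EFin \o f) x)%E \is a fin_num.
  exact: integrable_fin_num.
rewrite -[X in _ --> X](fineK fin) in h.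
exact: (fine_cvg h).
Qed.

Lemma itg_monotone (f_ : nat -> T -> R) f : inte f ->
  (forall n, measurable_fun setT (f_ n)) -> (forall n x, 0 <= f_ n x <= f x) ->
  (forall x, f_ ^~ x @ \oo --> f x) ->
  (fun n => itg (f_ n)) @ \oo --> itg f.
Proof.
move=> i mf f_f cf; apply: (itg_dominated i) => //; first exact: inteM.
by move=> n x; have /andP[h1 h2] := f_f n x; rewrite ger0_norm.
Qed.

Lemma itg_abs_continuous f e : inte f -> 0 < e -> exists2 dl : R, 0 < dl &
  forall A, measurable A -> (mu A < dl%:E)%E ->
  itg (fun x => \1_A x * `|f x|) < e.
Proof.
move=> i e0; have [dl [dl0 h]] := integral_normr_continuous i e0.
by exists dl => // A mA Ad; rewrite -itg_restrict; exact: h.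
Qed.

End calculus.

(** * Approximation in L^1 by dyadic step functions *)

HB.instance Definition _ N := Countable.copy (dyadic N) (can_type (@dyadic_codeK N)).

Section density.
Variables (R : realType) (N : nat).
Local Notation mu := (lebesgue R N).
Local Notation T := (Rn R N).

Definition lat (l : nat) (x : T) := cell (- l%:Z) x.

Lemma lat_anc l j x : lat l x = anc j (lat (l + j) x).
Proof. by rewrite /lat -cell_anc; congr cell; lia. Qed.

Lemma measurable_step (k : int) (s : set (dyadic N)) :
  measurable [set x : T | s (cell k x)].
Proof.
have -> : [set x : T | s (cell k x)] =
    \bigcup_(Q : dyadic N) (if `[< s Q /\ level Q = k >] then cube Q else set0).
  apply/seteqP; split => [x /= sx|x [Q _]].
    exists (cell k x) => //; case: asboolP => [_|[]//]; exact: cube_cell.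
  by case: asboolP => // -[sQ lQ] /cubeP; rewrite lQ /= => ->.
apply: countable_bigcupT_measurable; first exact: countableP.
by move=> Q; case: ifP => // _; exact: measurable_cube.
Qed.

Lemma measurable_fun_step (k : int) (s : dyadic N -> R) :
  measurable_fun setT (fun x : T => s (cell k x)).
Proof.
move=> _ B mB; rewrite setTI.
exact: (@measurable_step k (fun Q => B (s Q))).
Qed.

Section approx.
Variable w : T -> R.
Hypotheses (w0 : forall x, 0 <= w x) (iw : inte mu w).

Definition gap (A B : set T) := itg mu (fun x => `|\1_A x - \1_B x| * w x).

Lemma inte_gap A B : measurable A -> measurable B ->
  inte mu (fun x => `|\1_A x - \1_B x : R| * w x).
Proof.
move=> mA mB; apply: (inte_le _ iw).
  apply: measurable_funM; last exact: (inteM iw).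
  apply: measurableT_comp => //.
  by apply: measurable_funB; exact: measurable_indic.
move=> x; rewrite ger0_norm ?mulr_ge0//; apply: ler_piMl => //.
by rewrite !indicE; do 2!case: (_ \in _);
  rewrite ?subrr ?subr0 ?sub0r ?normrN ?normr1 ?normr0.
Qed.

Definition stepset l (s : set (dyadic N)) : set T := [set x | s (lat l x)].

(** The measurable sets for which approximation by unions of cubes of one size
holds; they will turn out to form a sigma-algebra containing the half-spaces.
*)
Definition approximable (A : set T) := measurable A /\
  forall e, 0 < e -> exists l s, gap A (stepset l s) < e.

Lemma gapU A B A' B' : measurable A -> measurable B -> measurable A' ->
  measurable B' -> gap (A `|` B) (A' `|` B') <= gap A A' + gap B B'.
Proof.
move=> mA mB mA' mB'; rewrite -itgD; try exact: inte_gap.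
apply: itg_le; [by apply: inte_gap; exact: measurableU| |].
  by apply: inteD; exact: inte_gap.
move=> x; rewrite -mulrDl; apply: ler_wpM2r => //.
rewrite !indicE !in_setU.
by do 4!case: (_ \in _); rewrite /= ?subrr ?subr0 ?sub0r ?normrN ?normr1 ?normr0; lra.
Qed.

Lemma gap_triangle A B C : measurable A -> measurable B -> measurable C ->
  gap A C <= gap A B + gap B C.
Proof.
move=> mA mB mC; rewrite -itgD; try exact: inte_gap.
apply: itg_le; [by apply: inte_gap| |].
  by apply: inteD; exact: inte_gap.
move=> x; rewrite -mulrDl; apply: ler_wpM2r => //.
rewrite !indicE.
by do 3!case: (_ \in _); rewrite /= ?subrr ?subr0 ?sub0r ?normrN ?normr1 ?normr0; lra.
Qed.

Lemma stepsetU l s l' s' : exists s2,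
  stepset l s `|` stepset l' s' = stepset (l + l') s2.
Proof.
exists (fun Q => s (anc l' Q) \/ s' (anc l Q)).
by apply/seteqP; split=> x; rewrite /stepset /= -(lat_anc l l') (addnC l)
  -(lat_anc l' l).
Qed.

Lemma approximableU A B : approximable A -> approximable B ->
  approximable (A `|` B).
Proof.
move=> [mA hA] [mB hB]; split; first exact: measurableU.
move=> e e0; have e2 : 0 < e / 2 by rewrite divr_gt0.
have [l [s h1]] := hA _ e2; have [l' [s' h2]] := hB _ e2.
have [s2 e12] := stepsetU l s l' s'; exists (l + l')%N, s2; rewrite -e12.
by apply: le_lt_trans (gapU _ _ _ _) _ => //; try exact: measurable_step; lra.
Qed.

(** Dominated convergence. *)
Lemma gap_cvg0 A (F : (set T)^nat) : measurable A ->
  (forall n, measurable (F n)) ->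
  (forall x, \forall n \near \oo, (x \in F n) = (x \in A)) ->
  forall e, 0 < e -> exists n, gap A (F n) < e.
Proof.
move=> mA mF AF e e0.
have cv : (fun n => gap A (F n)) @ \oo --> itg mu (fun=> 0 : R).
  apply: (itg_dominated iw).
  - exact: measurable_cst.
  - move=> n; exact: (inteM (inte_gap mA (mF n))).
  - move=> x; apply: cvg_near_cst.
    near=> n; have h : (x \in F n) = (x \in A) by near: n; exact: AF.
    by rewrite !indicE h subrr normr0 mul0r.
  - move=> n x; rewrite ger0_norm ?mulr_ge0//; apply: ler_piMl => //.
    by rewrite !indicE; do 2!case: (_ \in _);
      rewrite ?subrr ?subr0 ?sub0r ?normrN ?normr1 ?normr0.
rewrite itg0 in cv.
move/cvgr0Pnorm_lt : cv => /(_ e e0)[n _ /(_ n (leqnn n))]/= h; exists n.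
exact: le_lt_trans (ler_norm _) h.
Unshelve. all: by end_near. Qed.

Lemma approximable_limit A (F : (set T)^nat) : measurable A ->
  (forall n, approximable (F n)) ->
  (forall x, \forall n \near \oo, (x \in F n) = (x \in A)) -> approximable A.
Proof.
move=> mA aF AF; split => // e e0; have e2 : 0 < e / 2 by rewrite divr_gt0.
have mF n : measurable (F n) by have [] := aF n.
have [n hn] := gap_cvg0 mA mF AF e2.
have [_ /(_ _ e2)[l [s h]]] := aF n; exists l, s.
have ms : measurable (stepset l s) by exact: measurable_step.
by have := gap_triangle mA (mF n) ms; lra.
Qed.

Lemma approximable_step l s : approximable (stepset l s).
Proof.
split; first exact: measurable_step.
move=> e e0; exists l, s; rewrite /gap.
under eq_itg do rewrite subrr normr0 mul0r.
by rewrite itg0.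
Qed.

Lemma approximableC A : approximable A -> approximable (~` A).
Proof.
move=> [mA hA]; split; first exact: measurableC.
move=> e /hA[l [s h]]; exists l, (~` s).
suff -> : gap (~` A) (stepset l (~` s)) = gap A (stepset l s) by [].
apply: eq_itg => x; congr (_ * _).
have -> : stepset l (~` s) = ~` stepset l s by [].
by rewrite !indicE !in_setC; do 2!case: (_ \in _);
  rewrite /= ?subrr ?subr0 ?sub0r ?normrN.
Qed.

Lemma approximable_bigcup (F : (set T)^nat) : (forall n, approximable (F n)) ->
  approximable (\bigcup_n F n).
Proof.
move=> aF; apply: (@approximable_limit _ (fun n => \big[setU/set0]_(i < n) F i)).
- by apply: bigcupT_measurable => n; have [] := aF n.
- elim=> [|n IH]; last by rewrite big_ord_recr; exact: approximableU.
  rewrite big_ord0 (_ : set0 = stepset 0 set0); first exact: approximable_step.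
  by apply/seteqP; split.
move=> x; have [[m _ Fx]|nF] := pselect ((\bigcup_n F n) x).
  near=> n; rewrite (mem_set (A := \bigcup_n F n)); last by exists m.
  apply/mem_set; rewrite -bigcup_mkord; exists m => //=.
  by near: n; exact: nbhs_infty_gt.
near=> n; rewrite (memNset nF) memNset// -bigcup_mkord => -[m _ Fx].
by apply: nF; exists m.
Unshelve. all: by end_near. Qed.

(** The half-space where the i-th coordinate is at least [a] is the limit of
the union of the cubes of size 2^-l whose right end exceeds [a]. *)
Lemma approximable_coord (i : 'I_N) (B : set (measurableTypeR R)) :
  measurable B -> approximable ((fun x : T => tnth x i) @^-1` B).
Proof.
pose C : set (set R) :=
  [set B' | approximable ((fun x : T => tnth x i : R) @^-1` B')].
have CS : sigma_algebra setT C.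
  split.
  - rewrite /C /= preimage_set0 (_ : set0 = stepset 0 set0).
      exact: approximable_step.
    by apply/seteqP; split.
  - by move=> A CA; rewrite /C /= setTD preimage_setC; exact: approximableC.
  - by move=> F CF; rewrite /C /= preimage_bigcup; exact: approximable_bigcup.
move=> mB; have {mB} : (@RGenCInfty.G R).-sigma.-measurable B.
  by rewrite -RGenCInfty.measurableE.
move: B; apply: smallest_sub => // _ [a ->]; rewrite /C /=.
pose s l : set (dyadic N) :=
  [set Q | a < ((tnth (pos Q) i)%:~R + 1) * 2 ^ (- l%:Z)].
apply: (@approximable_limit _ (fun l => stepset l (s l))).
- rewrite -[X in measurable X]setTI.
  by apply: measurable_tnth => //; exact: measurable_itv.
- by move=> n; exact: approximable_step.
move=> x.
have cx l : ((tnth (pos (lat l x)) i)%:~R * 2 ^ (- l%:Z) : R) <= tnth x i <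
    ((tnth (pos (lat l x)) i)%:~R + 1) * 2 ^ (- l%:Z).
  exact: (cube_cell (- l%:Z) x).
have memE l : (x \in stepset l (s l)) =
    (a < ((tnth (pos (lat l x)) i)%:~R + 1) * 2 ^ (- l%:Z)).
  by apply/idP/idP => [/set_mem|h]//; exact/mem_set.
have mem2 : (x \in (fun y : T => tnth y i : R) @^-1` `[a, +oo[) =
    (a <= tnth x i).
  apply/idP/idP => [/set_mem|h]; rewrite ?/preimage /= ?in_itv /= ?andbT//.
  by apply/mem_set; rewrite /preimage /= in_itv /= h.
have [ax|xa] := leP a (tnth x i).
  apply: nearW => l; rewrite memE mem2 ax.
  by have /andP[_ h] := cx l; exact: le_lt_trans ax h.
have p : 0 < a - tnth x i by rewrite subr_gt0.
near=> l; rewrite memE mem2 [RHS]leNgt xa /=; apply/negbTE; rewrite -leNgt.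
have : 2 ^ (- l%:Z) <= a - tnth x i.
  rewrite -invr_expz -exprnP.
  rewrite -[leRHS]invrK lef_pV2 ?posrE ?exprn_gt0 ?invr_gt0//.
  apply: (@le_trans _ _ l%:R); last first.
    by rewrite -natrX ler_nat; apply: ltnW; exact: ltn_expl.
  by near: l; exact: nbhs_infty_ger.
by have /andP[h _] := cx l; rewrite mulrDl mul1r; move: h; lra.
Unshelve. all: by end_near. Qed.

Lemma measurable_approximable A : measurable A -> approximable A.
Proof.
have CS : sigma_algebra setT approximable.
  split.
  - rewrite (_ : set0 = stepset 0 set0); first exact: approximable_step.
    by apply/seteqP; split.
  - by move=> B CA; rewrite setTD; exact: approximableC.
  - by move=> F CF; exact: approximable_bigcup.
rewrite /measurable /=; move: A; apply: smallest_sub => //.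
apply: (big_ind (fun S : set (set T) => S `<=` approximable)) => [A []|S1 S2 h1 h2 A [/h1|/h2]//|i _ _ [B mB <-]].
by rewrite setTI; exact: approximable_coord.
Qed.

(** A number in [0, k] is approximated from below, up to 1, by the number of
thresholds 1, ..., k that it reaches. *)
Lemma count_le_bounds k (y : R) : 0 <= y -> y <= k%:R ->
  y - 1 <= \sum_(i < k) (i.+1%:R <= y)%R%:R <= y.
Proof.
move=> y0.
have h1 n : n%:R <= y -> \sum_(i < n) (i.+1%:R <= y)%R%:R = n%:R :> R.
  move=> ny; rewrite (eq_bigr (fun=> 1)); first by rewrite sumr_const card_ord.
  by move=> i _; rewrite (le_trans _ ny)// ler_nat.
elim: k => [|k IH] yk; first by rewrite big_ord0 y0; lra.
have [ky|ky] := leP k.+1%:R y; first by rewrite h1// ky; move: yk; lra.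
rewrite big_ord_recr /= (_ : (k.+1%:R <= y) = false) ?addr0; last by apply/negbTE; rewrite -ltNge.
have [ky2|ky2] := leP k%:R y; last by apply: IH; exact: ltW.
by rewrite h1// ky2; move: ky; rewrite -natr1; lra.
Qed.

Lemma approximable_common k (A : nat -> set T) e : 0 < e ->
  (forall i, measurable (A i)) ->
  exists l (s : nat -> set (dyadic N)),
    forall i, (i < k)%N -> gap (A i) (stepset l (s i)) < e.
Proof.
move=> e0 mA; elim: k => [|k [l [s h]]]; first by exists 0%N, (fun=> set0).
have [_ /(_ _ e0)[l' [s' h']]] := measurable_approximable (mA k).
exists (l + l')%N, (fun i => if (i < k)%N then [set Q | s i (anc l' Q)]
  else [set Q | s' (anc l Q)]).
have e1 s1 : stepset (l + l') [set Q | s1 (anc l' Q)] = stepset l s1.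
  by apply/seteqP; split => x; rewrite /stepset /= -(lat_anc l l').
have e2 s1 : stepset (l + l') [set Q | s1 (anc l Q)] = stepset l' s1.
  by apply/seteqP; split => x; rewrite /stepset /= (addnC l) -(lat_anc l' l).
move=> i; rewrite ltnS leq_eqVlt => /orP[/eqP ->|ik].
  by rewrite ltnn e2.
by rewrite ik e1; exact: h.
Qed.

(** A function with values in [a, b] is within c = (b - a) / (k + 1) of a + c
times the number of its superlevel sets [A i] that contain the point, and each
of these sets is approximable. *)
Theorem step_approx (f : T -> R) a b e : measurable_fun setT f -> 0 < e ->
  (forall x, a <= f x <= b) ->
  exists l (s : dyadic N -> R), (forall Q, a <= s Q <= b) /\
    itg mu (fun x => `|f x - s (lat l x)| * w x) < e.
Proof.
move=> mf e0 fab.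
have ab : 0 <= b - a.
  by have /andP[h1 h2] := fab (corner R (Dyadic 0 [tuple 0 | i < N])); lra.
pose W := itg mu w; have W0 : 0 <= W by exact: itg_ge0.
have [k kb] : exists k : nat, (b - a) * W / e < k.+1%:R.
  exists (Num.truncn ((b - a) * W / e)); apply: truncnS_gt.
pose c := (b - a) / k.+1%:R.
have kp : 0 < k.+1%:R :> R by [].
have c0 : 0 <= c by rewrite divr_ge0.
have cW : c * W < e.
  by rewrite /c mulrAC ltr_pdivrMr// [e * _]mulrC -ltr_pdivrMr.
pose A i := [set x | a + c * i.+1%:R <= f x].
have mA i : measurable (A i).
  rewrite (_ : A i = setT `&` f @^-1` `[a + c * i.+1%:R, +oo[).
    by apply: mf => //; exact: measurable_itv.
  by rewrite setTI; apply/seteqP; split => x; rewrite /A /preimage /= in_itv /= andbT.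
(* an error e' for each of the k + 1 sets, with weight c, fits into e - c W *)
pose e' := (e - c * W) / (c * k.+1%:R + 1).
have den : 0 < c * k.+1%:R + 1 by rewrite ltr_wpDl// mulr_ge0.
have e'0 : 0 < e' by rewrite divr_gt0// subr_gt0.
have [l [s hs]] := approximable_common k.+1 e'0 mA.
pose st Q := a + c * \sum_(i < k.+1) `[< s i Q >]%:R.
have sumk (P : 'I_k.+1 -> bool) : \sum_(i < k.+1) (P i)%:R <= k.+1%:R :> R.
  rewrite -[X in _ <= X%:R](card_ord k.+1) -sum1_card natr_sum.
  by apply: ler_sum => i _; case: (P i).
have ck : c * k.+1%:R = b - a by rewrite /c divfK.
exists l, st; split.
  move=> Q; rewrite /st lerDl; apply/andP; split.
    by rewrite mulr_ge0// sumr_ge0.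
  by rewrite -lerBrDl -ck; apply: ler_wpM2l => //; exact: sumk.
have ptw x : `|f x - st (lat l x)| * w x <= c * w x +
    \sum_(i < k.+1) c * (`|\1_(A i) x - \1_(stepset l (s i)) x| * w x).
  have -> : c * w x + \sum_(i < k.+1)
      c * (`|\1_(A i) x - \1_(stepset l (s i)) x| * w x) =
      (c + \sum_(i < k.+1) c * `|\1_(A i) x - \1_(stepset l (s i)) x|) * w x.
    by rewrite mulrDl mulr_suml; congr (_ + _); apply: eq_bigr => i _; ring.
  apply: ler_wpM2r => //.
  have Ai i : \1_(A i) x = (a + c * i.+1%:R <= f x)%R%:R :> R.
    rewrite indicE; congr (nat_of_bool _)%:R.
    by apply/idP/idP => [/set_mem|/mem_set].
  have Bi i : \1_(stepset l (s i)) x = `[< s i (lat l x) >]%:R :> R.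
    rewrite indicE; congr (nat_of_bool _)%:R. 
  have fS : `|f x - (a + c * \sum_(i < k.+1) \1_(A i) x)| <= c.
    have /andP[fa fb] := fab x.
    have [cz|cn0] := eqVneq c 0.
      by rewrite cz mul0r addr0; move: ck; rewrite cz mul0r ler_norml; lra.
    have cp : 0 < c by rewrite lt_neqAle eq_sym cn0.
    pose y := (f x - a) / c.
    have y0 : 0 <= y by rewrite divr_ge0 ?subr_ge0.
    have yk : y <= k.+1%:R by rewrite ler_pdivrMr// mulrC ck; lra.
    have := count_le_bounds y0 yk.
    have -> : \sum_(i < k.+1) (i.+1%:R <= y)%R%:R = \sum_(i < k.+1) \1_(A i) x :> R.
      apply: eq_bigr => i _; rewrite Ai /y ler_pdivlMr//.
      by rewrite lerBrDl mulrC.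
    set S := \sum_(i < _) _; have -> : f x = a + c * y.
      by rewrite /y mulrC divfK//; ring.
    by move=> /andP[h1 h2]; rewrite ler_norml; apply/andP; split; nra.
  have -> : f x - st (lat l x) = (f x - (a + c * \sum_(i < k.+1) \1_(A i) x)) +
     \sum_(i < k.+1) c * (\1_(A i) x - \1_(stepset l (s i)) x).
    rewrite /st -mulr_sumr sumrB.
    under [X in _ = _ + c * (_ - X)]eq_bigr do rewrite Bi.
    ring.
  apply: le_trans (ler_normD _ _) _; apply: lerD => //.
  apply: le_trans (ler_norm_sum _ _ _) _; apply: ler_sum => i _.
  by rewrite normrM (ger0_norm c0).
have ms i : measurable (stepset l (s i)) by exact: measurable_step.
have ig (i : 'I_k.+1) : inte mu
    (fun x => c * (`|\1_(A i) x - \1_(stepset l (s i)) x| * w x)).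
  exact/inteZ/inte_gap.
have isum : inte mu (fun x => c * w x +
    \sum_(i < k.+1) c * (`|\1_(A i) x - \1_(stepset l (s i)) x| * w x)).
  by apply: inteD; [exact: inteZ|exact: inte_sum].
apply: (@le_lt_trans _ _ (itg mu (fun x => c * w x +
    \sum_(i < k.+1) c * (`|\1_(A i) x - \1_(stepset l (s i)) x| * w x)))).
  apply: itg_le => //; apply: (inte_le _ isum).
    apply: measurable_funM; last exact: (inteM iw).
    apply: measurableT_comp => //; apply: measurable_funB => //.
    exact: measurable_fun_step.
  by move=> x; rewrite ger0_norm ?mulr_ge0.
rewrite itgD; [|exact: inteZ|exact: inte_sum].
rewrite itgZ// itg_sum//.
have : \sum_(i < k.+1) itg mu
    (fun x => c * (`|\1_(A i) x - \1_(stepset l (s i)) x| * w x)) <=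
    \sum_(i < k.+1) c * e'.
  apply: ler_sum => i _; rewrite itgZ; last exact: inte_gap.
  by apply: ler_wpM2l => //; apply: ltW; exact: hs.
rewrite sumr_const card_ord -mulr_natr -/W => h.
apply: le_lt_trans (lerD (lexx _) h) _.
have : c * e' * k.+1%:R < e - c * W; last by lra.
have : e' * (c * k.+1%:R + 1) = e - c * W by rewrite /e' divfK ?lt0r_neq0.
by move: e'0; lra.
Qed.

End approx.
End density.

(** * Boxes, leaves, and functions determined by their integrals over cubes *)

Section box.
Variables (R : realType) (N : nat).
Local Notation T := (Rn R N).

Definition box (M : nat) : set T :=
  [set y | forall i, - (2 ^+ M) <= (tnth y i : R) < 2 ^+ M].

Variables (M l : nat).
(** The cubes of side 2^-l in the box [-2^M, 2^M)^N. Their positions range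
over -2^(M+l), ..., 2^(M+l) - 1 in each coordinate, and are shifted to natural
numbers. *)
Definition leaf := N.-tuple 'I_(2 ^ (M + l).+1).
HB.instance Definition _ := Finite.on leaf.
Definition leaf_cube (x : leaf) : dyadic N :=
  Dyadic (- l%:Z) [tuple (tnth x i : nat)%:Z - (2 ^ (M + l))%:Z | i < N].

Lemma leaf_cube_inj : injective leaf_cube.
Proof.
move=> x y [] h; apply: eq_from_tnth => i.
have : tnth [tuple (tnth x i : nat)%:Z - (2 ^ (M + l))%:Z | i < N] i =
       tnth [tuple (tnth y i : nat)%:Z - (2 ^ (M + l))%:Z | i < N] i.
  by congr tnth; exact/val_inj.
by rewrite !tnth_mktuple => /addIr [] /val_inj.
Qed.

Lemma pow2E : (2 : R) ^ (- l%:Z) * 2 ^+ (M + l) = 2 ^+ M.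
Proof.
rewrite -invr_expz -exprnP exprD mulrCA mulVf ?mulr1 ?expf_neq0//.
Qed.

Lemma leaf_cube_box x y : cube (leaf_cube x) y -> box M y.
Proof.
move=> h i; have := h i; rewrite /side /= tnth_mktuple.
set e : R := 2 ^ _; have e0 : 0 < e by rewrite exprz_gt0.
have eM : e * 2 ^+ (M + l) = 2 ^+ M by exact: pow2E.
rewrite intrB -!pmulrn natrX => /andP[h1 h2].
have a0 : 0 <= (tnth x i : nat)%:R :> R by [].
have a1 : (tnth x i : nat).+1%:R <= 2 * 2 ^+ (M + l) :> R.
  by rewrite -exprS -natrX ler_nat ltn_ord.
rewrite -eM; move: a1; rewrite -natr1; nra.
Qed.

Lemma box_leaf_cube y : box M y -> exists x, lat l y = leaf_cube x.
Proof.
move=> h; have e0 : (0 : R) < 2 ^ (- l%:Z) by rewrite exprz_gt0.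
have eM := pow2E.
pose a i := Num.floor (tnth y i / (2 : R) ^ (- l%:Z)) + (2 ^ (M + l))%:Z.
have bnd i : 0 <= a i < (2 ^ (M + l).+1)%:Z.
  have /andP[h1 h2] := h i; rewrite /a -lerBlDr sub0r -ltrBrDr.
  have -> : (2 ^ (M + l).+1)%:Z - (2 ^ (M + l))%:Z = (2 ^ (M + l))%:Z.
    by rewrite expnS; lia.
  rewrite floor_ge_int floor_lt_int mulrNz -!pmulrn natrX.
  by rewrite ler_pdivlMr// ltr_pdivrMr// mulNr [2 ^+ _ * _]mulrC eM h1 h2.
have bn i : (`|a i| < 2 ^ (M + l).+1)%N.
  by have /andP[h1 h2] := bnd i; rewrite -ltz_nat gez0_abs.
exists [tuple Ordinal (bn i) | i < N].
congr Dyadic; apply: eq_from_tnth => i; rewrite !tnth_mktuple /=.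
by have /andP[h1 h2] := bnd i; rewrite gez0_abs// /a addrK.
Qed.

Lemma ind_box y : \1_(box M) y = \sum_(x : leaf) \1_(cube (leaf_cube x)) y :> R.
Proof.
have [/box_leaf_cube[x hx]|nb] := pselect (box M y).
  have cy : cube (leaf_cube x) y by rewrite -hx; exact: cube_cell.
  rewrite indicE mem_set; last exact: leaf_cube_box cy.
  rewrite (bigD1 x)//= indicE mem_set// big1 ?addr0// => z zx.
  rewrite indicE memNset// => cz; move/eqP: zx; apply.
  by apply: leaf_cube_inj; exact: cube_inj cz cy _.
rewrite indicE memNset// big1// => x _; rewrite indicE memNset//.
by move=> /leaf_cube_box.
Qed.

Lemma step_box (s : dyadic N -> R) y :
  s (lat l y) * \1_(box M) y =
  \sum_(x : leaf) s (leaf_cube x) * \1_(cube (leaf_cube x)) y.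
Proof.
rewrite ind_box mulr_sumr; apply: eq_bigr => x _.
rewrite indicE; case: (boolP (y \in _)) => [/set_mem /cubeP h|_].
  by rewrite /lat -{1}h.
by rewrite !mulr0.
Qed.

Lemma measurable_box : measurable (box M).
Proof.
have -> : box M = \bigcup_(x in [set: leaf]) cube (leaf_cube x).
  apply/seteqP; split=> y; last by move=> [x _]; exact: leaf_cube_box.
  by move=> /box_leaf_cube[x hx]; exists x => //; rewrite -hx; exact: cube_cell.
apply: fin_bigcup_measurable; first exact: finite_finset.
by move=> x _; exact: measurable_cube.
Qed.

End box.

Section L2cubes.
Variables (R : realType) (N : nat).
Local Notation mu := (lebesgue R N).
Local Notation T := (Rn R N).
Local Notation itg := (itg mu).
Local Notation inte := (inte mu).
Local Notation ip := (ip mu).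
Local Notation L2r := (L2r mu).
Implicit Types (f g h F G : T -> R) (Q P A B : dyadic N).

Local Notation "1[ Q ]" := (\1_(cube Q) : T -> R) (at level 0, format "1[ Q ]").

Lemma ind_sqr (A : set T) x : \1_A x ^+ 2 = \1_A x :> R.
Proof. by rewrite indicE; case: (_ \in _); rewrite ?expr1n ?expr0n. Qed.

Lemma ind_ge0 (A : set T) x : 0 <= \1_A x :> R.
Proof. by rewrite indicE. Qed.

Lemma inte_ind1 (A : set T) : measurable A -> (mu A < +oo)%E ->
  inte (\1_A : T -> R).
Proof.
move=> mA Afin; apply/integrableP; split.
  by apply/measurable_EFinP; exact: measurable_indic.
under eq_integral => x _ do rewrite /= ger0_norm ?ind_ge0//.
by rewrite integral_indic// setIT.
Qed.

Lemma itg_ind1 (A : set T) : measurable A -> itg (\1_A : T -> R) = fine (mu A).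
Proof. by move=> mA; rewrite itgE /Rintegral integral_indic// setIT. Qed.

Lemma inte_cube Q : inte (1[Q]).
Proof.
by apply: inte_ind1; [exact: measurable_cube|rewrite lebesgue_cube ltry].
Qed.

Lemma itg_cube Q : itg (1[Q]) = vol R Q.
Proof. by rewrite itg_ind1 ?lebesgue_cube//; exact: measurable_cube. Qed.

Lemma L2r_cube Q : L2r (1[Q]).
Proof.
split; first by apply: measurable_indic; exact: measurable_cube.
under eq_fun do rewrite ind_sqr; exact: inte_cube.
Qed.

Lemma inte_cubeM Q f : L2r f -> inte (fun x => 1[Q] x * f x).
Proof. by apply: L2r_inte; exact: L2r_cube. Qed.

Lemma L2r_box M : L2r (\1_(box M) : T -> R).
Proof.
rewrite (_ : (\1_(box M) : T -> R) =
    fun y => \sum_(x : leaf N M 0) 1[leaf_cube x] y); last first.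
  by apply/funext => y; rewrite (ind_box M 0).
by apply: L2r_sum => x _; exact: L2r_cube.
Qed.

Lemma near_box (x : T) : \forall n \near \oo, box n x.
Proof.
have [n hn] : exists n : nat, forall i, `|tnth x i : R| < n%:R.
  exists (\max_i (Num.truncn `|tnth x i : R|).+1)%N => i.
  apply: (lt_le_trans (truncnS_gt _)); rewrite ler_nat.
  by rewrite (bigD1 i) //= leq_maxl.
near=> m => i.
have : `|tnth x i : R| < 2 ^+ m.
  apply: (lt_le_trans (hn i)); rewrite -natrX ler_nat.
  apply: (@leq_trans m); last exact/ltnW/ltn_expl.
  by near: m; exact: nbhs_infty_ge.
by rewrite ltr_norml => /andP[/ltW -> ->].
Unshelve. all: by end_near. Qed.

Definition cutoff n f : T -> R :=
  fun x => \1_(box n `&` [set x | `|f x| <= n%:R]) x * f x.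

Lemma measurable_cutoff_set n f : measurable_fun setT f ->
  measurable (box n `&` [set x | `|f x| <= n%:R] : set T).
Proof.
move=> mf; apply: measurableI; first exact: measurable_box.
have -> : [set x | `|f x| <= n%:R] = setT `&` (fun x => `|f x|) @^-1` `]-oo, n%:R].
  by rewrite setTI; apply/seteqP; split => x; rewrite /preimage /= in_itv.
have mn : measurable_fun setT (fun x : T => `|f x|).
  by apply: measurableT_comp.
by apply: mn => //; exact: measurable_itv.
Qed.

Lemma cutoff_near f x : \forall n \near \oo, cutoff n f x = f x.
Proof.
near=> n; rewrite /cutoff indicE mem_set ?mul1r//; split.
  by near: n; exact: near_box.
by rewrite /=; near: n; exact: nbhs_infty_ger.
Unshelve. all: by end_near. Qed.

Lemma cutoff_cvg f x : cutoff n f x @[n --> \oo] --> f x.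
Proof. by apply: cvg_near_cst; exact: cutoff_near. Qed.

Lemma cutoff_le n f x : `|cutoff n f x| <= `|f x|.
Proof. exact: norm_ind_le. Qed.

Lemma cutoff_bound n f x : `|cutoff n f x| <= n%:R.
Proof.
rewrite /cutoff indicE; case: (boolP (x \in _)) => [/set_mem[_ h]|_].
  by rewrite mul1r.
by rewrite mul0r normr0.
Qed.

Lemma measurable_cutoff n f : measurable_fun setT f -> measurable_fun setT (cutoff n f).
Proof.
move=> mf; apply: measurable_funM => //; apply: measurable_indic.
exact: measurable_cutoff_set.
Qed.

Lemma cutoff_box n f x : cutoff n f x * \1_(box n) x = cutoff n f x.
Proof.
rewrite /cutoff !indicE; case: (boolP (x \in _)) => [/set_mem[b _]|_].
  by rewrite mem_set// mulr1.
by rewrite !mul0r.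
Qed.

(** By [step_approx] each truncation of [F], being bounded, is a limit of step
functions in L^1(|F|) on a box, hence is orthogonal to [F]. *)
Lemma cube_integrals_null F : L2r F ->
  (forall Q, itg (fun x => 1[Q] x * F x) = 0) -> ip F F = 0.
Proof.
move=> F2 F0; have mF := L2rM F2.
have cut0 n : itg (fun x => cutoff n F x * F x) = 0.
  pose w x := `|F x| * \1_(box n) x.
  have mw : measurable_fun setT w.
    apply: measurable_funM; first exact: measurableT_comp.
    by apply: measurable_indic; exact: measurable_box.
  have Lw : inte w.
    apply: L2r_inte; last exact: L2r_box.
    apply: (L2r_le _ F2) => [|x]; first exact: measurableT_comp.
    by rewrite normr_id.
  have w0 x : 0 <= w x by rewrite mulr_ge0.
  apply/eqP; rewrite -normr_le0; apply/ler_addgt0Pr => e e0; rewrite add0r.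
  have [x|l [s [sb hs]]] :=
      step_approx w0 Lw (a := - n%:R) (b := n%:R) (measurable_cutoff n mF) e0.
    by rewrite -ler_norml cutoff_bound.
  have z : itg (fun x => s (lat l x) * \1_(box n) x * F x) = 0.
    rewrite (@eq_itg _ _ _ _ _
      (fun x => \sum_(y : leaf N n l) s (leaf_cube y) *
        (1[leaf_cube y] x * F x))); last first.
      by move=> x; rewrite step_box mulr_suml; apply: eq_bigr => y _; ring.
    rewrite itg_sum; last by move=> y _; apply: inteZ; exact: inte_cubeM.
    by rewrite big1// => y _; rewrite itgZ ?F0 ?mulr0//; exact: inte_cubeM.
  have i1 : inte (fun x => cutoff n F x * F x).
    apply: L2r_inte => //; apply: (L2r_le _ F2); first exact: measurable_cutoff.
    by move=> x; exact: cutoff_le.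
  have ms : measurable_fun setT (fun x : T => s (lat l x)).
    exact: measurable_fun_step.
  have i2 : inte (fun x => s (lat l x) * \1_(box n) x * F x).
    apply: (inte_le _ (inteZ n%:R Lw)).
      apply: measurable_funM => //; apply: measurable_funM => //.
      by apply: measurable_indic; exact: measurable_box.
    move=> x; rewrite -mulrA normrM; apply: ler_pM => //.
      by rewrite ler_norml.
    by rewrite normrM mulrC (ger0_norm (ind_ge0 _ _)).
  rewrite -[X in `|X|]subr0 -z -itgB//; apply: le_trans (ltW hs).
  have i3 : inte (fun x => `|cutoff n F x - s (lat l x)| * w x).
    apply: (inte_le _ (inteZ (2 * n%:R) Lw)).
      apply: measurable_funM => //; apply: measurableT_comp => //.
      by apply: measurable_funB => //; exact: measurable_cutoff.
    move=> x; rewrite ger0_norm ?mulr_ge0//; apply: ler_wpM2r => //.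
    apply: le_trans (ler_normB _ _) _.
    have := cutoff_bound n F x; have : `|s (lat l x)| <= n%:R by rewrite ler_norml.
    lra.
  apply: itg_le_norm => //; first exact: inteB.
  move=> x.
  have e1 : cutoff n F x * F x = cutoff n F x * \1_(box n) x * F x by rewrite cutoff_box.
  have -> : cutoff n F x * F x - s (lat l x) * \1_(box n) x * F x =
      (cutoff n F x - s (lat l x)) * (F x * \1_(box n) x) by rewrite e1; ring.
  by rewrite 2!normrM (ger0_norm (ind_ge0 _ _)).
have : (fun n => itg (fun x => cutoff n F x * F x)) @ \oo --> ip F F.
  apply: (itg_dominated (g := fun x => F x * F x)).
  - exact: L2r_inte.
  - exact: measurable_funM.
  - by move=> n; apply: measurable_funM => //; exact: measurable_cutoff.
  - by move=> x; apply: cvgM; [exact: cutoff_cvg|exact: cvg_cst].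
  - move=> n x; rewrite -expr2 -(real_normK (num_real (F x))) expr2 normrM.
    by apply: ler_wpM2r => //; exact: cutoff_le.
under eq_fun do rewrite cut0.
by move=> h; have := cvg_unique _ h (cvg_cst 0); apply.
Qed.

End L2cubes.

(** * Pairs of adjoint operators with band structure *)

Section localization.
Variables (R : realType) (N : nat).
Hypothesis hN : (0 < N)%N.
Local Notation mu := (lebesgue R N).
Local Notation T := (Rn R N).
Local Notation itg := (itg mu).
Local Notation inte := (inte mu).
Local Notation ip := (ip mu).
Local Notation nrm := (nrm mu).
Local Notation L2r := (L2r mu).
Implicit Types (f g h F G phi : T -> R) (Q P A B : dyadic N).
Local Notation "1[ Q ]" := (\1_(cube Q) : T -> R) (at level 0, format "1[ Q ]").

(** A Haar function on the parent of [A]: it is 2^N - 1 on [A] and -1 on the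
siblings of [A]. Together these span the Haar functions on that parent. *)
Definition child_haar A : T -> R := fun x => 2 ^+ N * 1[A] x - 1[parent A] x.

Lemma L2r_child_haar A : L2r (child_haar A).
Proof. by apply: L2rB; [apply: L2rZ|]; exact: L2r_cube. Qed.

Lemma ip_child_haar G A : L2r G -> ip G (child_haar A) =
  2 ^+ N * itg (fun x => 1[A] x * G x) - itg (fun x => 1[parent A] x * G x).
Proof.
move=> G2; rewrite ipC ipBl ?ipZl//; try exact: L2r_cube.
by apply: L2rZ; exact: L2r_cube.
Qed.

Lemma ind_below A P x : below A P -> 1[P] x * 1[A] x = 1[A] x.
Proof.
move=> AP; rewrite !indicE; case: (boolP (x \in cube A)) => [/set_mem h|_].
  by rewrite mulr1 mem_set//; exact: below_sub h.
by rewrite mulr0.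
Qed.

Lemma ind_disjoint A P x : ~ below A P -> ~ below P A -> 1[P] x * 1[A] x = 0.
Proof.
move=> AP PA; rewrite !indicE; case: (boolP (x \in cube A)) => [/set_mem h|_].
  rewrite memNset ?mul0r// => hP.
  have [lAP|lPA] := leP (level A) (level P).
    apply: AP; exists `|level P - level A|%N.
    by apply/esym; apply: (cube_nested h hP); lia.
  apply: PA; exists `|level A - level P|%N.
  by apply/esym; apply: (cube_nested hP h); lia.
by rewrite mulr0.
Qed.

(** Going up one generation multiplies the integral of [G] by 2^N, whereas
Cauchy-Schwarz allows it to grow like the square root of the volume, that is
by 2^(N/2). *)
Lemma integral_vanish_from_above G Q : L2r G ->
  (forall i, 2 ^+ N * itg (fun x => 1[anc i Q] x * G x) =
    itg (fun x => 1[parent (anc i Q)] x * G x)) ->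
  itg (fun x => 1[Q] x * G x) = 0.
Proof.
move=> G2 h; set I := itg _; set D : R := 2 ^+ N.
have Ii i : itg (fun x => 1[anc i Q] x * G x) = D ^+ i * I.
  elim: i => [|i IH]; first by rewrite expr0 mul1r.
  by rewrite /anc iterS -/(anc i Q) -h IH exprS mulrA.
have bnd i : I ^+ 2 * D ^+ i <= vol R Q * ip G G.
  have := ip_CS2 (L2r_cube R (anc i Q)) G2.
  rewrite (_ : ip 1[anc i Q] G = D ^+ i * I); last exact: Ii.
  rewrite (_ : ip 1[anc i Q] 1[anc i Q] = D ^+ i * vol R Q); last first.
    rewrite -vol_anc -itg_cube; apply: eq_itg => x.
    by rewrite -expr2 ind_sqr.
  have Dp : 0 < D ^+ i by rewrite !exprn_gt0.
  move=> h'; rewrite -(ler_pM2l Dp).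
  have -> : D ^+ i * (I ^+ 2 * D ^+ i) = (D ^+ i * I) ^+ 2 by ring.
  by apply: le_trans h' _; rewrite le_eqVlt; apply/orP; left; apply/eqP; ring.
apply/eqP/negP => /negP I0.
have I2 : 0 < I ^+ 2 by rewrite exprn_even_gt0.
have := truncnS_gt (vol R Q * ip G G / I ^+ 2); move: (Num.truncn _).+1 => n.
rewrite ltr_pdivrMr// => h'; have := bnd n.
rewrite leNgt => /negP; apply; apply: (lt_le_trans h').
rewrite mulrC; apply: ler_wpM2l; first exact: ltW.
rewrite /D -exprM -natrX ler_nat; apply: (@leq_trans (2 ^ n)%N); first by apply: ltnW; exact: ltn_expl.
by rewrite leq_exp2l// leq_pmull.
Qed.

(** By [integral_vanish_from_above] the integral of [G] over a cube whose
parent is not below [P] is zero. So [G] minus its restriction to [P] has zero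
integral over all cubes, and [cube_integrals_null] applies. *)
Lemma vanish_off G P : L2r G ->
  (forall B, ~ below (parent B) P -> ip G (child_haar B) = 0) ->
  forall phi, L2r phi -> (forall x, cube P x -> phi x = 0) -> ip G phi = 0.
Proof.
move=> G2 h phi p2 p0.
have avg0 Q : ~ below (parent Q) P -> itg (fun x => 1[Q] x * G x) = 0.
  move=> QP; apply: integral_vanish_from_above => // i; apply/eqP; rewrite -subr_eq0 -ip_child_haar//.
  apply/eqP; apply: h => hb; apply: QP.
  apply: below_trans hb; exists i; by rewrite -ancS /anc iterS.
have strict Q : ~ below (parent Q) Q.
  move=> [n /(congr1 (@level N))]; rewrite level_anc /=; lia.
pose F x := G x - 1[P] x * G x.
have F2 : L2r F.
  by apply: L2rB => //; apply: L2r_ind => //; exact: measurable_cube.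
have F0 : ip F F = 0.
  apply: cube_integrals_null => // Q.
  have -> : itg (fun x => 1[Q] x * F x) =
      itg (fun x => 1[Q] x * G x) - itg (fun x => 1[P] x * 1[Q] x * G x).
    rewrite -itgB; first by apply: eq_itg => x; rewrite /F; ring.
      exact: inte_cubeM.
    under eq_fun do rewrite -mulrA.
    apply: inte_cubeM; apply: L2r_ind => //; exact: measurable_cube.
  have [QP|QP] := pselect (below Q P).
    by under [X in _ - X]eq_itg do rewrite (ind_below _ QP); rewrite subrr.
  rewrite avg0; last by move=> /below_parent.
  rewrite sub0r; have [PQ|PQ] := pselect (below P Q).
    under eq_itg do rewrite mulrC (mulrC (1[P] _)) (ind_below _ PQ) mulrC.
    by rewrite avg0 ?oppr0//; exact: strict.
  under eq_itg do rewrite ind_disjoint// mul0r.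
  by rewrite itg0 oppr0.
rewrite -(ip_null F2 p2 F0); apply: eq_itg => x; rewrite /F.
have [/p0 ->|nP] := pselect (cube P x); first by rewrite !mulr0.
by rewrite indicE memNset// mul0r subr0.
Qed.

(** Orthogonality to the Haar functions below [P] makes all averages over
cubes below [P] equal, so [G] is constant on [P]. *)
Lemma const_on G P : L2r G ->
  (forall A, below (parent A) P -> ip G (child_haar A) = 0) ->
  forall h, L2r h -> (forall x, ~ cube P x -> h x = 0) -> itg h = 0 -> ip G h = 0.
Proof.
move=> G2 hG h h2 h0 hi.
have hP x : h x = 1[P] x * h x.
  have [px|/h0 ->] := pselect (cube P x); last by rewrite mulr0.
  by rewrite indicE mem_set ?mul1r.
pose c := itg (fun x => 1[P] x * G x) / vol R P.
have vP : vol R P != 0 by rewrite lt0r_neq0 ?vol_gt0.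
have avg n : forall Q, anc n Q = P -> itg (fun x => 1[Q] x * G x) = c * vol R Q.
  elim: n => [|n IH] Q; first by move=> /= ->; rewrite divfK.
  rewrite ancS => hQ; have := IH _ hQ.
  have := hG Q (ex_intro _ n hQ); rewrite ip_child_haar// => /eqP; rewrite subr_eq0.
  move=> /eqP <-; rewrite vol_parent => e.
  have D0 : 2 ^+ N != 0 :> R by rewrite expf_neq0.
  by apply: (mulfI D0); rewrite e; ring.
pose F x := 1[P] x * G x - c * 1[P] x.
have F2 : L2r F.
  apply: L2rB; first by apply: L2r_ind => //; exact: measurable_cube.
  by apply: L2rZ; exact: L2r_cube.
have cPQ Q : itg (fun x => 1[Q] x * F x) =
    itg (fun x => (1[P] x * 1[Q] x) * G x) - c * itg (fun x => 1[P] x * 1[Q] x).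
  have i1 : inte (fun x => 1[P] x * 1[Q] x).
    by apply: inte_cubeM; exact: L2r_cube.
  rewrite -itgZ// -itgB; last exact: inteZ.
    by apply: eq_itg => x; rewrite /F; ring.
  under eq_fun do rewrite -mulrA.
  apply: inte_cubeM; apply: L2r_ind => //; exact: measurable_cube.
have F0 : ip F F = 0.
  apply: cube_integrals_null => // Q; rewrite cPQ.
  have [QP|QP] := pselect (below Q P).
    under eq_itg do rewrite (ind_below _ QP).
    under [X in _ - _ * X]eq_itg do rewrite (ind_below _ QP).
    by case: QP => n hn; rewrite (avg n)// itg_cube subrr.
  have [PQ|PQ] := pselect (below P Q).
    under eq_itg do rewrite (mulrC (1[P] _)) (ind_below _ PQ).
    under [X in _ - _ * X]eq_itg do rewrite (mulrC (1[P] _)) (ind_below _ PQ).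
    by rewrite (avg 0%N)// itg_cube subrr.
  under eq_itg do rewrite ind_disjoint// mul0r.
  under [X in _ - _ * X]eq_itg do rewrite ind_disjoint//.
  by rewrite !itg0 mulr0 subrr.
have ih : inte h.
  by rewrite (_ : h = fun x => 1[P] x * h x); [exact: inte_cubeM|exact/funext].
have e : ip F h = ip G h - c * itg h.
  rewrite -itgZ// -itgB; [|exact: L2r_inte|exact: inteZ].
  apply: eq_itg => x; rewrite /F; have := hP x.
  by rewrite indicE; case: (_ \in _) => /= e; [ring|rewrite e; ring].
by have := ip_null F2 h2 F0; rewrite e hi mulr0 subr0.
Qed.

(** What is used of the real or imaginary part of a band operator, [S'] being
its adjoint. The band condition is expressed without the tree distance: the
image of a Haar function below [P] is orthogonal to Haar functions not below
the r-th ancestor of [P]. *)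
Record band_pair (r : nat) (K : R) (S S' : (T -> R) -> T -> R) : Prop :=
  BandPair {
  bp_K : 0 <= K;
  bp_L2 : forall f, L2r f -> L2r (S f);
  bp_L2' : forall f, L2r f -> L2r (S' f);
  bp_adj : forall f g, L2r f -> L2r g -> ip (S f) g = ip f (S' g);
  bp_bound : forall f, L2r f -> nrm (S f) <= K * nrm f;
  bp_bound' : forall f, L2r f -> nrm (S' f) <= K * nrm f;
  bp_band : forall A B P, below (parent A) P -> ~ below (parent B) (anc r P) ->
    ip (S (child_haar A)) (child_haar B) = 0;
  bp_band' : forall A B P, below (parent A) P -> ~ below (parent B) (anc r P) ->
    ip (S' (child_haar A)) (child_haar B) = 0 }.

Lemma band_pair_sym r K S S' : band_pair r K S S' -> band_pair r K S' S.
Proof.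
case=> K0 h1 h2 h3 h4 h5 h6 h7; split => // f g f2 g2.
by rewrite ipC -h3// ipC.
Qed.

Section pair.
Variables (r : nat) (K : R) (S S' : (T -> R) -> T -> R).
Hypothesis bp : band_pair r K S S'.

Lemma ipS_bound f g : L2r f -> L2r g -> `|ip (S f) g| <= K * (nrm f * nrm g).
Proof.
move=> f2 g2; apply: le_trans (ip_CS (bp_L2 bp f2) g2) _.
by rewrite mulrA; apply: ler_wpM2r; [exact: sqrtr_ge0|exact: (bp_bound bp)].
Qed.

(** For a child Haar function below [P], the image is zero off the r-th
ancestor ([vanish_off]). Hence [S' phi] is orthogonal to all of them, so it is
constant on [P] ([const_on]), and pairs to zero with [h]. *)
Lemma localized P h phi : L2r h -> (forall x, ~ cube P x -> h x = 0) ->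
  itg h = 0 -> L2r phi -> (forall x, cube (anc r P) x -> phi x = 0) ->
  ip (S h) phi = 0.
Proof.
move=> h2 h0 hi p2 p0; rewrite (bp_adj bp)// ipC.
apply: (const_on (bp_L2' bp p2) (P := P)) => // A AP.
rewrite (bp_adj (band_pair_sym bp))//; last exact: L2r_child_haar.
rewrite ipC.
apply: (vanish_off (bp_L2 bp (L2r_child_haar A)) (P := anc r P)) => // B BP.
exact: (bp_band bp AP BP).
Qed.

End pair.
End localization.

(** * The Calderon-Zygmund decomposition *)

Section weak_type.
Variables (R : realType) (N : nat).
Hypothesis hN : (0 < N)%N.
Local Notation mu := (lebesgue R N).
Local Notation T := (Rn R N).
Local Notation itg := (itg mu).
Local Notation inte := (inte mu).
Local Notation ip := (ip mu).
Local Notation nrm := (nrm mu).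
Local Notation L2r := (L2r mu).
Implicit Types (f g h F G phi : T -> R) (Q P A B : dyadic N).
Local Notation "1[ Q ]" := (\1_(cube Q) : T -> R) (at level 0, format "1[ Q ]").

Lemma L2r_abs f : L2r f -> L2r (fun x => `|f x|).
Proof.
move=> f2; apply: (L2r_le _ f2) => [|x]; last by rewrite normr_id.
by apply: measurableT_comp => //; exact: L2rM f2.
Qed.

Section disjoint_family.
Variable Qs : seq (dyadic N).
Hypothesis uQs : uniq Qs.
Hypothesis dQs : forall Q Q' (x : T), Q \in Qs -> Q' \in Qs -> cube Q x -> cube Q' x ->
  Q = Q' :> dyadic N.

Definition union_cubes : set T := [set x | exists2 Q, Q \in Qs & cube Q x].

Lemma sum_at Q0 (x : T) : Q0 \in Qs -> cube Q0 x ->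
  forall c : dyadic N -> R, \sum_(Q <- Qs) c Q * 1[Q] x = c Q0.
Proof.
move=> Q0s Q0x c; rewrite (bigD1_seq Q0)//= indicE mem_set// mulr1.
rewrite big_seq_cond big1 ?addr0// => Q /andP[Qs' QQ0].
rewrite indicE memNset ?mulr0// => Qx; move/eqP: QQ0; apply.
exact: (dQs _ _ Qx Q0x).
Qed.

Lemma sum_off x : ~ union_cubes x ->
  forall c : dyadic N -> R, \sum_(Q <- Qs) c Q * 1[Q] x = 0.
Proof.
move=> nx c; rewrite big_seq big1// => Q Qs'; rewrite indicE memNset ?mulr0//.
by move=> Qx; apply: nx; exists Q.
Qed.

Lemma measurable_union_cubes : measurable union_cubes.
Proof.
have -> : union_cubes = \bigcup_(Q in [set` Qs]) cube Q.
  by apply/seteqP; split => x [Q h1 h2]; exists Q.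
apply: fin_bigcup_measurable; first exact: finite_seq.
by move=> Q _; exact: measurable_cube.
Qed.

End disjoint_family.

Section stopping.
Variables (a : T -> R) (lam : R).
Hypotheses (a0 : forall x, 0 <= a x) (a2 : L2r a) (ia : inte a).
Hypothesis lam0 : 0 < lam.
Local Notation m Q := (itg (fun x => 1[Q] x * a x)).

(** The maximal cubes on which the average of [a] exceeds [lam]. *)
Definition stop Q := lam * vol R Q < m Q /\
  forall i, m (anc i.+1 Q) <= lam * vol R (anc i.+1 Q).

Lemma m_le Q : m Q <= itg a.
Proof.
apply: itg_le => //; first exact: inte_cubeM.
by move=> x; rewrite ler_piMl// indicE; case: (_ \in _).
Qed.

Lemma m_parent Q : m Q <= m (parent Q).
Proof.
apply: itg_le; try exact: inte_cubeM.
move=> x; apply: ler_wpM2r => //; rewrite !indicE.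
case: (boolP (x \in cube Q)) => [/set_mem h|_]; last by rewrite ler0n.
by rewrite mem_set//; exact: (cube_anc 1 h).
Qed.

(** The parent of a stopping cube has average at most [lam]. *)
Lemma stop_ub Q : stop Q -> m Q <= lam * 2 ^+ N * vol R Q.
Proof.
move=> [_ /(_ 0%N) h]; apply: le_trans (m_parent Q) _; apply: le_trans h _.
by rewrite /= vol_parent mulrA.
Qed.

Lemma stop_disjoint Q Q' (x : T) : stop Q -> stop Q' -> cube Q x -> cube Q' x -> Q = Q'.
Proof.
clear hN a0 a2 ia lam0; wlog le : Q Q' / level Q <= level Q'.
  move=> H s1 s2 x1 x2; have [l|l] := leP (level Q) (level Q'); first exact: H.
  by apply/esym; apply: H => //; exact: ltW.
move=> [_ s1] [s2 _] x1 x2.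
have [n hn] : exists n : nat, level Q' = level Q + n%:Z.
  by exists `|level Q' - level Q|%N; lia.
have e := cube_nested x1 x2 hn; case: n hn e => [//|n] hn e.
by have := s1 n; rewrite -e leNgt s2.
Qed.

(** Averages over ancestors of high order are small as [a] is integrable, so
there is a largest ancestor with average above [lam]. *)
Lemma stop_exists Q L : lam * vol R Q < m Q ->
  itg a <= lam * vol R (anc L Q) -> exists2 k, (k <= L)%N & stop (anc k Q).
Proof.
move=> hQ hL.
have small i : (L <= i)%N -> m (anc i Q) <= lam * vol R (anc i Q).
  move=> Li; apply: le_trans (m_le _) _; apply: le_trans hL _.
  rewrite ler_pM2l// -(subnK Li) anc_add [leRHS]vol_anc ler_peMl ?(ltW (vol_gt0 _ _))//.
  by rewrite !exprn_ege1 ?ler1n.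
pose P i := lam * vol R (anc i Q) < m (anc i Q).
have exP : exists i, P i by exists 0%N.
have ubP i : P i -> (i <= L)%N.
  by rewrite /P => Pi; rewrite leqNgt; apply/negP => /ltnW/small; rewrite leNgt Pi.
case: (ex_maxnP exP ubP) => k Pk maxk; exists k; first exact: ubP.
split=> // i; rewrite -anc_add leNgt; apply/negP => /maxk.
by rewrite addSn ltnNge leq_addl.
Qed.

(** Only a finite list of cubes is selected: [a] is cut off to a bounded
function in a box and approximated by a step function on leaves, and the
stopping cubes above these leaves are taken. On a leaf that meets no selected
cube the average of [a] is at most [lam]; [e] pays for the approximations. *)
Lemma stopping_cubes e : 0 < e -> exists Qs : seq (dyadic N),
  [/\ uniq Qs, (forall Q, Q \in Qs -> stop Q) &
      itg (fun x => \1_(~` union_cubes Qs) x * a x ^+ 2) <=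
      lam * itg a + e].
Proof.
move=> e0; have e3 : 0 < e / 3 by rewrite divr_gt0.
have ma := L2rM a2.
have [n [hn1 hn2]] : exists n, itg (fun x => a x * a x - cutoff n a x * a x) < e / 3
    /\ itg a <= lam * 2 ^+ n.
  have cv : (fun n => itg (fun x => a x * a x - cutoff n a x * a x)) @ \oo -->
      itg (fun=> 0 : R).
    apply: (itg_dominated (g := fun x => a x * a x)).
    - exact: L2r_inte.
    - exact: measurable_cst.
    - move=> n; apply: measurable_funB; apply: measurable_funM => //.
      exact: measurable_cutoff.
    - move=> x; apply: cvg_near_cst; near=> n.
      have -> : cutoff n a x = a x by near: n; exact: cutoff_near.
      by rewrite subrr.
    - move=> n x; rewrite -mulrBl normrM (ger0_norm (a0 x)).
      apply: ler_wpM2r => //; rewrite /cutoff indicE; case: (_ \in _).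
        by rewrite mul1r subrr normr0.
      by rewrite mul0r subr0 ger0_norm.
  rewrite itg0 in cv.
  move/cvgr0Pnorm_lt : cv => /(_ _ e3) cv.
  near \oo => n; exists n; split.
    apply: le_lt_trans (ler_norm _) _; near: n; exact: cv.
  rewrite -ler_pdivrMl// mulrC; apply: (@le_trans _ _ n%:R); last first.
    by rewrite -natrX ler_nat; apply: ltnW; exact: ltn_expl.
  by near: n; exact: nbhs_infty_ger.
pose f := cutoff n a.
have f0 x : 0 <= f x by rewrite mulr_ge0 ?ind_ge0.
have fn x : f x <= n%:R by apply: le_trans (cutoff_bound n a x); exact: ler_norm.
have fa x : f x <= a x.
  by rewrite -[a x]ger0_norm//; apply: le_trans (cutoff_le n a x); exact: ler_norm.
have mf : measurable_fun setT f by exact: measurable_cutoff.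
pose w x := (a x + 1) * \1_(box n) x.
have w0 x : 0 <= w x by rewrite mulr_ge0 ?ind_ge0 ?addr_ge0.
have L2box := L2r_box R N n.
have ibox : inte (\1_(box n) : T -> R).
  by have [_] := L2box; under eq_fun do rewrite ind_sqr.
have iw : inte w.
  rewrite (_ : w = fun x => a x * \1_(box n) x + \1_(box n) x).
    by apply: inteD => //; exact: L2r_inte.
  by apply/funext => x; rewrite /w mulrDl mul1r.
pose e' := e / (3 * (1 + lam)).
have e'0 : 0 < e' by rewrite divr_gt0// mulr_gt0// addr_gt0.
have [x|l [s [sb hs]]] := step_approx w0 iw (a := 0) (b := n%:R) mf e'0.
  by rewrite f0 fn.
pose L := (n + l)%N.
(* L generations above a leaf the average of a is at most lam by the choice of
   n *)
pose Qs := undup [seq Q <- [seq anc k (leaf_cube x) | k <- iota 0 L.+1,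
   x <- enum {: leaf N n l}] | `[< stop Q >]].
have stopQs Q : Q \in Qs -> stop Q.
  by rewrite mem_undup mem_filter => /andP[/asboolP].
exists Qs; split => //; first exact: undup_uniq.
set Om := union_cubes Qs.
have mOm : measurable Om by exact: measurable_union_cubes.
have mOC : measurable (~` Om) by exact: measurableC.
have leafP (x : leaf N n l) :
    itg (fun y => \1_(~` Om) y * (1[leaf_cube x] y * a y)) <=
    lam * vol R (leaf_cube x).
  have [h|h] := leP (m (leaf_cube x)) (lam * vol R (leaf_cube x)).
    apply: le_trans h; apply: itg_le.
    - by apply: inte_ind => //; exact: inte_cubeM.
    - exact: inte_cubeM.
    - by move=> y; rewrite ler_piMl ?mulr_ge0 ?ind_ge0//.
  have [|k kL sk] := stop_exists (L := L) h.
    apply: le_trans hn2 _; rewrite ler_pM2l// vol_anc /vol /side /=.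
    rewrite -exprM mulnC exprM -exprMn mulrC pow2E.
    rewrite -[X in X <= _]expr1; apply: ler_weXn2l => //.
    by rewrite exprn_ege1// ler1n.
  have inQs : anc k (leaf_cube x) \in Qs.
    rewrite mem_undup mem_filter; apply/andP; split; first exact/asboolP.
    apply/allpairsP; exists (k, x); split; rewrite ?mem_enum ?mem_iota// add0n ltnS.

  rewrite (@eq_itg _ _ _ _ _ (fun=> 0)).
    by rewrite itg0 mulr_ge0 ?ltW ?vol_gt0.
  move=> y; rewrite !indicE.
  case: (boolP (y \in cube (leaf_cube x))) => [/set_mem hy|_]; last first.
    by rewrite mul0r mulr0.
  rewrite memNset ?mul0r// => /=; apply; exists (anc k (leaf_cube x)) => //.
  exact: cube_anc.
have ms : measurable_fun setT (fun x : T => s (lat l x)).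
  exact: measurable_fun_step.
have sb0 (x : T) : 0 <= s (lat l x) by have /andP[] := sb (lat l x).
have sbn (x : T) : s (lat l x) <= n%:R by have /andP[] := sb (lat l x).
have is1 : inte (fun x => s (lat l x) * \1_(box n) x).
  apply: (inte_le _ (inteZ n%:R ibox)); first by apply: measurable_funM => //; exact: inteM ibox.
  by move=> x; rewrite ger0_norm ?mulr_ge0 ?ind_ge0// ler_wpM2r ?ind_ge0.
have iabs : inte (fun x => a x * \1_(box n) x) by exact: L2r_inte.
have is2 : inte (fun x => s (lat l x) * (a x * \1_(box n) x)).
  apply: (inte_le _ (inteZ n%:R iabs)).
    by apply: measurable_funM => //; exact: inteM iabs.
  by move=> x; rewrite ger0_norm ?mulr_ge0 ?ind_ge0// ler_wpM2r ?mulr_ge0 ?ind_ge0.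
have is3 : inte (fun x => \1_(~` Om) x * (s (lat l x) * (a x * \1_(box n) x))).
  exact: inte_ind.
have ifs : inte (fun x => `|f x - s (lat l x)| * w x).
  apply: (inte_le _ (inteZ n%:R iw)).
    apply: measurable_funM; last exact: inteM iw.
    by apply: measurableT_comp => //; exact: measurable_funB.
  move=> x; rewrite ger0_norm; last exact: mulr_ge0.
  apply: ler_wpM2r => //.
  by rewrite ler_norml; have := sb0 x; have := sbn x; have := f0 x; have := fn x; lra.
have fbox x : f x * \1_(box n) x = f x by exact: cutoff_box.
have b1 : itg (fun x => s (lat l x) * \1_(box n) x) <= itg a + e'.
  apply: (@le_trans _ _ (itg a + itg (fun x => `|f x - s (lat l x)| * w x))).
    rewrite -itgD//; apply: itg_le => //; first exact: inteD.
    move=> x; have := ler_norm (s (lat l x) - f x); rewrite distrC.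
    have := mulr_ge0 (normr_ge0 (f x - s (lat l x))) (a0 x).
    have := fa x; have := fbox x; have := a0 x; rewrite /w.
    rewrite indicE; case: (_ \in _) => /=; rewrite ?mulr1 ?mulr0; lra.
  by rewrite lerD2l ltW.
have b2 : itg (fun x => \1_(~` Om) x * (s (lat l x) * (a x * \1_(box n) x))) <=
    lam * itg (fun x => s (lat l x) * \1_(box n) x).
  rewrite (@eq_itg _ _ _ _ _ (fun y => \sum_(x : leaf N n l) s (leaf_cube x) *
     (\1_(~` Om) y * (1[leaf_cube x] y * a y)))); last first.
    move=> y; transitivity (\1_(~` Om) y * a y * (s (lat l y) * \1_(box n) y)).
      by ring.
    by rewrite step_box mulr_sumr; apply: eq_bigr => x _; ring.
  rewrite itg_sum; last first.
    by move=> x _; apply: inteZ; apply: inte_ind => //; exact: inte_cubeM.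
  rewrite (@eq_itg _ _ _ _ (fun y => s (lat l y) * \1_(box n) y)
    (fun y => \sum_(x : leaf N n l) s (leaf_cube x) * 1[leaf_cube x] y)); last first.
    by move=> y; rewrite step_box.
  rewrite itg_sum; last by move=> x _; apply: inteZ; exact: inte_cube.
  rewrite mulr_sumr; apply: ler_sum => x _; rewrite !itgZ; first last.
  - by apply: inte_ind => //; exact: inte_cubeM.
  - exact: inte_cube.
  rewrite itg_cube mulrCA; apply: ler_wpM2l; last exact: leafP.
  by have /andP[] := sb (leaf_cube x).
have i4 : inte (fun x => a x * a x - cutoff n a x * a x).
  apply: inteB; apply: L2r_inte => //; apply: (L2r_le _ a2) => // x.
  exact: cutoff_le.
have b3 : itg (fun x => \1_(~` Om) x * a x ^+ 2) <=
  itg (fun x => \1_(~` Om) x * (s (lat l x) * (a x * \1_(box n) x))) +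
  (itg (fun x => `|f x - s (lat l x)| * w x) +
   itg (fun x => a x * a x - cutoff n a x * a x)).
  rewrite -[X in _ <= _ + X]itgD// -itgD//; last exact: inteD.
  apply: itg_le.
  - by apply: inte_ind => //; case: a2.
  - by apply: inteD => //; exact: inteD.
  - move=> x; rewrite -/(f x).
    have h1 : f x * a x - s (lat l x) * (a x * \1_(box n) x) <=
        `|f x - s (lat l x)| * w x.
      rewrite -[f x in X in X <= _]fbox /w.
      have -> : f x * \1_(box n) x * a x - s (lat l x) * (a x * \1_(box n) x) =
         (f x - s (lat l x)) * (a x * \1_(box n) x) by ring.
      apply: (@le_trans _ _ (`|f x - s (lat l x)| * (a x * \1_(box n) x))).
        by apply: ler_wpM2r; [rewrite mulr_ge0 ?ind_ge0|exact: ler_norm].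
      by apply: ler_wpM2l => //; apply: ler_wpM2r; rewrite ?ind_ge0// lerDl.
    have h2 : 0 <= `|f x - s (lat l x)| * w x by rewrite mulr_ge0.
    have h3 : 0 <= a x * a x - f x * a x.
      by rewrite -mulrBl mulr_ge0// subr_ge0.
    by rewrite indicE; case: (_ \in _) => /=; rewrite ?mul1r ?mul0r ?expr2; lra.
apply: le_trans b3 _.
have : lam * itg (fun x => s (lat l x) * \1_(box n) x) <= lam * (itg a + e').
  by rewrite ler_pM2l.
have : (1 + lam) * e' = e / 3.
  by rewrite /e'; field; rewrite lt0r_neq0// addr_gt0.
move: b2 hn1 hs; lra.
Unshelve. all: by end_near. Qed.

End stopping.

Section pair.
Variables (r : nat) (K : R) (S S' : (T -> R) -> T -> R).
Hypothesis bp : band_pair r K S S'.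

(** Calderon-Zygmund decomposition b = g + sum of h_Q over the stopping cubes,
with h_Q of mean zero on Q. By [localized] the image of h_Q is zero off the
r-th ancestor of Q; [A] is the union of these ancestors. Off [A] the operator
does not see the h_Q, and the square integral of g is controlled by lam times
the integral of |b|. *)
Theorem weak_type b lam e : L2r b -> inte b -> 0 < lam -> 0 < e ->
  exists A : set T, [/\ measurable A,
    (mu A <= ((2 ^+ N) ^+ r * itg (fun x => `|b x|) / lam)%:E)%E &
    itg (fun x => \1_(~` A) x * S b x ^+ 2) <=
    K ^+ 2 * ((2 ^+ N + 1) * lam * itg (fun x => `|b x|) + e)].
Proof.
move=> b2 ib lam0 e0; pose a x := `|b x|.
have a2 : L2r a by exact: L2r_abs.
have ia : inte a by exact: inte_abs.
have a0 x : 0 <= a x by exact: normr_ge0.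
have [Qs [uQs sQs hQs]] := stopping_cubes a0 a2 ia lam0 e0.
have dQs Q Q' (x : T) : Q \in Qs -> Q' \in Qs -> cube Q x -> cube Q' x -> Q = Q'.
  by move=> h1 h2; exact: (stop_disjoint (sQs _ h1) (sQs _ h2)).
pose m Q := itg (fun x => 1[Q] x * a x).
have i1 Q : inte (fun x => 1[Q] x * a x) by exact: inte_cubeM.
have vp Q := vol_gt0 R Q.
have summ : \sum_(Q <- Qs) m Q <= itg a.
  rewrite -itg_sum; last by move=> Q _; exact: i1.
  apply: itg_le => //; first by apply: inte_sum => Q _; exact: i1.
  move=> x; have [[Q Qs' Qx]|nx] := pselect (union_cubes Qs x).
    have := sum_at uQs dQs Qs' Qx (fun=> a x).
    by under eq_bigr do rewrite mulrC; move=> ->.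
  have := sum_off nx (fun=> a x).
  by under eq_bigr do rewrite mulrC; move=> ->.
pose A : set T := \bigcup_(Q in [set` Qs]) cube (anc r Q).
have mA : measurable A.
  apply: fin_bigcup_measurable; first exact: finite_seq.
  by move=> Q _; exact: measurable_cube.
exists A; split=> //.
  have AE : A = \big[setU/set0]_(Q <- Qs) cube (anc r Q).
    by rewrite /A bigcup_seq.
  apply: (@le_trans _ _ (\sum_(Q <- Qs) (vol R (anc r Q))%:E)%E).
    rewrite AE; elim: (Qs) => [|Q s IH]; first by rewrite !big_nil measure0.
    rewrite !big_cons; apply: le_trans (measureU2 _ _ _) _.
    - exact: measurable_cube.
    - elim: (s) => [|Q' s' IHs]; first by rewrite big_nil.
      by rewrite big_cons; apply: measurableU => //; exact: measurable_cube.
    - by apply: leeD; [rewrite -lebesgue_cube|exact: IH].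
  rewrite sumEFin lee_fin.
  under eq_bigr do rewrite vol_anc.
  rewrite -mulr_sumr -mulrA; apply: ler_wpM2l; first by rewrite !exprn_ge0.
  rewrite ler_pdivlMr// mulrC mulr_sumr; apply: le_trans summ.
  rewrite big_seq [leRHS]big_seq; apply: ler_sum => Q /sQs[h _].
  exact: ltW h.
(* the bad parts hQ have mean zero; the good part g is avg Q on Q *)
pose avg Q := itg (fun x => 1[Q] x * b x) / vol R Q.
pose hQ Q x := 1[Q] x * b x - avg Q * 1[Q] x.
pose g x := b x - \sum_(Q <- Qs) hQ Q x.
have hQ2 Q : L2r (hQ Q).
  apply: L2rB; first by apply: L2r_ind => //; exact: measurable_cube.
  by apply: L2rZ; exact: L2r_cube.
have hs2 : L2r (fun x => \sum_(Q <- Qs) hQ Q x) by apply: L2r_sum.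
have g2 : L2r g by exact: L2rB.
pose phi x := \1_(~` A) x * S b x.
have Sb2 := bp_L2 bp b2.
have mAC : measurable (~` A) by exact: measurableC.
have p2 : L2r phi by apply: L2r_ind.
have phi0 Q (x : T) : Q \in Qs -> cube (anc r Q) x -> phi x = 0.
  move=> Qs' Qx; rewrite /phi indicE memNset ?mul0r// => /=; apply.
  by exists Q.
have hphi Q : Q \in Qs -> ip (hQ Q) (S' phi) = 0.
  move=> Qs'; rewrite -(bp_adj bp)//.
  apply: (localized hN bp (hQ2 Q) (P := Q)) => //.
  - by move=> x nx; rewrite /hQ indicE memNset// mul0r mulr0 subr0.
  - rewrite itgB; [|exact: inte_cubeM|by apply: inteZ; exact: inte_cube].
    rewrite itgZ ?itg_cube ?divfK ?subrr ?lt0r_neq0//; exact: inte_cube.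
  - by move=> x; exact: phi0.
have phiE : ip phi phi = ip g (S' phi).
  have -> : ip phi phi = ip (S b) phi.
    apply: eq_itg => x; rewrite /phi.
    by rewrite indicE; case: (_ \in _); rewrite /= ?mul1r ?mul0r ?mulr0.
  rewrite (bp_adj bp)//.
  have -> : ip g (S' phi) = ip b (S' phi) -
      ip (fun x => \sum_(Q <- Qs) hQ Q x) (S' phi).
    by apply: ipBl => //; exact: (bp_L2' bp).
  rewrite ip_suml//; last exact: (bp_L2' bp).
  by rewrite big_seq big1 ?subr0// => Q Qs'; exact: hphi.
have gE x : g x ^+ 2 = \1_(~` union_cubes Qs) x * a x ^+ 2 +
    \sum_(Q <- Qs) avg Q ^+ 2 * 1[Q] x.
  have [[Q Qs' Qx]|nx] := pselect (union_cubes Qs x).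
    rewrite (sum_at uQs dQs Qs' Qx) indicE memNset; last first.
      by move=> h; apply: h; exists Q.
    rewrite mul0r add0r /g.
    have -> : \sum_(Q' <- Qs) hQ Q' x = b x - avg Q.
      rewrite -(sum_at uQs dQs Qs' Qx (fun Q => b x - avg Q)).
      by apply: eq_bigr => Q' _; rewrite /hQ; ring.
    by congr (_ ^+ 2); ring.
  rewrite (sum_off nx) indicE mem_set//= mul1r addr0 /g.
  have -> : \sum_(Q <- Qs) hQ Q x = 0.
    rewrite -[RHS](sum_off nx (fun Q => b x - avg Q)).
    by apply: eq_bigr => Q' _; rewrite /hQ; ring.
  by rewrite subr0 /a real_normK// num_real.
have mU : measurable (~` union_cubes Qs : set T).
  by apply: measurableC; exact: measurable_union_cubes.
have gn : ip g g <= (2 ^+ N + 1) * lam * itg a + e.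
  have -> : ip g g = itg (fun x => \1_(~` union_cubes Qs) x * a x ^+ 2) +
      \sum_(Q <- Qs) avg Q ^+ 2 * vol R Q.
    have is1 Q : inte (fun x => avg Q ^+ 2 * 1[Q] x).
      by apply: inteZ; exact: inte_cube.
    transitivity (itg (fun x => \1_(~` union_cubes Qs) x * a x ^+ 2) +
       itg (fun x => \sum_(Q <- Qs) avg Q ^+ 2 * 1[Q] x)).
      rewrite -itgD; first by apply: eq_itg => x; rewrite -gE expr2.
        by apply: inte_ind => //; case: a2.
      by apply: inte_sum.
    congr (_ + _); rewrite itg_sum//; apply: eq_bigr => Q _.
    by rewrite itgZ ?itg_cube//; exact: inte_cube.
  have : \sum_(Q <- Qs) avg Q ^+ 2 * vol R Q <= 2 ^+ N * lam * itg a.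
    apply: (@le_trans _ _ (\sum_(Q <- Qs) 2 ^+ N * lam * m Q)); last first.
      rewrite -mulr_sumr; apply: ler_wpM2l => //.
      by rewrite mulr_ge0 ?ltW// exprn_gt0.
    rewrite big_seq [leRHS]big_seq; apply: ler_sum => Q /sQs sQ.
    have m0 : 0 <= m Q by apply: itg_ge0 => x; rewrite mulr_ge0 ?ind_ge0.
    have av : `|avg Q| <= m Q / vol R Q.
      have vi : 0 < (vol R Q)^-1 by rewrite invr_gt0.
      rewrite /avg normrM (ger0_norm (ltW vi)) ler_pM2r//.
      apply: itg_le_norm => //.
        exact: inte_cubeM.
      by move=> x; rewrite normrM ger0_norm ?ind_ge0.
    have av2 : m Q / vol R Q <= 2 ^+ N * lam.
      by rewrite ler_pdivrMr// [2 ^+ N * _]mulrC; exact: (stop_ub a0 a2 sQ).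
    rewrite -(real_normK (num_real (avg Q))) expr2.
    apply: (@le_trans _ _ ((2 ^+ N * lam) * (m Q / vol R Q) * vol R Q)).
      apply: ler_wpM2r; first exact: ltW.
      by apply: ler_pM => //; exact: le_trans av av2.
    by rewrite -mulrA divfK ?lt0r_neq0.
  by move: hQs; lra.
have -> : itg (fun x => \1_(~` A) x * S b x ^+ 2) = ip phi phi.
  apply: eq_itg => x; rewrite /phi.
  by rewrite indicE; case: (_ \in _); rewrite /= ?mul1r ?mul0r ?mulr0// expr2.
apply: (@le_trans _ _ (K ^+ 2 * ip g g)); last first.
  by apply: ler_wpM2l => //; exact: sqr_ge0.
have : nrm phi <= K * nrm g.
  have [->|pn0] := eqVneq (nrm phi) 0.
    by rewrite mulr_ge0 ?sqrtr_ge0 ?(bp_K bp).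
  have pp : 0 < nrm phi by rewrite lt_neqAle eq_sym pn0 sqrtr_ge0.
  rewrite -(ler_pM2r pp) -expr2 nrm2 phiE; apply: le_trans (ler_norm _) _.
  apply: le_trans (ip_CS g2 (bp_L2' bp p2)) _.
  rewrite [K * _]mulrC -mulrA; apply: ler_wpM2l; first exact: sqrtr_ge0.
  exact: (bp_bound' bp).
rewrite -(nrm2 mu phi) -(nrm2 mu g) -exprMn => h.
by rewrite ler_pXn2r// nnegrE ?sqrtr_ge0// mulr_ge0 ?sqrtr_ge0 ?(bp_K bp).
Qed.

End pair.
End weak_type.

(** * Nested partitions of the leaves *)

Section leaf_tower.
Variables (R : realType) (N M l : nat).
Local Notation T := (Rn R N).
Local Notation X := (leaf N M l).
Local Notation L := (M + l)%N.
Local Notation cx := (@leaf_cube N M l).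
Implicit Types (x y z : X) (Q : dyadic N).

Lemma pos_anc k Q i :
  tnth (pos (anc k Q)) i = (tnth (pos Q) i %/ (2 ^ k)%N%:Z)%Z.
Proof.
elim: k Q => [|k IH] Q /=; first by rewrite expn0 divz1.
by rewrite tnth_mktuple IH expnSr PoszM divzMA_ge0.
Qed.

(** Above generation M + l only the 2^N orthants are left, and they never
merge. *)
Lemma top_pos x i j : tnth (pos (anc (L + j) (cx x))) i =
  if (tnth x i < 2 ^ L)%N then -1 else 0.
Proof.
rewrite pos_anc /= tnth_mktuple.
have xi : (tnth x i < 2 ^ L + 2 ^ L)%N.
  by apply: leq_trans (ltn_ord (tnth x i)) _; rewrite expnS mul2n addnn.
have p : (2 ^ L <= 2 ^ (L + j))%N by rewrite leq_exp2l// leq_addr.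
set a := tnth x i in xi *; set b := (2 ^ L)%N in xi p *.
set c := (2 ^ (L + j))%N in p *.
have c0 : (0 < c)%N by rewrite expn_gt0.
have a0 : (0 <= (a : nat))%N by [].
case: ltnP => ab.
  have -> : (a : nat)%:Z - b%:Z = (-1) * c%:Z + ((a : nat)%:Z - b%:Z + c%:Z) by lia.
  by rewrite divzMDl ?divz_small ?addr0//; lia.
by rewrite divz_small//; lia.
Qed.

Lemma top_pos0 x i : tnth (pos (anc L (cx x))) i =
  if (tnth x i < 2 ^ L)%N then -1 else 0.
Proof. by have := top_pos x i 0; rewrite addn0. Qed.

Lemma top_inj x y j : anc (L + j) (cx x) = anc (L + j) (cx y) ->
  anc L (cx x) = anc L (cx y).
Proof.
move=> /(congr1 (@pos N)) h.
have lev : level (anc L (cx x)) = level (anc L (cx y)) by rewrite !level_anc.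
have pp : pos (anc L (cx x)) = pos (anc L (cx y)).
  apply: eq_from_tnth => i; have := congr1 (fun t => tnth t i) h.
  by rewrite !top_pos !top_pos0.
by case: (anc L (cx x)) (anc L (cx y)) lev pp => a b [c d] /= -> ->.
Qed.

(** The generation is cut at M + l, where the classes are the 2^N orthants of
the box; beyond it the partitions no longer change. *)
Definition up k x := anc (minn k L) (cx x).
Definition rep k x : X := odflt x [pick z | up k z == up k x].

Lemma level_up_close r k1 k2 x1 x2 : (k1 <= k2 + r)%N ->
  level (up k1 x1) <= level (up k2 x2) + r%:Z.
Proof. by rewrite !level_anc /=; lia. Qed.

Lemma up_rep k x : up k (rep k x) = up k x.
Proof. by rewrite /rep; case: pickP => [z /eqP|/(_ x)]//=; rewrite eqxx. Qed.

Lemma rep_eqP k x y : rep k x = rep k y <-> up k x = up k y.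
Proof.
split=> [e|e]; first by rewrite -(up_rep k x) e up_rep.
rewrite /rep e; case: pickP => [//|/(_ y)]; by rewrite eqxx.
Qed.

Lemma rep_eq k x y : (rep k x == rep k y) = (up k x == up k y).
Proof. by apply/eqP/eqP => /rep_eqP. Qed.

Lemma repS k x : rep k.+1 (rep k x) = rep k.+1 x.
Proof.
apply/rep_eqP; rewrite /up; have := up_rep k x; rewrite /up.
have [kL|Lk] := leqP k.+1 L.
  by rewrite (minn_idPl (ltnW kL)) => /= ->.
by have -> : minn k L = L by lia.
Qed.

Lemma rep_id k x : rep k (rep k x) = rep k x.
Proof. by apply/rep_eqP; exact: up_rep. Qed.

Lemma rep0 x : rep 0 x = x.
Proof.
have := up_rep 0 x; rewrite /up min0n /=; exact: leaf_cube_inj.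
Qed.

Lemma up_sep k r x y : rep (k + r) x != rep (k + r) y ->
  anc r (up k x) <> anc r (up k y).
Proof.
move=> /eqP h e; apply: h; apply/rep_eqP; move: e; rewrite /up -!anc_add.
have [kL|Lk] := leqP k L.
  have [krL|Lkr] := leqP (k + r) L; first by rewrite addnC.
  by rewrite (_ : r + k = L + (k + r - L))%N; [exact: top_inj|lia].
have -> : minn (k + r) L = L by lia.
by rewrite addnC; exact: top_inj.
Qed.

(** A class of generation [k] inside a given class of generation [j] is
determined by its positions modulo 2^(j-k) in the [N] coordinates. *)
Lemma card_rep k j q : (k <= j)%N ->
  (#|imset (rep k) (mem [pred x | rep j x == q])| <= 2 ^ ((j - k) * N))%N.
Proof.
move=> kj; set d := (j - k)%N.
set A := imset _ _.
pose off (x : X) : N.-tuple 'I_(2 ^ d).-1.+1 :=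
  [tuple inord `|(tnth (pos (up k x)) i %% (2 ^ d)%N%:Z)%Z|%N | i < N].
have dp : ((2 ^ d).-1.+1 = 2 ^ d)%N by rewrite prednK// expn_gt0.
have inj : {in A &, injective off}.
  move=> x y /imsetP[x0]; rewrite inE => /eqP jx ->.
  move=> /imsetP[y0]; rewrite inE => /eqP jy -> e.
  apply/rep_eqP; rewrite -(up_rep k x0) -(up_rep k y0).
  set x1 := rep k x0 in e *; set y1 := rep k y0 in e *.
  have ej : up j x1 = up j y1.
    have h z : up j (rep k z) = up j z.
      have := up_rep k z; rewrite /up.
      have -> : minn j L = ((minn j L - minn k L) + minn k L)%N by lia.
      by rewrite !anc_add => ->.
    by rewrite !h; apply/rep_eqP; rewrite jx jy.
  have lev : level (up k x1) = level (up k y1) by rewrite !level_anc.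
  have pp : pos (up k x1) = pos (up k y1).
    apply: eq_from_tnth => i.
    pose d' := (minn j L - minn k L)%N.
    have d'd : (d' <= d)%N by rewrite /d' /d; lia.
    have upE z : up j z = anc d' (up k z).
      by rewrite /up -anc_add; congr anc; rewrite /d'; lia.
    have := congr1 (fun Q => tnth (pos Q) i) ej; rewrite !upE (pos_anc d' (up k x1)) (pos_anc d' (up k y1)).
    have := congr1 (fun t => val (tnth t i)) e; rewrite !tnth_mktuple.
    set a := tnth (pos (up k x1)) i; set b := tnth (pos (up k y1)) i => e1 e2.
    have D0 : (2 ^ d)%N%:Z != 0 by rewrite eqz_nat -lt0n expn_gt0.
    have small c : (`|(c %% (2 ^ d)%N%:Z)%Z|%N < (2 ^ d).-1.+1)%N.
      by rewrite dp -ltz_nat gez0_abs ?modz_ge0// ltz_pmod// ltz_nat expn_gt0.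
    rewrite /= !inordK// in e1.
    have e3 : (a %% (2 ^ d)%N%:Z = b %% (2 ^ d)%N%:Z)%Z.
      by rewrite -(gez0_abs (modz_ge0 a D0)) -(gez0_abs (modz_ge0 b D0)) e1.
    have e4 : (a %/ (2 ^ d)%N%:Z = b %/ (2 ^ d)%N%:Z)%Z.
      have -> : (2 ^ d)%N%:Z = (2 ^ d')%N%:Z * (2 ^ (d - d'))%N%:Z.
        by rewrite -PoszM -expnD subnKC.
      by rewrite !divzMA_ge0// e2.
    by rewrite (divz_eq a (2 ^ d)%N%:Z) e3 e4 -divz_eq.
  by case: (up k x1) (up k y1) lev pp => ? ? [? ?] /= -> ->.
rewrite -(card_in_imset inj); apply: leq_trans (max_card _) _.
by rewrite card_tuple card_ord dp -expnM.
Qed.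

Lemma card_top : (#|imset (rep L) (mem {: X})| <= 2 ^ N)%N.
Proof.
pose off (x : X) : N.-tuple bool := [tuple (tnth x i < 2 ^ L)%N | i < N].
have inj : {in imset (rep L) (mem {: X}) &, injective off}.
  move=> x y /imsetP[x0 _ ->] /imsetP[y0 _ ->] e.
  apply/rep_eqP; rewrite -(up_rep L x0) -(up_rep L y0).
  rewrite /up minnn; set x1 := rep L x0 in e *; set y1 := rep L y0 in e *.
  have lev : level (anc L (cx x1)) = level (anc L (cx y1)) by rewrite !level_anc.
  have pp : pos (anc L (cx x1)) = pos (anc L (cx y1)).
    apply: eq_from_tnth => i; have := congr1 (fun t => tnth t i) e.
    by rewrite !tnth_mktuple !top_pos0 => ->.
  by case: (anc L (cx x1)) (anc L (cx y1)) lev pp => a b [c d] /= -> ->.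
rewrite -(card_in_imset inj); apply: leq_trans (max_card _) _.
by rewrite card_tuple card_bool.
Qed.

Lemma ind_up k x (y : T) : \1_(cube (up k x)) y =
  \sum_(z : X | rep k z == rep k x) \1_(cube (cx z)) y :> R.
Proof.
have cz z : cube (cx z) y -> cube (up k z) y by exact: cube_anc.
have lev z : level (up k z) = level (up k x) by rewrite !level_anc.
have [hy|nb] := pselect (cube (up k x) y); last first.
  rewrite indicE memNset// big1// => z; rewrite rep_eq => /eqP e.
  by rewrite indicE memNset// => /cz; rewrite e.
have bx : box M y.
  move: hy; rewrite /up => hy i.
  have h := hy i; move: h; rewrite pos_anc /side level_anc /= tnth_mktuple.
  set k' := minn k L; have k'L : (k' <= L)%N by rewrite geq_minr.
  set e : R := 2 ^ _; have e0 : 0 < e by rewrite exprz_gt0.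
  have eM : e * 2 ^+ (L - k') = 2 ^+ M.
    have := @pow2E R M l; rewrite /e => <-.
    rewrite expfzDr// -exprnP -mulrA -exprD subnKC//.
  have xi : (tnth x i < 2 ^ L + 2 ^ L)%N.
    by apply: leq_trans (ltn_ord (tnth x i)) _; rewrite expnS mul2n addnn.
  set q := (_ %/ _)%Z.
  have q1 : - (2 ^ (L - k'))%N%:Z <= q.
    rewrite /q lez_divRL ?ltz_nat ?expn_gt0// mulNr -PoszM -expnD subnK//.
    by lia.
  have q2 : q + 1 <= (2 ^ (L - k'))%N%:Z.
    rewrite lezD1 /q ltz_divLR ?ltz_nat ?expn_gt0// -PoszM -expnD subnK//.
    by lia.
  have q1' : - (2 ^+ (L - k')) <= q%:~R :> R.
    by rewrite -natrX pmulrn -mulrNz ler_int.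
  have q2' : q%:~R + 1 <= 2 ^+ (L - k') :> R.
    by rewrite -natrX pmulrn -[1]/(1%:~R) -intrD ler_int.
  by rewrite -eM => /andP[h1 h2]; apply/andP; split; nra.
have [z hz] := box_leaf_cube l bx.
have zy : cube (cx z) y by rewrite -hz; exact: cube_cell.
have zx : rep k z == rep k x.
  by rewrite rep_eq; apply/eqP; apply: cube_inj (cz _ zy) hy (lev z).
rewrite indicE mem_set// (bigD1 z)//= indicE mem_set// big1 ?addr0//.
move=> z' /andP[_ z'z]; rewrite indicE memNset// => z'y; move/eqP: z'z; apply.
by apply: leaf_cube_inj; exact: cube_inj z'y zy _.
Qed.

End leaf_tower.

(** * Weights, their truncations, and the error made by truncating *)

Section readings.
Variables (R : realType) (N : nat).
Local Notation mu := (lebesgue R N).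
Local Notation T := (Rn R N).
Local Notation itg := (itg mu).
Local Notation inte := (inte mu).
Local Notation ip := (ip mu).
Local Notation nrm := (nrm mu).
Local Notation L2r := (L2r mu).
Implicit Types (f g h F G phi : T -> R) (Q P A B : dyadic N).
Local Notation "1[ Q ]" := (\1_(cube Q) : T -> R) (at level 0, format "1[ Q ]").

Definition lweight (w : T -> R) := [/\ forall x, 0 <= w x,
  measurable_fun setT w & forall Q, inte (fun x => 1[Q] x * w x)].

Definition wmass w Q := itg (fun x => 1[Q] x * w x).
Definition good w Q := L2r (fun x => 1[Q] x * w x).

(** The real functions whose complexifications are the readings of [w] on [Q].
*)
Definition real_reading w Q : set (T -> R) := [set g |
  (good w Q /\ g = fun x => 1[Q] x * w x) \/
  (~ good w Q /\ exists2 n, (0 < n)%N & g = fun x => 1[Q] x * trunc w n x)].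

(** Unlike [real_reading], truncations are allowed on good cubes as well; this
class is stable under restriction to smaller cubes. *)
Definition sub_reading w Q : set (T -> R) := [set g |
  (good w Q /\ g = fun x => 1[Q] x * w x) \/
  (exists2 n, (0 < n)%N & g = fun x => 1[Q] x * trunc w n x)].

Lemma real_reading_sub w Q g : real_reading w Q g -> sub_reading w Q g.
Proof. by move=> [|[_]]; [left|right]. Qed.

Section one_weight.
Variable w : T -> R.
Hypothesis lw : lweight w.
Let w0 x : 0 <= w x. Proof. by case: lw. Qed.
Let mw : measurable_fun setT w. Proof. by case: lw. Qed.
Let iw Q : inte (fun x => 1[Q] x * w x). Proof. by case: lw. Qed.

Lemma trunc_ge0 n x : 0 <= trunc w n x.
Proof. by rewrite /trunc le_min w0 ler0n. Qed.
Lemma trunc_le n x : trunc w n x <= w x.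
Proof. by rewrite /trunc ge_min lexx. Qed.
Lemma trunc_len n x : trunc w n x <= n%:R.
Proof. by rewrite /trunc ge_min lexx orbT. Qed.
Lemma trunc_mono m n x : (m <= n)%N -> trunc w m x <= trunc w n x.
Proof.
move=> mn; rewrite /trunc le_min ge_min lexx /= ge_min.
by apply/orP; right; rewrite ler_nat.
Qed.
Lemma trunc_mul n x : trunc w n x <= n%:R * trunc w 1 x.
Proof.
rewrite /trunc; case: n => [|n].
  by rewrite mul0r ge_min lexx orbT.
rewrite [leRHS](_ : _ = Num.min (n.+1%:R * w x) (n.+1%:R * 1)); last first.
  by rewrite minr_pMr.
rewrite mulr1 le_min !ge_min lexx orbT andbT.
by rewrite ler_peMl ?w0// ler1n.
Qed.

Lemma measurable_trunc n : measurable_fun setT (trunc w n).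
Proof. by apply: measurable_minr => //; exact: measurable_cst. Qed.

Lemma trunc_cvg x : \forall n \near \oo, trunc w n x = w x.
Proof.
near=> n; rewrite /trunc min_l//.
by near: n; exact: nbhs_infty_ger.
Unshelve. all: by end_near. Qed.

Lemma L2r_trunc Q n : L2r (fun x => 1[Q] x * trunc w n x).
Proof.
apply: (L2r_le _ (L2rZ n%:R (L2r_cube R Q))).
  apply: measurable_funM; last exact: measurable_trunc.
  by apply: measurable_indic; exact: measurable_cube.
move=> x; rewrite mulrC !normrM; apply: ler_wpM2r => //.
by rewrite !ger0_norm ?trunc_ge0// trunc_len.
Qed.

Lemma inte_trunc Q n : inte (fun x => 1[Q] x * trunc w n x).
Proof.
apply: (inte_le _ (iw Q)); first exact: L2rM (L2r_trunc Q n).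
move=> x; rewrite ger0_norm ?mulr_ge0 ?ind_ge0 ?trunc_ge0//.
by apply: ler_wpM2l; rewrite ?ind_ge0// trunc_le.
Qed.

Lemma wmass_ge0 Q : 0 <= wmass w Q.
Proof. by apply: itg_ge0 => x; rewrite mulr_ge0 ?ind_ge0. Qed.

Lemma wmass_trunc_le Q n : wmass (trunc w n) Q <= wmass w Q.
Proof.
apply: itg_le => //; first exact: inte_trunc.
by move=> x; apply: ler_wpM2l; rewrite ?ind_ge0// trunc_le.
Qed.

Lemma wmass_trunc_mono Q m n : (m <= n)%N ->
  wmass (trunc w m) Q <= wmass (trunc w n) Q.
Proof.
move=> mn; apply: itg_le; try exact: inte_trunc.
by move=> x; apply: ler_wpM2l; rewrite ?ind_ge0// trunc_mono.
Qed.

Lemma wmass_trunc_cvg Q : wmass (trunc w n) Q @[n --> \oo] --> wmass w Q.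
Proof.
apply: itg_monotone => //.
- by move=> n; exact: L2rM (L2r_trunc Q n).
- move=> n x; rewrite mulr_ge0 ?ind_ge0 ?trunc_ge0//=.
  by apply: ler_wpM2l; rewrite ?ind_ge0// trunc_le.
- move=> x; apply: cvg_near_cst; near=> n.
  by congr (_ * _); near: n; exact: trunc_cvg.
Unshelve. all: by end_near. Qed.

Lemma wmass_trunc1 Q : wmass (trunc w 1) Q = 0 ->
  forall n, wmass (trunc w n) Q = 0.
Proof.
move=> h n; apply/eqP; rewrite eq_le; apply/andP; split; last first.
  by apply: itg_ge0 => x; rewrite mulr_ge0 ?ind_ge0 ?trunc_ge0.
rewrite -[leRHS](mulr0 n%:R) -h -itgZ; last exact: inte_trunc.
apply: itg_le; [exact: inte_trunc|by apply: inteZ; exact: inte_trunc|].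
move=> x; rewrite mulrCA; apply: ler_wpM2l; rewrite ?ind_ge0//.
exact: trunc_mul.
Qed.

Lemma wmass_trunc_null Q n : wmass (trunc w n) Q = 0 ->
  ip (fun x => 1[Q] x * trunc w n x) (fun x => 1[Q] x * trunc w n x) = 0.
Proof.
move=> h; apply/eqP; rewrite eq_le ip_ge0 andbT.
rewrite -[leRHS](mulr0 n%:R) -h -itgZ; last exact: inte_trunc.
apply: itg_le.
- by apply: L2r_inte; exact: L2r_trunc.
- by apply: inteZ; exact: inte_trunc.
move=> x; apply: ler_wpM2r; first by rewrite mulr_ge0 ?ind_ge0 ?trunc_ge0.
rewrite indicE; case: (_ \in _) => /=; rewrite ?mul1r ?mul0r//.
exact: trunc_len.
Qed.

Definition tail n x := w x - trunc w n x.

Lemma tail_ge0 n x : 0 <= tail n x.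
Proof. by rewrite subr_ge0 trunc_le. Qed.
Lemma tail_le n x : tail n x <= w x.
Proof. by rewrite gerBl trunc_ge0. Qed.
Lemma measurable_tail n : measurable_fun setT (tail n).
Proof. by apply: measurable_funB => //; exact: measurable_trunc. Qed.
Lemma tail_cvg x : \forall n \near \oo, tail n x = 0.
Proof.
near=> n; rewrite /tail; have -> : trunc w n x = w x.
  by near: n; exact: trunc_cvg.
by rewrite subrr.
Unshelve. all: by end_near. Qed.

Lemma measurable_1tail Q n : measurable_fun setT (fun x => 1[Q] x * tail n x).
Proof.
apply: measurable_funM; last exact: measurable_tail.
by apply: measurable_indic; exact: measurable_cube.
Qed.

Lemma L2r_tail Q n : good w Q -> L2r (fun x => 1[Q] x * tail n x).
Proof.
move=> gQ; apply: (L2r_le _ gQ); first exact: measurable_1tail.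
move=> x; rewrite !normrM; apply: ler_wpM2l => //.
by rewrite !ger0_norm ?tail_ge0// tail_le.
Qed.

Lemma inte_tail Q n : inte (fun x => 1[Q] x * tail n x).
Proof.
apply: (inte_le _ (iw Q)); first exact: measurable_1tail.
move=> x; rewrite ger0_norm ?mulr_ge0 ?ind_ge0 ?tail_ge0//.
by apply: ler_wpM2l; rewrite ?ind_ge0// tail_le.
Qed.

Lemma tail_mass_cvg Q : itg (fun x => 1[Q] x * tail n x) @[n --> \oo] --> (0 : R).
Proof.
rewrite -[X in _ --> X](itg0 mu); apply: (itg_dominated (iw Q)).
- exact: measurable_cst.
- by move=> n; exact: measurable_1tail.
- move=> x; apply: cvg_near_cst; near=> n.
  have -> : tail n x = 0 by near: n; exact: tail_cvg.
  by rewrite mulr0.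
- move=> n x; rewrite ger0_norm ?mulr_ge0 ?ind_ge0 ?tail_ge0//.
  by apply: ler_wpM2l; rewrite ?ind_ge0// tail_le.
Unshelve. all: by end_near. Qed.

Lemma tail_norm_cvg Q : good w Q ->
  ip (fun x => 1[Q] x * tail n x) (fun x => 1[Q] x * tail n x)
  @[n --> \oo] --> (0 : R).
Proof.
move=> gQ; rewrite -[X in _ --> X](itg0 mu).
apply: (itg_dominated (L2r_inte gQ gQ)).
- exact: measurable_cst.
- by move=> n; apply: measurable_funM; exact: measurable_1tail.
- move=> x; apply: cvg_near_cst; near=> n.
  have -> : tail n x = 0 by near: n; exact: tail_cvg.
  by rewrite !mulr0.
- move=> n x; rewrite normrM; apply: ler_pM => //;
  rewrite ger0_norm ?mulr_ge0 ?ind_ge0 ?tail_ge0//;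
  by apply: ler_wpM2l; rewrite ?ind_ge0// tail_le.
Unshelve. all: by end_near. Qed.

Lemma sub_readingP Q g : sub_reading w Q g ->
  [/\ L2r g, inte g, forall x, g x = 1[Q] x * g x, forall x, 0 <= g x &
      forall x, g x <= 1[Q] x * w x].
Proof.
have dup f x : 1[Q] x * f x = 1[Q] x * (1[Q] x * f x).
  by rewrite mulrA -expr2 ind_sqr.
case=> [[gQ ->]|[n n0 ->]]; split=> //.
- by move=> x; rewrite mulr_ge0 ?ind_ge0.
- exact: L2r_trunc.
- exact: inte_trunc.
- by move=> x; rewrite mulr_ge0 ?ind_ge0 ?trunc_ge0.
- by move=> x; apply: ler_wpM2l; rewrite ?ind_ge0// trunc_le.
Qed.

Lemma sub_reading_mass Q g : sub_reading w Q g -> itg g <= wmass w Q.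
Proof.
by move=> /sub_readingP[_ ig _ _ gw]; exact: itg_le.
Qed.

End one_weight.

(** The weak bound and the two testing conditions, for the real or imaginary
part of the operator. *)
Record testing_data (r : nat) (K C : R) (S S' : (T -> R) -> T -> R)
    (u v : T -> R) : Prop := TestingData {
  td_bp : band_pair r K S S';
  td_C : 0 <= C;
  td_u : lweight u;
  td_v : lweight v;
  td_weak : forall Q P g h, level Q <= level P + r%:Z ->
    level P <= level Q + r%:Z -> real_reading u Q g -> real_reading v P h ->
    `|ip (S g) h| <= C * (Num.sqrt (wmass u Q) * Num.sqrt (wmass v P));
  td_test : forall Q g, real_reading u Q g ->
    inte (fun x => 1[Q] x * (S g x ^+ 2 * v x)) /\
    itg (fun x => 1[Q] x * (S g x ^+ 2 * v x)) <= C * wmass u Q;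
  td_test' : forall Q h, real_reading v Q h ->
    inte (fun x => 1[Q] x * (S' h x ^+ 2 * u x)) /\
    itg (fun x => 1[Q] x * (S' h x ^+ 2 * u x)) <= C * wmass v Q }.

Lemma testing_data_sym r K C S S' u v :
  testing_data r K C S S' u v -> testing_data r K C S' S v u.
Proof.
case=> bp C0 lu lv hw ht ht'; split => //; first exact: band_pair_sym.
move=> Q P g h l1 l2 rg rh.
have [g2 _ _ _ _] := sub_readingP lv (real_reading_sub rg).
have [h2 _ _ _ _] := sub_readingP lu (real_reading_sub rh).
rewrite ipC -(bp_adj bp)// [X in C * X]mulrC.
exact: hw.
Qed.

Section kernel.
Hypothesis hN : (0 < N)%N.
Variables (r : nat) (K : R) (M l : nat).
Local Notation X := (leaf N M l).
Local Notation X' := (leaf N M (l + r)).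

Lemma leaf_refine (x : X) : exists z : X', up r z = leaf_cube x.
Proof.
have hc := cube_corner R (leaf_cube x).
have [z hz] := box_leaf_cube (l + r) (leaf_cube_box hc); exists z.
rewrite /up (_ : minn r (M + (l + r)) = r); last by lia.
rewrite -hz -lat_anc; apply/esym.
by have /cubeP := hc => {1}<-.
Qed.

(** On each subcube [z], r generations down, [f] may be replaced by its
average: the difference has mean zero on [z], so its image stays inside the
leaf [x] ([localized]), where [phi] vanishes. *)
Lemma one_sided S S' (x : X) (z0 : X') f phi : band_pair r K S S' ->
  up r z0 = leaf_cube x -> L2r f -> L2r phi ->
  (forall y, cube (leaf_cube x) y -> phi y = 0) ->
  ip (S (fun y => 1[leaf_cube x] y * f y)) phi =
  \sum_(z : X' | rep r z == rep r z0)
    itg (fun y => 1[leaf_cube z] y * f y) / vol R (leaf_cube z) *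
    ip (S 1[leaf_cube z]) phi.
Proof.
move=> bp hz f2 p2 p0.
have Sp2 := bp_L2' bp p2.
have f2Q Q : L2r (fun y => 1[Q] y * f y).
  by apply: L2r_ind => //; exact: measurable_cube.
rewrite (bp_adj bp)//.
rewrite (_ : (fun y => 1[leaf_cube x] y * f y) = fun y =>
  \sum_(z : X' | rep r z == rep r z0) 1[leaf_cube z] y * f y); last first.
  by apply/funext => y; rewrite -hz ind_up mulr_suml.
rewrite ip_suml//; apply: eq_bigr => z; rewrite rep_eq hz => /eqP uz.
set Q := leaf_cube z; set av := itg _ / _.
have Q2 := L2r_cube R Q.
have h2 : L2r (fun y => 1[Q] y * f y - av * 1[Q] y).
  by apply: L2rB => //; exact: L2rZ.
have : ip (S (fun y => 1[Q] y * f y - av * 1[Q] y)) phi = 0.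
  apply: (localized hN bp h2 (P := Q)) => //.
  - by move=> y ny; rewrite indicE memNset// mul0r mulr0 subr0.
  - rewrite itgB; [|exact: inte_cubeM|by apply: inteZ; exact: inte_cube].
    rewrite itgZ ?itg_cube; last exact: inte_cube.
    by rewrite /av divfK ?subrr// lt0r_neq0// vol_gt0.
  - move=> y; rewrite -/Q in uz; rewrite /up in uz.
    have mE : minn r (M + (l + r)) = r by lia.
    by rewrite mE in uz; rewrite uz; exact: p0.
rewrite (bp_adj bp)// ipBl//; last exact: L2rZ.
move=> /eqP; rewrite subr_eq0 => /eqP ->.
by rewrite ipZl// (bp_adj bp).
Qed.

(** Averaging on subcubes in both variables ([one_sided] for [S] and for [S'])
leaves a finite matrix acting on averages. *)
Lemma kernel_bound S S' (x x' : X) : band_pair r K S S' -> x != x' ->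
  exists2 B : R, 0 <= B & forall f g, L2r f -> L2r g ->
  `|ip (S (fun y => 1[leaf_cube x] y * f y)) (fun y => 1[leaf_cube x'] y * g y)|
  <= B * (itg (fun y => 1[leaf_cube x] y * `|f y|) *
          itg (fun y => 1[leaf_cube x'] y * `|g y|)).
Proof.
move=> bp xx'; have bp' := band_pair_sym bp.
have [z0 hz0] := leaf_refine x; have [z0' hz0'] := leaf_refine x'.
have disj (y : T) : cube (leaf_cube x) y -> cube (leaf_cube x') y -> False.
  by move=> h h'; move/eqP: xx'; apply; apply: leaf_cube_inj; exact: cube_inj h h' _.
have mE : minn r (M + (l + r)) = r by lia.
have sub (z z1 : X') (x1 : X) (y : T) : up r z1 = leaf_cube x1 -> rep r z == rep r z1 ->
    cube (leaf_cube z) y -> cube (leaf_cube x1) y.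
  move=> hz1; rewrite rep_eq hz1 /up mE => /eqP <-; exact: cube_anc.
pose V (z : X') := vol R (leaf_cube z).
have V0 z : 0 < V z by exact: vol_gt0.
pose k (z z' : X') := ip (S' 1[leaf_cube z']) 1[leaf_cube z].
exists (\sum_(z : X' | rep r z == rep r z0) \sum_(z' : X' | rep r z' == rep r z0')
   (V z)^-1 * (V z')^-1 * `|k z z'|).
  by do 2!apply: sumr_ge0 => ? _; rewrite !mulr_ge0// invr_ge0 ltW.
move=> f g f2 g2.
have gx2 : L2r (fun y => 1[leaf_cube x'] y * g y).
  by apply: L2r_ind => //; exact: measurable_cube.
rewrite (one_sided bp hz0 f2 gx2); last first.
  move=> y hy; rewrite indicE memNset ?mul0r// => hy'; exact: (disj y).
have avb (z : X') (z1 : X') (x1 : X) h : up r z1 = leaf_cube x1 ->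
    rep r z == rep r z1 -> L2r h ->
    `|itg (fun y => 1[leaf_cube z] y * h y) / V z| <=
    itg (fun y => 1[leaf_cube x1] y * `|h y|) / V z.
  move=> e1 e2 h2; have vi : 0 < (V z)^-1 by rewrite invr_gt0.
  rewrite normrM (ger0_norm (ltW vi)) ler_pM2r//.
  apply: itg_le_norm; first exact: inte_cubeM.
    by apply: inte_cubeM; exact: L2r_abs.
  move=> y; rewrite !indicE; case: (boolP (y \in cube (leaf_cube z))).
    by move=> /set_mem /(sub _ _ _ _ e1 e2) hy; rewrite mem_set// normrM normr1.
  by move=> _; rewrite mul0r normr0 mulr_ge0.
set If := itg (fun y => 1[leaf_cube x] y * _).
set Ig := itg (fun y => 1[leaf_cube x'] y * _).
have If0 : 0 <= If by apply: itg_ge0 => y; rewrite mulr_ge0 ?ind_ge0.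
have Ig0 : 0 <= Ig by apply: itg_ge0 => y; rewrite mulr_ge0 ?ind_ge0.
apply: le_trans (ler_norm_sum _ _ _) _.
rewrite mulr_suml; apply: ler_sum => z hz.
have Q2 := L2r_cube R (leaf_cube z).
have -> : ip (S 1[leaf_cube z]) (fun y => 1[leaf_cube x'] y * g y) =
   ip (S' (fun y => 1[leaf_cube x'] y * g y)) 1[leaf_cube z].
  by rewrite (bp_adj bp)// ipC.
rewrite (one_sided bp' hz0' g2 Q2); last first.
  move=> y hy'; rewrite indicE memNset// => hy.
  by apply: (disj y) => //; exact: (sub _ _ _ _ hz0 hz hy).
rewrite normrM mulr_suml.
apply: (@le_trans _ _ ((If / V z) * \sum_(z' : X' | rep r z' == rep r z0')
   (Ig / V z') * `|k z z'|)).
  apply: ler_pM => //; first exact: (avb z z0 x f hz0 hz f2).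
  apply: le_trans (ler_norm_sum _ _ _) _; apply: ler_sum => z' hz'.
  rewrite normrM; apply: ler_wpM2r => //.
  exact: (avb z' z0' x' g hz0' hz' g2).
rewrite mulr_sumr le_eqVlt; apply/orP; left; apply/eqP.
by apply: eq_bigr => z' _; ring.
Qed.

Lemma near_exists (P : nat -> Prop) : (\forall n \near \oo, P n) ->
  exists n0, forall n, (n0 <= n)%N -> P n.
Proof. by case=> n0 _ h; exists n0 => n; exact: h. Qed.

(** Three cases. If [v] is square integrable on [x'], boundedness in L^2 is
enough. If not and x = x', then [g] is a reading of [v], and Cauchy-Schwarz
against the testing condition for [S'] brings out the integral of the tail of
[u]. If x <> x' the kernel is bounded and again the integral of the tail
appears. *)
Lemma leaf_tail C S S' u v (x x' : X) e : testing_data r K C S S' u v ->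
  good u (leaf_cube x) -> 0 < e ->
  exists n0, forall n, (n0 <= n)%N -> forall g, sub_reading v (leaf_cube x') g ->
  `|ip (S (fun y => 1[leaf_cube x] y * tail u n y)) g| <= e.
Proof.
move=> td gx e0; have bp := td_bp td; have lu := td_u td; have lv := td_v td.
set Q := leaf_cube x in gx *; set Q' := leaf_cube x'.
have t2 n : L2r (fun y => 1[Q] y * tail u n y) by exact: L2r_tail.
have dup f y : 1[Q] y * f y = 1[Q] y * (1[Q] y * f y).
  by rewrite mulrA -expr2 ind_sqr.
have small (a : nat -> R) (b : R) : a n @[n --> \oo] --> (0 : R) -> 0 <= b ->
    (forall n, 0 <= a n) -> exists n0, forall n, (n0 <= n)%N -> a n * b <= e.
  move=> a0 b0 ap; have d0 : 0 < e / (b + 1) by rewrite divr_gt0// ltr_wpDl.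
  move/cvgr0Pnorm_lt : a0 => /(_ _ d0)/near_exists[n0 hn]; exists n0 => n /hn.
  rewrite ger0_norm// => /ltW h.
  apply: (@le_trans _ _ (e / (b + 1) * b)); first exact: ler_wpM2r.
  rewrite mulrAC ler_pdivrMr ?ltr_wpDl//; apply: ler_wpM2l; first exact: ltW.
  by rewrite lerDl.
have sqr_small (a : nat -> R) : a n @[n --> \oo] --> (0 : R) ->
    Num.sqrt (a n) @[n --> \oo] --> (0 : R).
  move=> h; rewrite -[X in _ --> X]sqrtr0.
  apply: (@cvg_comp _ _ _ a Num.sqrt _ _ _ h).
  exact: sqrt_continuous.
have [gQ'|nQ'] := pselect (good v Q').
  have [n0 hn] := small _ (K * nrm (fun y => 1[Q'] y * v y))
    (sqr_small _ (tail_norm_cvg lu gx))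
    (mulr_ge0 (bp_K bp) (sqrtr_ge0 _)) (fun=> sqrtr_ge0 _).
  exists n0 => n /hn h g sg; apply: le_trans h.
  have [g2 _ _ g0 gv] := sub_readingP lv sg.
  apply: le_trans (ipS_bound bp (t2 n) g2) _.
  rewrite mulrCA; apply: ler_wpM2l; first exact: sqrtr_ge0.
  apply: ler_wpM2l; first exact: (bp_K bp).
  rewrite ler_wsqrtr//; apply: itg_le; try exact: L2r_inte.
  by move=> y; apply: ler_pM.
have [e1|nexx'] := eqVneq x x'.
  have eQ : Q' = Q by rewrite /Q /Q' e1.
  rewrite eQ in nQ' *.
  have [n0 hn] := small _ (Num.sqrt (C * wmass v Q))
    (sqr_small _ (tail_mass_cvg lu Q)) (sqrtr_ge0 _) (fun=> sqrtr_ge0 _).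
  exists n0 => n /hn h g sg; apply: le_trans h.
  have [g2 _ _ g0 gv] := sub_readingP lv sg.
  have rg : real_reading v Q g by case: sg => [[/nQ']//|]; right.
  have [i1 i2] := td_test' td rg.
  rewrite (bp_adj bp)//.
  have u0 y : 0 <= u y by case: lu.
  have w1 y : 0 <= 1[Q] y * tail u n y by rewrite mulr_ge0 ?ind_ge0 ?tail_ge0.
  have mS : measurable_fun setT (S' g) := L2rM (bp_L2' bp g2).
  have m1 : measurable_fun setT (fun _ : T => 1 : R) by exact: measurable_cst.
  have mt := measurable_1tail lu Q n.
  have i3 : inte (fun y => 1 ^+ 2 * (1[Q] y * tail u n y)).
    by under eq_fun do rewrite expr1n mul1r; exact: inte_tail.
  have le4 y : S' g y ^+ 2 * (1[Q] y * tail u n y) <=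
      1[Q] y * (S' g y ^+ 2 * u y).
    rewrite mulrCA; apply: ler_wpM2l; rewrite ?ind_ge0//.
    by apply: ler_wpM2l; rewrite ?sqr_ge0// tail_le.
  have i4 : inte (fun y => S' g y ^+ 2 * (1[Q] y * tail u n y)).
    apply: (inte_le _ i1).
      by apply: measurable_funM => //; exact: measurable_funX.
    by move=> y; rewrite ger0_norm// mulr_ge0 ?sqr_ge0.
  have := itg_CS w1 m1 mS mt i3 i4.
  rewrite (@eq_itg _ _ _ _ (fun y => 1 * S' g y * (1[Q] y * tail u n y))
    (fun y => 1[Q] y * tail u n y * S' g y)); last first.
    by move=> y; ring.
  move/le_trans; apply; apply: ler_pM; rewrite ?sqrtr_ge0// ler_wsqrtr//.
    by under eq_itg do rewrite expr1n mul1r.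
  by apply: le_trans i2; exact: itg_le.
have [B B0 hB] := kernel_bound bp nexx'.
have ap n : 0 <= itg (fun y => 1[Q] y * tail u n y).
  by apply: itg_ge0 => y; rewrite mulr_ge0 ?ind_ge0 ?tail_ge0.
have [n0 hn] := small _ (B * wmass v Q') (tail_mass_cvg lu Q)
  (mulr_ge0 B0 (wmass_ge0 lv Q')) ap.
exists n0 => n /hn h g sg; apply: le_trans h.
have [g2 _ gE g0 gv] := sub_readingP lv sg.
have := hB _ _ (t2 n) g2.
rewrite (_ : (fun y => 1[leaf_cube x] y * (1[Q] y * tail u n y)) =
  fun y => 1[Q] y * tail u n y); last by apply/funext => y; rewrite -dup.
rewrite (_ : (fun y => 1[leaf_cube x'] y * g y) = g); last exact/esym/funext.
move/le_trans; apply; rewrite mulrCA.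
apply: ler_pM.
- by apply: itg_ge0 => y; rewrite mulr_ge0 ?ind_ge0.
- by rewrite mulr_ge0// itg_ge0// => y; rewrite mulr_ge0 ?ind_ge0.
- rewrite le_eqVlt; apply/orP; left; apply/eqP; apply: eq_itg => y.
  rewrite ger0_norm; last by rewrite mulr_ge0 ?ind_ge0 ?tail_ge0.
  by rewrite -dup.
- apply: ler_wpM2l => //.
  rewrite (@eq_itg _ _ _ _ _ g); first exact: sub_reading_mass.
  by move=> y; rewrite ger0_norm// -gE.
Qed.

End kernel.
End readings.

(** * The matrix of the operator between truncated weights *)

Section form.
Variables (R : realType) (N : nat).
Hypothesis hN : (0 < N)%N.
Local Notation mu := (lebesgue R N).
Local Notation T := (Rn R N).
Local Notation itg := (itg mu).
Local Notation inte := (inte mu).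
Local Notation ip := (ip mu).
Local Notation nrm := (nrm mu).
Local Notation L2r := (L2r mu).
Implicit Types (f g h F G phi : T -> R) (Q P A B : dyadic N).
Local Notation "1[ Q ]" := (\1_(cube Q) : T -> R) (at level 0, format "1[ Q ]").

Variables (M l : nat).
Local Notation X := (leaf N M l).
Local Notation cx := (@leaf_cube N M l).
Local Notation L := (M + l)%N.
Local Notation nX := (#|{: X}|%:R : R).

Lemma class_split k (x0 : X) f y : 1[up k x0] y * f y =
  \sum_(z : X | rep k z == rep k x0) 1[cx z] y * f y.
Proof. by rewrite ind_up mulr_suml. Qed.

Lemma leaf_in_class k (x0 z : X) y : rep k z == rep k x0 ->
  1[up k x0] y * 1[cx z] y = 1[cx z] y.
Proof.
rewrite rep_eq => /eqP <-; apply: ind_below; exact: below_anc.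
Qed.

Lemma good_leaf (w : T -> R) k (x0 z : X) : rep k z == rep k x0 -> good w (up k x0) ->
  good w (cx z).
Proof.
move=> zx gQ; rewrite /good.
rewrite (_ : (fun _ => _) = fun y => 1[cx z] y * (1[up k x0] y * w y)).
  by apply: L2r_ind => //; exact: measurable_cube.
by apply/funext => y; rewrite mulrA [_ * 1[up k x0] y]mulrC (leaf_in_class _ zx).
Qed.

Lemma sub_reading_leaf (w : T -> R) k (x0 z : X) g : rep k z == rep k x0 ->
  sub_reading w (up k x0) g -> sub_reading w (cx z) (fun y => 1[cx z] y * g y).
Proof.
have e f y : rep k z == rep k x0 -> 1[cx z] y * (1[up k x0] y * f y) = 1[cx z] y * f y.
  by move=> zx; rewrite mulrA [_ * 1[up k x0] y]mulrC (leaf_in_class _ zx).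
move=> zx [[gQ ->]|[n n0 ->]]; [left|right].
  by split; [exact: good_leaf gQ|apply/funext => y; rewrite e].
by exists n => //; apply/funext => y; rewrite e.
Qed.

Lemma ipS_sum (I : finType) (P : pred I) r K S S' (F : I -> T -> R) G :
  band_pair r K S S' -> (forall i, P i -> L2r (F i)) -> L2r G ->
  ip (S (fun y => \sum_(i | P i) F i y)) G = \sum_(i | P i) ip (S (F i)) G.
Proof.
move=> bp F2 G2; rewrite (bp_adj bp)//; last exact: L2r_sum.
rewrite ip_suml//; last exact: (bp_L2' bp).
by apply: eq_bigr => i Pi; rewrite (bp_adj bp)//; exact: F2.
Qed.

Lemma ip_sumr (I : finType) (P : pred I) (F : I -> T -> R) G :
  (forall i, P i -> L2r (F i)) -> L2r G ->
  ip G (fun y => \sum_(i | P i) F i y) = \sum_(i | P i) ip G (F i).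
Proof.
move=> F2 G2; rewrite ipC ip_suml//; apply: eq_bigr => i _; exact: ipC.
Qed.

Lemma ipZr a f g : L2r f -> L2r g -> ip f (fun x => a * g x) = a * ip f g.
Proof. by move=> f2 g2; rewrite ipC ipZl// ipC. Qed.

Lemma ipSZ r K S S' a f g : band_pair r K S S' -> L2r f -> L2r g ->
  ip (S (fun y => a * f y)) g = a * ip (S f) g.
Proof.
move=> bp f2 g2; rewrite (bp_adj bp)//; last exact: L2rZ.
by rewrite ipZl ?(bp_adj bp)//; exact: (bp_L2' bp).
Qed.

Lemma wmass_class (w : T -> R) n k (x0 : X) : lweight w ->
  mass (@rep N M l) (fun x => wmass (trunc w n) (cx x)) k (rep k x0) =
  wmass (trunc w n) (up k x0).
Proof.
move=> lw; rewrite /mass /wmass -itg_sum; last by move=> z _; exact: inte_trunc.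
by apply: eq_itg => y; rewrite class_split.
Qed.

(** The next three predicates express that the truncation level is high enough
and that rho is small enough for a given finite set of leaves. *)
Definition tail_small (S : (T -> R) -> T -> R) (u v : T -> R) n e := forall x x' : X,
  good u (cx x) -> forall g, sub_reading v (cx x') g ->
  `|ip (S (fun y => 1[cx x] y * tail u n y)) g| <= e.
Definition mass_ok (u : T -> R) n := forall k (x : X),
  wmass u (up k x) <= 4 * wmass (trunc u n) (up k x).
Definition floor_ok (u : T -> R) rho := forall x : X,
  wmass (trunc u 1) (cx x) = 0 \/ rho <= wmass (trunc u 1) (cx x).

Section half.
Variables (r : nat) (K C : R) (S S' : (T -> R) -> T -> R) (u v : T -> R).
Variables (n : nat) (e : R).
Hypothesis td : testing_data r K C S S' u v.
Hypotheses (n0 : (0 < n)%N) (e0 : 0 <= e) (tsu : tail_small S u v n e).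
Let bp := td_bp td.
Let lu := td_u td.
Let lv := td_v td.
Lemma class_error k1 k2 (x1 x2 : X) g : good u (up k1 x1) ->
  sub_reading v (up k2 x2) g ->
  `|ip (S (fun y => 1[up k1 x1] y * tail u n y)) g| <= nX ^+ 2 * e.
Proof.
move=> gQ sg; have [g2 _ gE _ _] := sub_readingP lv sg.
have gz (z : X) : L2r (fun y => 1[cx z] y * g y).
  by apply: L2r_ind => //; exact: measurable_cube.
rewrite (_ : (fun y => 1[up k1 x1] y * tail u n y) = fun y =>
  \sum_(z : X | rep k1 z == rep k1 x1) 1[cx z] y * tail u n y); last first.
  by apply/funext => y; rewrite class_split.
have t2 (z : X) : rep k1 z == rep k1 x1 -> L2r (fun y => 1[cx z] y * tail u n y).
  by move=> zx; apply: L2r_tail => //; exact: good_leaf zx gQ.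
rewrite (ipS_sum bp)//.
have card (I : finType) (P : pred I) (a b : R) : 0 <= b -> a = b ->
    \sum_(i | P i) a <= #|I|%:R * b.
  move=> b0 ->; rewrite sumr_const -[leLHS]mulr_natl; apply: ler_wpM2r => //.
  by rewrite ler_nat max_card.
apply: le_trans (ler_norm_sum _ _ _) _.
apply: (@le_trans _ _ (\sum_(z : X | rep k1 z == rep k1 x1) nX * e)); last first.
  apply: le_trans (card _ _ _ (nX * e) _ erefl) _; first by rewrite mulr_ge0.
  by rewrite mulrA expr2.
apply: ler_sum => z zx.
have -> : ip (S (fun y => 1[cx z] y * tail u n y)) g =
    \sum_(z' : X | rep k2 z' == rep k2 x2)
      ip (S (fun y => 1[cx z] y * tail u n y)) (fun y => 1[cx z'] y * g y).
  rewrite -ip_sumr//; last exact: (bp_L2 bp (t2 z zx)).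
  by apply: eq_itg => y; rewrite -class_split -gE.
apply: le_trans (ler_norm_sum _ _ _) _.
apply: le_trans (card _ _ _ e e0 erefl); apply: ler_sum => z' zx'.
apply: tsu; first exact: good_leaf zx gQ.
exact: sub_reading_leaf zx' sg.
Qed.

(** On a good cube the reading is [u] itself, which differs from the
truncation by tails on good leaves; on the other cubes the truncation is a
reading. *)
Lemma reading_near k1 (x1 : X) : exists2 gQ, real_reading u (up k1 x1) gQ &
  forall k2 (x2 : X) g, sub_reading v (up k2 x2) g ->
  `|ip (S gQ) g - ip (S (fun y => 1[up k1 x1] y * trunc u n y)) g| <=
  nX ^+ 2 * e.
Proof.
have [gQ|nQ] := pselect (good u (up k1 x1)); last first.
  exists (fun y => 1[up k1 x1] y * trunc u n y); first by right; split => //; exists n.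
  by move=> k2 x2 g _; rewrite subrr normr0 mulr_ge0 ?sqr_ge0.
exists (fun y => 1[up k1 x1] y * u y); first by left.
move=> k2 x2 g sg; have [g2 _ _ _ _] := sub_readingP lv sg.
have uQ2 := L2r_trunc lu (up k1 x1) n.
have Sg2 := bp_L2' bp g2.
rewrite (bp_adj bp gQ g2) (bp_adj bp uQ2 g2) -ipBl//.
rewrite (_ : (fun x => _) = fun y => 1[up k1 x1] y * tail u n y); last first.
  by apply/funext => y; rewrite /tail mulrBr.
have t2 := L2r_tail lu n gQ.
by rewrite -(bp_adj bp)//; exact: (class_error gQ sg).
Qed.

End half.

Section full.
Variables (r : nat) (K C : R) (S S' : (T -> R) -> T -> R) (u v : T -> R).
Variables (n m : nat) (e rho : R).
Hypothesis td : testing_data r K C S S' u v.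
Hypotheses (n0 : (0 < n)%N) (m0 : (0 < m)%N) (e0 : 0 <= e) (rho0 : 0 < rho).
Hypotheses (tsu : tail_small S u v n e) (tsv : tail_small S' v u m e).
Hypotheses (mku : mass_ok u n) (mkv : mass_ok v m).
Hypotheses (fku : floor_ok u rho) (fkv : floor_ok v rho).
Hypothesis small : (nX + 2) * (nX ^+ 2 * e) <= rho.

Let bp := td_bp td.
Let lu := td_u td.
Let lv := td_v td.
Let u2 Q := L2r_trunc lu Q n.
Let v2 Q := L2r_trunc lv Q m.

(** A class of positive mass contains a leaf of positive mass. *)
Lemma mass_floor (w : T -> R) k nn (x0 : X) : lweight w -> floor_ok w rho -> (0 < nn)%N ->
  wmass (trunc w nn) (up k x0) = 0 \/ rho <= wmass (trunc w nn) (up k x0).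
Proof.
move=> lw fk nn0; have [h|h] := eqVneq (wmass (trunc w 1) (up k x0)) 0.
  by left; exact: wmass_trunc1.
right; apply: (@le_trans _ _ (wmass (trunc w 1) (up k x0))); last first.
  exact: wmass_trunc_mono.
move: h; rewrite -wmass_class// /mass => h.
have [z zx hz] : exists2 z, rep k z == rep k x0 & wmass (trunc w 1) (cx z) != 0.
  apply: contrapT => nz; move/eqP: h; apply; apply: big1 => z zx.
  by apply/eqP/negP => /negP hz; apply: nz; exists z.
have wz z' : 0 <= wmass (trunc w 1) (cx z').
  by apply: itg_ge0 => y; rewrite mulr_ge0 ?ind_ge0 ?(trunc_ge0 lw).
rewrite (bigD1 z)//=; apply: (@le_trans _ _ (wmass (trunc w 1) (cx z))).
  by have [h0|//] := fk z; rewrite h0 eqxx in hz.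
by rewrite lerDl sumr_ge0.
Qed.

Lemma null_pair f g : L2r f -> L2r g -> ip f f = 0 -> ip (S f) g = 0.
Proof.
move=> f2 g2 f0; rewrite (bp_adj bp)//; apply: ip_null => //.
exact: (bp_L2' bp).
Qed.

Lemma test_pair Q g (H : T -> R) : real_reading u Q g -> measurable_fun setT H ->
  inte (fun y => 1[Q] y * (H y ^+ 2 * trunc v m y)) ->
  `|ip (S g) (fun y => 1[Q] y * (H y * trunc v m y))| <=
  Num.sqrt (C * wmass u Q) *
  Num.sqrt (itg (fun y => 1[Q] y * (H y ^+ 2 * trunc v m y))).
Proof.
move=> rg mH iH; have [i1 i2] := td_test td rg.
have [g2 _ _ _ _] := sub_readingP lu (real_reading_sub rg).
have mS : measurable_fun setT (S g) := L2rM (bp_L2 bp g2).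
have w0 y : 0 <= 1[Q] y * trunc v m y.
  by rewrite mulr_ge0 ?ind_ge0 ?(trunc_ge0 lv).
have mw : measurable_fun setT (fun y => 1[Q] y * trunc v m y) := L2rM (v2 Q).
have le y : S g y ^+ 2 * (1[Q] y * trunc v m y) <= 1[Q] y * (S g y ^+ 2 * v y).
  rewrite mulrCA; apply: ler_wpM2l; rewrite ?ind_ge0//.
  by apply: ler_wpM2l; rewrite ?sqr_ge0// trunc_le.
have i3 : inte (fun y => S g y ^+ 2 * (1[Q] y * trunc v m y)).
  apply: (inte_le _ i1); first by apply: measurable_funM => //; exact: measurable_funX.
  by move=> y; rewrite ger0_norm// mulr_ge0 ?sqr_ge0.
have i4 : inte (fun y => H y ^+ 2 * (1[Q] y * trunc v m y)).
  by under eq_fun do rewrite mulrCA.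
have := itg_CS w0 mS mH mw i3 i4.
rewrite (@eq_itg _ _ _ _ (fun y => S g y * H y * (1[Q] y * trunc v m y))
  (fun y => S g y * (1[Q] y * (H y * trunc v m y)))); last first.
  by move=> y; ring.
move/le_trans; apply; apply: ler_pM; rewrite ?sqrtr_ge0// ler_wsqrtr//.
  by apply: le_trans i2; exact: itg_le.
by under eq_itg do rewrite mulrCA.
Qed.

Definition stepf (h : X -> R) : T -> R := fun y => \sum_x h x * 1[cx x] y.

Lemma stepf_leaf (h : X -> R) x y : stepf h y * 1[cx x] y = h x * 1[cx x] y.
Proof.
rewrite /stepf mulr_suml (bigD1 x)//= big1 => [|z zx].
  by rewrite addr0 -mulrA -expr2 ind_sqr.
rewrite -mulrA !indicE.
case: (boolP (y \in cube (cx x))) => [/set_mem hx|_]; last by rewrite !mulr0.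
case: (boolP (y \in cube (cx z))) => [/set_mem hz|_]; last by rewrite !(mul0r, mulr0).
by move/eqP: zx; case; apply: leaf_cube_inj; exact: cube_inj hz hx _.
Qed.

Lemma L2r_stepf (h : X -> R) : L2r (stepf h).
Proof. by apply: L2r_sum => x _; apply: L2rZ; exact: L2r_cube. Qed.

Lemma stepf_class (h : X -> R) (w : T -> R) k (x0 : X) y : 1[up k x0] y * (stepf h y * w y) =
  \sum_(z : X | rep k z == rep k x0) h z * (1[cx z] y * w y).
Proof.
rewrite (class_split k x0 (fun y => stepf h y * w y)); apply: eq_bigr => z _.
by rewrite mulrA [X in X * _]mulrC stepf_leaf mulrA.
Qed.

Lemma stepf_class2 (h : X -> R) (w : T -> R) k (x0 : X) y : 1[up k x0] y * (stepf h y ^+ 2 * w y) =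
  \sum_(z : X | rep k z == rep k x0) h z ^+ 2 * (1[cx z] y * w y).
Proof.
rewrite (class_split k x0 (fun y => stepf h y ^+ 2 * w y)).
apply: eq_bigr => z _.
have := stepf_leaf h z y; rewrite !indicE; case: (_ \in _) => /=.
  by rewrite !mulr1 => ->; ring.
by rewrite !mul0r mulr0.
Qed.

Definition entry (x y : X) :=
  ip (S (fun z => 1[cx x] z * trunc u n z)) (fun z => 1[cx y] z * trunc v m z).

Local Notation U x := (wmass (trunc u n) (cx x)).
Local Notation V x := (wmass (trunc v m) (cx x)).

Lemma small2 : 2 * (nX ^+ 2 * e) <= rho /\ nX * (nX ^+ 2 * e) <= rho.
Proof.
have E0 : 0 <= nX ^+ 2 * e by rewrite mulr_ge0 ?sqr_ge0.
have nX0 : 0 <= nX by [].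
split; apply: le_trans small; apply: ler_wpM2r => //; lra.
Qed.

(** The truncations are exchanged for readings, to which the weak bound
applies. The errors are at most rho, hence at most the product of the roots of
the two masses, unless one of the masses is zero and the pairing vanishes. *)
Lemma weak_form k1 k2 (x1 x2 : X) : (k1 <= k2 + r)%N -> (k2 <= k1 + r)%N ->
  `|\sum_(x | rep k1 x == rep k1 x1) \sum_(y | rep k2 y == rep k2 x2) entry x y|
  <= (4 * C + 2) * (Num.sqrt (wmass (trunc u n) (up k1 x1)) *
      Num.sqrt (wmass (trunc v m) (up k2 x2))).
Proof.
move=> k12 k21.
set Q := up k1 x1; set P := up k2 x2.
pose w1 y := 1[Q] y * trunc u n y; pose w2 y := 1[P] y * trunc v m y.
have -> : \sum_(x | rep k1 x == rep k1 x1) \sum_(y | rep k2 y == rep k2 x2)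
    entry x y = ip (S w1) w2.
  rewrite (_ : w1 = fun y => \sum_(x | rep k1 x == rep k1 x1)
      1[cx x] y * trunc u n y); last by apply/funext => y; exact: class_split.
  rewrite (ipS_sum bp)//; last exact: v2.
  apply: eq_bigr => x _; rewrite -ip_sumr//; last exact: (bp_L2 bp (u2 _)).
  by apply: eq_itg => y; rewrite -class_split.
have w12 : L2r w1 := u2 Q.
have w22 : L2r w2 := v2 P.
have [hU|hU] := mass_floor k1 x1 lu fku n0.
  rewrite (null_pair w12 w22 (wmass_trunc_null lu hU)).
  by rewrite normr0 -/Q hU sqrtr0 mul0r mulr0.
have [hV|hV] := mass_floor k2 x2 lv fkv m0.
  rewrite ipC (ip_null w22 (bp_L2 bp w12) (wmass_trunc_null lv hV)).
  by rewrite normr0 -/P hV sqrtr0 !mulr0.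
have [gQ rQ hQ] := reading_near td n0 e0 tsu k1 x1.
have td' := testing_data_sym td.
have [gP rP hP] := reading_near td' m0 e0 tsv k2 x2.
have [E2 _] := small2.
have sP := real_reading_sub rP; have sw1 : sub_reading u Q w1 by right; exists n.
have h1 := hQ _ _ _ sP; have h2 := hP _ _ _ sw1.
have [gP2 _ _ _ _] := sub_readingP lv sP.
have h3 : `|ip (S gQ) gP| <=
    C * (Num.sqrt (wmass u Q) * Num.sqrt (wmass v P)).
  exact: (td_weak td (level_up_close x1 x2 k12) (level_up_close x2 x1 k21) rQ rP).
have -> : ip (S w1) w2 = ip (S gQ) gP - (ip (S gQ) gP - ip (S w1) gP)
    - (ip (S' gP) w1 - ip (S' w2) w1).
  have -> : ip (S' gP) w1 = ip (S w1) gP.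
    by rewrite (bp_adj bp) ?u2// ipC.
  have -> : ip (S' w2) w1 = ip (S w1) w2.
    by rewrite (bp_adj bp) ?u2 ?v2// ipC.
  ring.
have sq w k nn (x : X) : lweight w -> mass_ok w nn ->
    Num.sqrt (wmass w (up k x)) <= 2 * Num.sqrt (wmass (trunc w nn) (up k x)).
  move=> lw ok; have -> : 2 = Num.sqrt 4 :> R.
    by rewrite (_ : 4 = 2 ^+ 2) ?sqrtr_sqr ?ger0_norm//; ring.
  by rewrite -sqrtrM// ler_wsqrtr.
have sU := sq _ k1 _ x1 lu mku; have sV := sq _ k2 _ x2 lv mkv.
set a := Num.sqrt (wmass (trunc u n) _) in sU *.
set b := Num.sqrt (wmass (trunc v m) _) in sV *.
have a0 : 0 <= a by exact: sqrtr_ge0.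
have b0 : 0 <= b by exact: sqrtr_ge0.
have rab : rho <= a * b.
  have -> : rho = Num.sqrt rho * Num.sqrt rho by rewrite -expr2 sqr_sqrtr// ltW.
  by apply: ler_pM; rewrite ?sqrtr_ge0// ler_wsqrtr.
have h4 : Num.sqrt (wmass u Q) * Num.sqrt (wmass v P) <= 4 * (a * b).
  apply: le_trans (ler_pM (sqrtr_ge0 _) (sqrtr_ge0 _) sU sV) _.
  by rewrite le_eqVlt; apply/orP; left; apply/eqP; ring.
have h5 : C * (Num.sqrt (wmass u Q) * Num.sqrt (wmass v P)) <= C * (4 * (a * b)).
  by apply: ler_wpM2l => //; exact: (td_C td).
apply: le_trans (ler_normB _ _) _; apply: le_trans (lerD (ler_normB _ _) h2) _.
have ab0 : 0 <= a * b by rewrite mulr_ge0.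
by move: h1 h3 h5; rewrite -/Q; lra.
Qed.

(** As for [weak_form]; the error is estimated leaf by leaf, where the value
of [h] on a leaf is at most its norm divided by the square root of rho. *)
Lemma test_form k (x0 : X) (h : X -> R) :
  `|\sum_(x | rep k x == rep k x0) \sum_(y | rep k y == rep k x0) entry x y * h y|
  <= (4 * C + 2) * (Num.sqrt (wmass (trunc u n) (up k x0)) *
      Num.sqrt (\sum_(y | rep k y == rep k x0) V y * h y ^+ 2)).
Proof.
set Q := up k x0; pose w1 y := 1[Q] y * trunc u n y.
set Nh := \sum_(y | _) V y * _.
pose G y := 1[Q] y * (stepf h y * trunc v m y).
have GE : G = fun y => \sum_(z : X | rep k z == rep k x0)
    h z * (1[cx z] y * trunc v m y).
  by apply/funext => y; exact: stepf_class.
have z2 (z : X) : L2r (fun y => h z * (1[cx z] y * trunc v m y)) by exact: L2rZ.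
have G2 : L2r G by rewrite GE; exact: L2r_sum.
have Sw2 := bp_L2 bp (u2 Q).
have V0 z : 0 <= V z.
  by apply: itg_ge0 => y; rewrite mulr_ge0 ?ind_ge0 ?(trunc_ge0 lv).
have Nh0 : 0 <= Nh by apply: sumr_ge0 => z _; rewrite mulr_ge0 ?sqr_ge0.
have -> : \sum_(x | rep k x == rep k x0) \sum_(y | rep k y == rep k x0)
    entry x y * h y = ip (S w1) G.
  rewrite (_ : w1 = fun y => \sum_(x | rep k x == rep k x0)
      1[cx x] y * trunc u n y); last by apply/funext => y; exact: class_split.
  rewrite (ipS_sum bp)//.
  apply: eq_bigr => x _; rewrite GE ip_sumr//; last exact: (bp_L2 bp (u2 _)).
  apply: eq_bigr => y _; rewrite (ipZr _ (bp_L2 bp (u2 _)) (v2 _)).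
  exact: mulrC.
have [hU|hU] := mass_floor k x0 lu fku n0.
  rewrite (null_pair (u2 Q) G2 (wmass_trunc_null lu hU)).
  by rewrite normr0 -/Q hU sqrtr0 mul0r mulr0.
have [gQ rQ hQ] := reading_near td n0 e0 tsu k x0.
have iH : inte (fun y => 1[Q] y * (stepf h y ^+ 2 * trunc v m y)).
  under eq_fun do rewrite stepf_class2.
  by apply: inte_sum => z _; apply: inteZ; exact: inte_trunc.
have h1 := test_pair rQ (L2rM (L2r_stepf h)) iH.
have NhE : itg (fun y => 1[Q] y * (stepf h y ^+ 2 * trunc v m y)) = Nh.
  under eq_itg do rewrite stepf_class2.
  rewrite itg_sum; last by move=> z _; apply: inteZ; exact: inte_trunc.
  by apply: eq_bigr => z _; rewrite itgZ 1?mulrC//; exact: inte_trunc.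
rewrite NhE in h1.
have [gQ2 _ _ _ _] := sub_readingP lu (real_reading_sub rQ).
have SgQ2 := bp_L2 bp gQ2.
have [_ E3] := small2.
have h2 : `|ip (S gQ) G - ip (S w1) G| <=
    Num.sqrt (wmass (trunc u n) Q) * Num.sqrt Nh.
  rewrite GE !ip_sumr// -sumrB.
  have -> : \sum_(z : X | rep k z == rep k x0)
      (ip (S gQ) (fun y => h z * (1[cx z] y * trunc v m y)) -
       ip (S w1) (fun y => h z * (1[cx z] y * trunc v m y))) =
     \sum_(z : X | rep k z == rep k x0) h z *
      (ip (S gQ) (fun y => 1[cx z] y * trunc v m y) -
       ip (S w1) (fun y => 1[cx z] y * trunc v m y)).
    apply: eq_bigr => z _.
    by rewrite (ipZr _ SgQ2 (v2 _)) (ipZr _ Sw2 (v2 _)); ring.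
  apply: le_trans (ler_norm_sum _ _ _) _.
  pose sr := Num.sqrt rho.
  have sr0 : 0 < sr by rewrite sqrtr_gt0.
  have rE : rho = sr * sr by rewrite -expr2 sqr_sqrtr// ltW.
  apply: (@le_trans _ _ (\sum_(z : X | rep k z == rep k x0)
     Num.sqrt Nh / sr * (nX ^+ 2 * e))).
    apply: ler_sum => z zx.
    have E0 : 0 <= nX ^+ 2 * e by rewrite mulr_ge0 ?sqr_ge0.
    have [hV|hV] := mass_floor 0 z lv fkv m0.
      rewrite (ipC _ (S gQ)) (ipC _ (S w1)).
      have nul : ip (fun y => 1[cx z] y * trunc v m y)
          (fun y => 1[cx z] y * trunc v m y) = 0.
        by apply: wmass_trunc_null; rewrite /up min0n /= in hV.
      rewrite (ip_null (v2 _) SgQ2 nul) (ip_null (v2 _) Sw2 nul) subrr mulr0 normr0 mulr_ge0// divr_ge0 ?sqrtr_ge0//.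
    rewrite normrM; apply: ler_pM => //; last first.
      apply: (hQ 0%N z); right; exists m => //.
      by rewrite /up min0n.
    rewrite /up min0n /= in hV.
    rewrite ler_pdivlMr// -(sqrtr_sqr (h z)) -sqrtrM ?sqr_ge0// ler_wsqrtr//.
    apply: (@le_trans _ _ (V z * h z ^+ 2)).
      by rewrite mulrC; apply: ler_wpM2r; rewrite ?sqr_ge0.
    rewrite /Nh (bigD1 z)//= lerDl sumr_ge0// => z' _.
    exact: mulr_ge0 (V0 z') (sqr_ge0 _).
  rewrite sumr_const -[leLHS]mulr_natl.
  apply: (@le_trans _ _ (Num.sqrt Nh / sr * (nX * (nX ^+ 2 * e)))).
    rewrite mulrCA; apply: ler_wpM2l.
      by rewrite divr_ge0 ?sqrtr_ge0// ltW.
    apply: ler_wpM2r; first by rewrite mulr_ge0 ?sqr_ge0.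
    by rewrite ler_nat max_card.
  have h5 : nX * (nX ^+ 2 * e) / sr <= Num.sqrt (wmass (trunc u n) Q).
    rewrite ler_pdivrMr//; apply: le_trans E3 _; rewrite rE.
    by apply: ler_wpM2r; [exact: ltW|rewrite ler_wsqrtr].
  apply: le_trans (ler_wpM2r (sqrtr_ge0 Nh) h5).
  by rewrite le_eqVlt; apply/orP; left; apply/eqP; ring.
have sU : Num.sqrt (C * wmass u Q) <= (C + 1) * Num.sqrt (wmass (trunc u n) Q).
  have C0 := td_C td.
  have W0 : 0 <= wmass (trunc u n) Q.
    by apply: itg_ge0 => y; rewrite mulr_ge0 ?ind_ge0 ?(trunc_ge0 lu).
  have -> : (C + 1) * Num.sqrt (wmass (trunc u n) Q) =
      Num.sqrt ((C + 1) ^+ 2 * wmass (trunc u n) Q).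
    by rewrite sqrtrM ?sqr_ge0// sqrtr_sqr ger0_norm ?addr_ge0.
  rewrite ler_wsqrtr//; apply: (@le_trans _ _ (C * (4 * wmass (trunc u n) Q))).
    by apply: ler_wpM2l => //; exact: mku.
  rewrite mulrA; apply: ler_wpM2r => //.
  by have := sqr_ge0 (C - 1); lra.
have -> : ip (S w1) G = ip (S gQ) G - (ip (S gQ) G - ip (S w1) G) by ring.
apply: le_trans (ler_normB _ _) _.
apply: le_trans (lerD h1 h2) _; rewrite -mulrDl mulrA.
apply: ler_wpM2r; first exact: sqrtr_ge0.
have := sqrtr_ge0 (wmass (trunc u n) Q); have := td_C td; nra.
Qed.

(** The function [V z 1_y v_m - V y 1_z v_m] has mean zero on the k-th class
of [y] and [z]. *)
Lemma kernel_form k (x y z : X) : rep k y = rep k z ->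
  rep (k + r) x != rep (k + r) y -> entry x y * V z = entry x z * V y.
Proof.
move=> yz xy.
have yzE : up k y = up k z by apply/rep_eqP.
pose w1 := (fun s => 1[cx x] s * trunc u n s) : T -> R.
pose h s := V z * (1[cx y] s * trunc v m s) - V y * (1[cx z] s * trunc v m s).
have h2 : L2r h by apply: L2rB; apply: L2rZ; exact: v2.
have sub (x1 : X) (s : T) : cube (cx x1) s -> cube (up k x1) s.
  exact: cube_anc.
have h0 (s : T) : ~ cube (up k y) s -> h s = 0.
  move=> ns; rewrite /h !indicE !memNset ?mul0r ?mulr0 ?subr0//.
    by move=> /sub; rewrite -yzE.
  by move=> /sub.
have hi : itg h = 0.
  rewrite itgB; try (by apply: inteZ; exact: inte_trunc).
  rewrite (itgZ _ (inte_trunc lv _ m)) (itgZ _ (inte_trunc lv _ m)).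
  by rewrite -/(V y) -/(V z) mulrC subrr.
have p0 (s : T) : cube (anc r (up k y)) s -> w1 s = 0.
  move=> hs; rewrite /w1 indicE memNset ?mul0r// => hx.
  apply: (up_sep xy); apply: (@cube_inj R _ _ _ s) => //.
    by apply: cube_anc; exact: sub.
  by rewrite !level_anc.
have := localized hN (band_pair_sym bp) h2 h0 hi (u2 (cx x)) p0.
rewrite (bp_adj (band_pair_sym bp) h2 (u2 _)).
have Sw2 := bp_L2 bp (u2 (cx x)).
rewrite (ipBl (L2rZ _ (v2 _)) (L2rZ _ (v2 _)) Sw2).
rewrite (ipZl _ (v2 _) Sw2) (ipZl _ (v2 _) Sw2) !(ipC mu _ (S w1)).
move=> /eqP; rewrite subr_eq0 => /eqP e1.
by rewrite /entry (mulrC _ (V z)) (mulrC _ (V y)).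
Qed.

Lemma entry_u0 x y : U x = 0 -> entry x y = 0.
Proof.
move=> h; apply: null_pair; [exact: u2|exact: v2|exact: wmass_trunc_null].
Qed.

Lemma entry_v0 x y : V y = 0 -> entry x y = 0.
Proof.
move=> h; rewrite /entry ipC ip_null//; first exact: (bp_L2 bp (u2 _)).
exact: wmass_trunc_null.
Qed.

End full.

End form.

(** * The estimate for step functions on leaves *)

Section bounds.
Variables (R : realType) (N : nat).
Hypothesis hN : (0 < N)%N.
Local Notation mu := (lebesgue R N).
Local Notation T := (Rn R N).
Local Notation itg := (itg mu).
Local Notation inte := (inte mu).
Local Notation ip := (ip mu).
Local Notation nrm := (nrm mu).
Local Notation L2r := (L2r mu).
Implicit Types (Q P A B : dyadic N).
Local Notation "1[ Q ]" := (\1_(cube Q) : T -> R) (at level 0, format "1[ Q ]").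

(** The constant of [discrete_two_weight] for the constant 4 C + 2 of
[weak_form] and [test_form], with [card_rep] and [card_top] giving the number
of classes. *)
Definition Bform r (C : R) : R :=
  (4 * C + 2) * (4 + 2 * (r%:R + 1) * (2 ^ (r.+1 * N))%N%:R).

Section leaves.
Variables (M l : nat).
Local Notation X := (leaf N M l).
Local Notation cx := (@leaf_cube N M l).
Local Notation L := (M + l)%N.
Local Notation nX := (#|{: X}|%:R : R).

Lemma class_case k (q : X) : (exists x0, q = rep k x0) \/ (forall x, (rep k x == q) = false).
Proof.
have [[x0 e]|ne] := pselect (exists x0, q = rep k x0); first by left; exists x0.
by right => x; apply/eqP => e; apply: ne; exists x.
Qed.

Section form_bound.
Variables (r : nat) (K C : R) (S S' : (T -> R) -> T -> R) (u v : T -> R).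
Variables (n m : nat) (e rho : R).
Hypothesis td : testing_data r K C S S' u v.
Hypotheses (n0 : (0 < n)%N) (m0 : (0 < m)%N) (e0 : 0 <= e) (rho0 : 0 < rho).
Hypotheses (tsu : tail_small M l S u v n e) (tsv : tail_small M l S' v u m e).
Hypotheses (mku : mass_ok M l u n) (mkv : mass_ok M l v m).
Hypotheses (fku : floor_ok M l u rho) (fkv : floor_ok M l v rho).
Hypothesis small : (nX + 2) * (nX ^+ 2 * e) <= rho.

Let bp := td_bp td.
Let lu := td_u td.
Let lv := td_v td.

Lemma form_bound (f g : X -> R) :
  `|ip (S (fun y => stepf f y * trunc u n y)) (fun y => stepf g y * trunc v m y)|
  <= Bform r C * (Num.sqrt (\sum_x wmass (trunc u n) (cx x) * f x ^+ 2) *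
                  Num.sqrt (\sum_x wmass (trunc v m) (cx x) * g x ^+ 2)).
Proof.
have td' := testing_data_sym td; have C0 := td_C td.
have u2 Q := L2r_trunc lu Q n; have v2 Q := L2r_trunc lv Q m.
pose t (x y : X) := entry S u v n m x y.
have stE (w : T -> R) nn (h : X -> R) : (fun y => stepf h y * trunc w nn y) =
    fun y => \sum_x h x * (1[cx x] y * trunc w nn y).
  apply/funext => y; rewrite /stepf mulr_suml; apply: eq_bigr => x _; ring.
have -> : ip (S (fun y => stepf f y * trunc u n y))
    (fun y => stepf g y * trunc v m y) = bil t f g.
  rewrite !stE (ipS_sum (td_bp td)); last 2 first.
  - by move=> x _; exact: L2rZ.
  - by apply: L2r_sum => y _; exact: L2rZ.
  apply: eq_bigr => x _.
  have Sx := bp_L2 bp (L2rZ (f x) (u2 (cx x))).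
  rewrite ip_sumr//; last by move=> y _; exact: L2rZ.
  apply: eq_bigr => y _; rewrite ipZr// (ipSZ _ bp)// /t /entry; ring.
have tC (x y : X) : entry S' v u m n y x = t x y.
  by rewrite /t /entry (bp_adj bp)// ipC.
have c0 : 0 < 4 * C + 2 by lra.
have U0 (w : T -> R) nn : lweight w -> forall x, 0 <= wmass (trunc w nn) (cx x).
  move=> lw x; apply: itg_ge0 => y.
  by rewrite mulr_ge0 ?ind_ge0 ?(trunc_ge0 lw).
apply: (@discrete_two_weight R X (@rep N M l) (@repS N M l) (@rep_id N M l)
  (@rep0 N M l) r (2 ^ (r.+1 * N)) L (4 * C + 2)
  (fun x => wmass (trunc u n) (cx x)) (fun x => wmass (trunc v m) (cx x))
  t f g c0 (U0 u n lu) (U0 v m lv)).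
- by move=> x y; exact: (entry_u0 m td).
- by move=> x y; exact: (entry_v0 n td).
- move=> k1 k2 q1 q2 k12 k21.
  have z0 : 0 <= (4 * C + 2) * (Num.sqrt
      (mass (@rep N M l) (fun x => wmass (trunc u n) (cx x)) k1 q1) *
      Num.sqrt (mass (@rep N M l) (fun x => wmass (trunc v m) (cx x)) k2 q2)).
    by rewrite !mulr_ge0 ?sqrtr_ge0// ltW.
  have [[x1 e1]|ne] := class_case k1 q1; last by rewrite big_pred0// normr0.
  have [[x2 e2]|ne] := class_case k2 q2; last first.
    by rewrite big1 ?normr0// => x _; rewrite big_pred0.
  rewrite e1 e2 (wmass_class _ _ _ lu) (wmass_class _ _ _ lv).
  exact: (weak_form td n0 m0 e0 rho0 tsu tsv mku mkv fku fkv small x1 x2 k12 k21).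
- move=> k q h.
  have [[x1 e1]|ne] := class_case k q; last first.
    by rewrite big_pred0// normr0 !mulr_ge0 ?sqrtr_ge0// ltW.
  rewrite e1 (wmass_class _ _ _ lu).
  exact: (test_form td n0 m0 e0 rho0 tsu mku fku fkv small k x1 h).
- move=> k q h.
  have [[x1 e1]|ne] := class_case k q; last first.
    by rewrite big_pred0// normr0 !mulr_ge0 ?sqrtr_ge0// ltW.
  rewrite e1 (wmass_class _ _ _ lv).
  have := test_form td' m0 n0 e0 rho0 tsv mkv fkv fku small k x1 h.
  rewrite exchange_big /= [X in _ * X]mulrC.
  by under eq_bigr do under eq_bigr do rewrite tC.
- by move=> k x y z; exact: (kernel_form hN n m td).
- move=> k x y z yz xy; rewrite -!tC.
  exact: (kernel_form hN m n td' yz xy).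
- move=> k j q kj jk; apply: leq_trans (card_rep _ kj) _.
  by rewrite leq_exp2l// leq_mul2r; apply/orP; right; lia.
- apply: leq_trans (card_top N M l) _.
  by rewrite leq_exp2l// leq_pmull.
Qed.

End form_bound.

Lemma positive_floor (I : finType) (a : I -> R) : (forall i, 0 <= a i) ->
  exists2 rho, 0 < rho & forall i, a i = 0 \/ rho <= a i.
Proof.
move=> a0; exists (\big[Order.min/1]_(i | a i != 0) a i).
  elim/big_ind: _ => // [x y x0 y0|i ai]; first by rewrite lt_min x0.
  by rewrite lt_neqAle eq_sym ai a0.
move=> i; have [->|ai] := eqVneq (a i) 0; first by left.
by right; exact: bigmin_le_cond.
Qed.

(** [leaf_tail] for finitely many pairs of leaves. *)
Lemma near_tail_small r K C (S S' : (T -> R) -> T -> R) u v e : testing_data r K C S S' u v -> 0 < e ->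
  \forall n \near \oo, tail_small M l S u v n e.
Proof.
move=> td e0.
have : \forall n \near \oo, forall p : X * X, good u (cx p.1) ->
    forall g, sub_reading v (cx p.2) g ->
    `|ip (S (fun y => 1[cx p.1] y * tail u n y)) g| <= e.
  apply: filter_forall => -[x x'] /=.
  have [gx|nx] := pselect (good u (cx x)); last by apply: nearW => n /nx.
  have [n0 h] := leaf_tail hN x' td gx e0.
  by exists n0 => // n /= n0n _; exact: h.
by apply: filterS => n h x x'; exact: (h (x, x')).
Qed.

Lemma near_mass_ok (u : T -> R) : lweight u ->
  \forall n \near \oo, mass_ok M l u n.
Proof.
move=> lu.
have : \forall n \near \oo, forall p : 'I_L.+1 * X,
    wmass u (up p.1 p.2) <= 4 * wmass (trunc u n) (up p.1 p.2).
  apply: filter_forall => -[k x] /=; set Q := up k x.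
  have W0 := wmass_ge0 lu Q.
  have Wn n : 0 <= wmass (trunc u n) Q.
    by apply: itg_ge0 => y; rewrite mulr_ge0 ?ind_ge0 ?(trunc_ge0 lu).
  have [->|Wne] := eqVneq (wmass u Q) 0.
    by apply: nearW => n; rewrite mulr_ge0.
  have Wp : 0 < wmass u Q / 2 by rewrite divr_gt0// lt_neqAle eq_sym Wne.
  have /cvgrPdist_lt/(_ _ Wp) := @wmass_trunc_cvg _ _ _ lu Q.
  apply: filterS => n; rewrite ltr_norml => /andP[_ h].
  by have := Wn n; lra.
apply: filterS => n h k x.
have kL : (minn k L < L.+1)%N by rewrite ltnS geq_minr.
have := h (Ordinal kL, x); rewrite /up /=.
by rewrite -minnA minnn.
Qed.

End leaves.
End bounds.

(** * Step functions tested against arbitrary functions *)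

Section step.
Variables (R : realType) (N : nat).
Hypothesis hN : (0 < N)%N.
Local Notation mu := (lebesgue R N).
Local Notation T := (Rn R N).
Local Notation itg := (itg mu).
Local Notation inte := (inte mu).
Local Notation ip := (ip mu).
Local Notation nrm := (nrm mu).
Local Notation L2r := (L2r mu).
Implicit Types (Q P A B : dyadic N).
Local Notation "1[ Q ]" := (\1_(cube Q) : T -> R) (at level 0, format "1[ Q ]").

Variables (M l r : nat).
Local Notation Bform := (@Bform R N).
Local Notation X := (leaf N M (l + r)).
Local Notation Y := (leaf N M l).
Local Notation nX := (#|{: X}|%:R : R).

Lemma block_exists (z : X) : exists p : Y, leaf_cube p = up r z.
Proof.
have hc := cube_corner R (leaf_cube z).
have [p hp] := box_leaf_cube l (leaf_cube_box hc); exists p.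
rewrite /up (_ : minn r (M + (l + r)) = r); last by lia.
rewrite -hp (lat_anc l r); congr anc.
by have /cubeP := hc => {2}<-.
Qed.

(** [f] is a step function on the coarse cubes [Y], called blocks, whereas the
matrix lives on the leaves [X], r generations below: what happens inside a
leaf does not leave its block. *)
Definition block (z : X) : Y := sval (cid (block_exists z)).

Lemma blockP z : leaf_cube (block z) = up r z.
Proof. by rewrite /block; case: cid. Qed.

Lemma block_anc z : leaf_cube (block z) = anc r (leaf_cube z).
Proof. by rewrite blockP /up (_ : minn r (M + (l + r)) = r)//; lia. Qed.

Lemma block_sum (p : Y) (f : T -> R) y : 1[leaf_cube p] y * f y =
  \sum_(z : X | block z == p) 1[leaf_cube z] y * f y.
Proof.
have [z0 hz] := leaf_refine R hN r p.
rewrite -hz (class_split r z0); apply: eq_bigl => z.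
rewrite rep_eq -blockP hz; apply/eqP/eqP => [|->//]; exact: leaf_cube_inj.
Qed.

Section estimate.
Variables (K C : R) (S S' : (T -> R) -> T -> R) (u v : T -> R).
Hypothesis td : testing_data r K C S S' u v.
Let bp := td_bp td.
Let lu := td_u td.
Let lv := td_v td.
Variable f : Y -> R.

(** A function equal to [u] where this is square integrable and truncated
elsewhere, so that [mixed n p] is a reading of [u] on [p]. Truncating
everywhere would not do, as the testing conditions do not cover truncations on
good blocks. *)
Definition mixed n (p : Y) : T -> R := fun y =>
  1[leaf_cube p] y * (if `[< good u (leaf_cube p) >] then u y else trunc u n y).

Definition mixed_step n : T -> R := fun y => \sum_p f p * mixed n p y.

Lemma mixed_reading n p : (0 < n)%N -> real_reading u (leaf_cube p) (mixed n p).
Proof. by move=> n0; rewrite /mixed; case: asboolP => gp; [left|right; split => //; exists n]. Qed.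

Let fnorm := Num.sqrt (\sum_p wmass u (leaf_cube p) * f p ^+ 2).

Section pairing.
Variables (n m : nat) (e rho dl : R).
Hypotheses (n0 : (0 < n)%N) (m0 : (0 < m)%N) (e0 : 0 <= e) (rho0 : 0 < rho).
Hypotheses (tsu : tail_small M (l + r) S u v n e).
Hypotheses (tsv : tail_small M (l + r) S' v u m e).
Hypotheses (mku : mass_ok M (l + r) u n) (mkv : mass_ok M (l + r) v m).
Hypotheses (fku : floor_ok M (l + r) u rho) (fkv : floor_ok M (l + r) v rho).
Hypothesis small : (nX + 2) * (nX ^+ 2 * e) <= rho.
Hypothesis small3 : (\sum_p `|f p|) * (nX * (nX ^+ 2 * e)) <= dl * Num.sqrt rho.
Variable h : T -> R.
Hypothesis h2 : L2r h.
Local Notation vm := (trunc v m).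
Local Notation cx := (@leaf_cube N M (l + r)).

(* mass, first moment, mean, second moment and variance of h on a leaf, for
   the weight v truncated at m *)
Let V (z : X) := wmass vm (cx z).
Let I (z : X) := itg (fun y => 1[cx z] y * (h y * vm y)).
Let h0 (z : X) := I z / V z.
Let J (z : X) := itg (fun y => 1[cx z] y * (h y ^+ 2 * vm y)).
Let E (z : X) := itg (fun y => 1[cx z] y * ((h y - h0 z) ^+ 2 * vm y)).

Let v2 Q := L2r_trunc lv Q m.
Let vm0 y : 0 <= vm y. Proof. exact: trunc_ge0. Qed.

Lemma L2_hv : L2r (fun y => h y * vm y).
Proof.
apply: (L2r_le _ (L2rZ m%:R h2)).
  by apply: measurable_funM; [exact: L2rM h2|exact: measurable_trunc].
move=> y; rewrite mulrC !normrM; apply: ler_wpM2r => //.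
by rewrite !ger0_norm// trunc_len.
Qed.

Lemma inte_h2v : inte (fun y => h y ^+ 2 * vm y).
Proof.
by under eq_fun do rewrite expr2 -mulrA; apply: L2r_inte => //; exact: L2_hv.
Qed.

Lemma V_ge0 z : 0 <= V z.
Proof. by apply: itg_ge0 => y; rewrite mulr_ge0 ?ind_ge0. Qed.

Lemma Vh0 z : V z * h0 z = I z.
Proof.
rewrite /h0; have [VE|Vn] := eqVneq (V z) 0; last by rewrite mulrC divfK.
rewrite VE mul0r; have := ip_null (v2 (cx z)) h2 (wmass_trunc_null lv VE).
by rewrite /I => <-; apply: eq_itg => y; ring.
Qed.

Lemma leaf_variance z : E z = J z - V z * h0 z ^+ 2.
Proof.
have iJ : inte (fun y => 1[cx z] y * (h y ^+ 2 * vm y)).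
  by apply: inte_ind; [exact: measurable_cube|exact: inte_h2v].
have iI : inte (fun y => 1[cx z] y * (h y * vm y)) by apply: inte_cubeM; exact: L2_hv.
have iV : inte (fun y => 1[cx z] y * vm y) by exact: inte_trunc.
have -> : E z = J z - 2 * h0 z * I z + h0 z ^+ 2 * V z.
  rewrite /J /I /V /wmass -!itgZ// -itgB//; last exact: inteZ.
  rewrite -itgD; [|by apply: inteB => //; exact: inteZ|exact: inteZ].
  by apply: eq_itg => y; ring.
rewrite -Vh0; ring.
Qed.

Lemma E_ge0 z : 0 <= E z.
Proof.
by apply: itg_ge0 => y; rewrite mulr_ge0 ?ind_ge0// mulr_ge0 ?sqr_ge0.
Qed.

Let H2 := itg (fun y => \1_(box M) y * (h y ^+ 2 * vm y)).

Lemma box_split (g : T -> R) y :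
  \1_(box M) y * g y = \sum_(z : X) 1[cx z] y * g y.
Proof. by rewrite (ind_box M (l + r)) mulr_suml. Qed.

Lemma box_energy_leaves : H2 = \sum_z J z.
Proof.
rewrite /H2 (eq_itg mu (box_split _)).
rewrite itg_sum// => z _.
by apply: inte_ind; [exact: measurable_cube|exact: inte_h2v].
Qed.

Lemma sumE_le : \sum_z E z <= H2.
Proof.
rewrite box_energy_leaves; apply: ler_sum => z _; rewrite leaf_variance lerBlDr lerDl.
by rewrite mulr_ge0 ?V_ge0 ?sqr_ge0.
Qed.

Lemma sumV_le : \sum_z V z * h0 z ^+ 2 <= H2.
Proof.
rewrite box_energy_leaves; apply: ler_sum => z _; have := E_ge0 z; rewrite leaf_variance; lra.
Qed.

Let rest z y := 1[cx z] y * (h y * vm y) - h0 z * (1[cx z] y * vm y).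

Lemma L2r_rest z : L2r (rest z).
Proof.
apply: L2rB; last by apply: L2rZ; exact: v2.
by apply: L2r_ind; [exact: measurable_cube|exact: L2_hv].
Qed.

Lemma L2r_mixed p : L2r (mixed n p).
Proof. by have [] := sub_readingP lu (real_reading_sub (mixed_reading p n0)). Qed.

(** [rest z] is h v_m on the leaf [z] minus a multiple of v_m that makes its
mean zero, so it only interacts with the block of [z]. *)
Lemma rest_local p z : block z != p -> ip (S (mixed n p)) (rest z) = 0.
Proof.
move=> zp; have r2 := L2r_rest z; have m2 := L2r_mixed p.
have rz (y : T) : ~ cube (cx z) y -> rest z y = 0.
  by move=> ny; rewrite /rest indicE memNset// !mul0r mulr0 subr0.
have ri : itg (rest z) = 0.
  rewrite itgB; [|by apply: inte_cubeM; exact: L2_hv|by apply: inteZ; exact: inte_trunc].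
  rewrite itgZ; last exact: inte_trunc.
  by rewrite -/(I z) -/(V z) -Vh0 mulrC subrr.
have pz (y : T) : cube (anc r (cx z)) y -> mixed n p y = 0.
  move=> hy; rewrite /mixed indicE memNset ?mul0r// => hp.
  move/eqP: zp; apply; apply: leaf_cube_inj; rewrite -block_anc in hy.
  exact: cube_inj hy hp _.
have := localized hN (band_pair_sym bp) r2 rz ri m2 pz.
by rewrite (bp_adj (band_pair_sym bp))// ipC.
Qed.

Lemma rest_sum p y : \sum_(z : X | block z == p) rest z y =
  1[leaf_cube p] y * ((h y - stepf h0 y) * vm y).
Proof.
rewrite (block_sum p (fun y => (h y - stepf h0 y) * vm y)); apply: eq_bigr => z _.
have := stepf_leaf h0 z y; rewrite /rest => e'.
rewrite mulrBl mulrBr; congr (_ - _).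
by rewrite mulrA -e'; ring.
Qed.

(** By [rest_local] only the diagonal blocks remain, on each of which the
testing condition applies to the reading [mixed n p]. *)
Lemma mean_zero_part_bound : `|ip (S (mixed_step n)) (fun y => \sum_z rest z y)| <=
  Num.sqrt C * fnorm * Num.sqrt H2.
Proof.
have C0 := td_C td.
have m2 (p : Y) := L2r_mixed p.
have Sm (p : Y) := bp_L2 bp (m2 p).
have r2 := L2r_rest.
pose G (p : Y) (y : T) := 1[leaf_cube p] y * ((h y - stepf h0 y) * vm y).
have GE (p : Y) : G p = fun y => \sum_(z : X | block z == p) rest z y.
  by apply/funext => y; rewrite rest_sum.
have G2 (p : Y) : L2r (G p) by rewrite GE; apply: L2r_sum => z _; exact: r2.
have -> : ip (S (mixed_step n)) (fun y => \sum_z rest z y) =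
    \sum_p f p * ip (S (mixed n p)) (G p).
  rewrite (ipS_sum bp); last 2 first.
  - by move=> p _; exact: L2rZ.
  - by apply: L2r_sum => z _; exact: r2.
  apply: eq_bigr => p _; rewrite (ipSZ _ bp)//; last first.
    by apply: L2r_sum => z _; exact: r2.
  congr (_ * _); rewrite GE !ip_sumr//.
  rewrite (bigID (fun z => block z == p))/= [X in _ + X]big1 ?addr0//.
  by move=> z zp; exact: rest_local.
have mH : measurable_fun setT (fun y => h y - stepf h0 y).
  by apply: measurable_funB; [exact: L2rM h2|exact: L2rM (L2r_stepf _)].
have stepE (z : X) (y : T) : 1[cx z] y * ((h y - stepf h0 y) ^+ 2 * vm y) =
    1[cx z] y * ((h y - h0 z) ^+ 2 * vm y).
  have := stepf_leaf h0 z y; rewrite !indicE; case: (_ \in _) => /=.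
    by rewrite !mulr1 => ->.
  by rewrite !mul0r.
have iE (z : X) : inte (fun y => 1[cx z] y * ((h y - h0 z) ^+ 2 * vm y)).
  have iJ : inte (fun y => 1[cx z] y * (h y ^+ 2 * vm y)).
    by apply: inte_ind; [exact: measurable_cube|exact: inte_h2v].
  have iI : inte (fun y => 1[cx z] y * (h y * vm y)) by apply: inte_cubeM; exact: L2_hv.
  have iV : inte (fun y => 1[cx z] y * vm y) by exact: inte_trunc.
  rewrite (_ : (fun y => _) = fun y => 1[cx z] y * (h y ^+ 2 * vm y) -
    (2 * h0 z) * (1[cx z] y * (h y * vm y)) + h0 z ^+ 2 * (1[cx z] y * vm y)).
    by apply: inteD; [apply: inteB => //; exact: inteZ|exact: inteZ].
  by apply/funext => y; ring.
have blockE (p : Y) (y : T) : 1[leaf_cube p] y * ((h y - stepf h0 y) ^+ 2 * vm y) =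
    \sum_(z : X | block z == p) 1[cx z] y * ((h y - h0 z) ^+ 2 * vm y).
  rewrite (block_sum p (fun y => (h y - stepf h0 y) ^+ 2 * vm y)).
  by apply: eq_bigr => z _; rewrite stepE.
have iH (p : Y) : inte (fun y => 1[leaf_cube p] y * ((h y - stepf h0 y) ^+ 2 * vm y)).
  by under eq_fun do rewrite blockE; apply: inte_sum => z _; exact: iE.
have each (p : Y) : `|ip (S (mixed n p)) (G p)| <=
    Num.sqrt (C * wmass u (leaf_cube p)) *
    Num.sqrt (\sum_(z : X | block z == p) E z).
  have := test_pair td (mixed_reading p n0) mH (iH p).
  rewrite (_ : itg (fun y => 1[leaf_cube p] y *
    ((h y - stepf h0 y) ^+ 2 * vm y)) = \sum_(z : X | block z == p) E z)//.
  by rewrite (eq_itg mu (blockE p)) itg_sum.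
have W0 (p : Y) : 0 <= wmass u (leaf_cube p) by exact: wmass_ge0.
apply: le_trans (ler_norm_sum _ _ _) _.
apply: (@le_trans _ _ (\sum_p Num.sqrt C *
   (Num.sqrt (wmass u (leaf_cube p) * f p ^+ 2) *
    Num.sqrt (\sum_(z : X | block z == p) E z)))).
  apply: ler_sum => p _; rewrite normrM.
  apply: le_trans (ler_wpM2l (normr_ge0 _) (each p)) _.
  rewrite (sqrtrM _ C0) (sqrtrM _ (W0 p)) sqrtr_sqr le_eqVlt; apply/orP; left; apply/eqP; ring.
rewrite -mulr_sumr -mulrA; apply: ler_wpM2l; first exact: sqrtr_ge0.
apply: le_trans (sum_sqrt_CS _ _) _.
- by move=> p _; rewrite mulr_ge0 ?sqr_ge0.
- by move=> p _; apply: sumr_ge0 => z _; exact: E_ge0.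
apply: ler_wpM2l; first exact: sqrtr_ge0.
rewrite ler_wsqrtr//; apply: le_trans sumE_le.
by rewrite [leRHS](partition_big block predT).
Qed.

Let fX (z : X) := f (block z).

Lemma stepf_block y : stepf fX y = \sum_p f p * 1[leaf_cube p] y.
Proof.
rewrite /stepf (partition_big block predT)//=; apply: eq_bigr => p _.
have := block_sum p (fun=> 1) y; rewrite mulr1 => ->.
by rewrite mulr_sumr; apply: eq_bigr => z /eqP <-; rewrite mulr1.
Qed.

Lemma truncated_part_bound : `|ip (S (fun y => stepf fX y * trunc u n y))
   (fun y => stepf h0 y * vm y)| <= Bform r C * fnorm * Num.sqrt H2.
Proof.
have C0 := td_C td.
have B0 : 0 <= Bform r C by rewrite /Bform !mulr_ge0 ?addr_ge0 ?mulr_ge0 ?addr_ge0.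
apply: le_trans (form_bound hN td n0 m0 e0 rho0 tsu tsv mku mkv fku fkv small _ _) _.
rewrite -mulrA; apply: ler_wpM2l => //.
apply: ler_pM; rewrite ?sqrtr_ge0// ler_wsqrtr//; last exact: sumV_le.
rewrite (partition_big block predT)//=; apply: ler_sum => p _.
rewrite (_ : \sum_(z : X | block z == p) _ = wmass (trunc u n) (leaf_cube p) * f p ^+ 2).
  by apply: ler_wpM2r; rewrite ?sqr_ge0// wmass_trunc_le.
rewrite {2}/wmass (eq_itg mu (block_sum p _)).
rewrite itg_sum; last by move=> z _; exact: inte_trunc.
by rewrite mulr_suml; apply: eq_bigr => z /eqP <-.
Qed.

Let D y := \sum_(p | `[< good u (leaf_cube p) >]) f p * (1[leaf_cube p] y * tail u n y).

Lemma L2r_tail_part : L2r D.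
Proof. by apply: L2r_sum => p /asboolP gp; apply: L2rZ; exact: L2r_tail. Qed.

Lemma stepf_vm : (fun y => stepf h0 y * vm y) =
  fun y => \sum_z h0 z * (1[cx z] y * vm y).
Proof.
by apply/funext => y; rewrite /stepf mulr_suml; apply: eq_bigr => z _; ring.
Qed.

(** On good blocks [mixed] exceeds the truncation by a tail, whose image is
small when paired with any leaf. *)
Lemma tail_part_bound : `|ip (S D) (fun y => stepf h0 y * vm y)| <= dl * Num.sqrt H2.
Proof.
have sr0 : 0 < Num.sqrt rho by rewrite sqrtr_gt0.
have E0 : 0 <= nX ^+ 2 * e by rewrite mulr_ge0 ?sqr_ge0.
have H20 : 0 <= H2 by apply: itg_ge0 => y; rewrite mulr_ge0 ?ind_ge0// mulr_ge0 ?sqr_ge0.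
have vz2 z : L2r (fun y => h0 z * (1[cx z] y * vm y)) by apply: L2rZ; exact: v2.
rewrite (ipS_sum bp); last 2 first.
- by move=> p /asboolP gp; apply: L2rZ; exact: L2r_tail.
- by rewrite stepf_vm; apply: L2r_sum.
apply: le_trans (ler_norm_sum _ _ _) _.
apply: (@le_trans _ _ (\sum_p `|f p| * (Num.sqrt H2 / Num.sqrt rho *
    (nX * (nX ^+ 2 * e))))); last first.
  have e1 (s a b c d : R) : s * (a * b * (c * d)) = s * (c * d) * b * a by ring.
  rewrite -mulr_suml e1; apply: ler_wpM2r; first exact: sqrtr_ge0.
  by rewrite ler_pdivrMr.
rewrite [leLHS]big_mkcond; apply: ler_sum => p _.
have rhs0 : 0 <= `|f p| * (Num.sqrt H2 / Num.sqrt rho * (nX * (nX ^+ 2 * e))).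
  by rewrite !mulr_ge0 ?sqrtr_ge0// invr_ge0 ltW.
case: asboolP => gp //.
have t2 : L2r (fun y => 1[leaf_cube p] y * tail u n y) by exact: L2r_tail.
rewrite (ipSZ _ bp)//; last by rewrite stepf_vm; apply: L2r_sum.
rewrite normrM; apply: ler_wpM2l => //.
rewrite stepf_vm ip_sumr//; last exact: (bp_L2 bp t2).
apply: le_trans (ler_norm_sum _ _ _) _.
apply: (@le_trans _ _ (\sum_(z : X) Num.sqrt H2 / Num.sqrt rho * (nX ^+ 2 * e))).
  2: { by rewrite sumr_const -[leLHS]mulr_natl mulrCA. }
apply: ler_sum => z _.
have St := bp_L2 bp t2.
rewrite (ipZr _ St (v2 _)) normrM.
have [hV|hV] := mass_floor 0 z lv fkv m0; rewrite /up min0n /= in hV.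
  rewrite (ipC _ (S _)) (ip_null (v2 _) St (wmass_trunc_null lv hV)).
  by rewrite normr0 mulr0 mulr_ge0// divr_ge0 ?sqrtr_ge0.
apply: ler_pM => //.
  rewrite ler_pdivlMr// -(sqrtr_sqr (h0 z)) -sqrtrM ?sqr_ge0// ler_wsqrtr//.
  apply: (@le_trans _ _ (V z * h0 z ^+ 2)).
    by rewrite mulrC; apply: ler_wpM2r; rewrite ?sqr_ge0.
  apply: le_trans sumV_le; rewrite (bigD1 z)//= lerDl sumr_ge0// => z' _.
  by rewrite mulr_ge0 ?sqr_ge0 ?V_ge0.
have [z0 hz0] := leaf_refine R hN r p.
have sr : sub_reading v (up 0 z) (fun y => 1[cx z] y * vm y).
  by right; exists m => //; rewrite /up min0n.
have := class_error td e0 tsu (k1:=r) (x1:=z0) _ sr.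
by rewrite hz0; apply.
Qed.

(** [h v_m] splits into its step part and the part with mean zero on leaves,
and [mixed_step] splits into the truncated step function and tails on the good
blocks. *)
Lemma step_pairing : `|ip (S (mixed_step n)) (fun y => \1_(box M) y * (h y * vm y))|
  <= ((Bform r C + Num.sqrt C) * fnorm + dl) * Num.sqrt H2.
Proof.
have s2 : L2r (fun y => stepf h0 y * vm y).
  by rewrite stepf_vm; apply: L2r_sum => z _; apply: L2rZ; exact: v2.
have r2 : L2r (fun y => \sum_z rest z y) by apply: L2r_sum => z _; exact: L2r_rest.
have su2 : L2r (fun y => stepf fX y * trunc u n y).
  rewrite (_ : (fun y => _) = fun y => \sum_z fX z * (1[cx z] y * trunc u n y)).
    by apply: L2r_sum => z _; apply: L2rZ; exact: L2r_trunc.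
  by apply/funext => y; rewrite /stepf mulr_suml; apply: eq_bigr => z _; ring.
have M2 : L2r (mixed_step n) by apply: L2r_sum => p _; apply: L2rZ; exact: L2r_mixed.
have e1 : (fun y => \1_(box M) y * (h y * vm y)) =
    fun y => (stepf h0 y * vm y) + \sum_z rest z y.
  apply/funext => y; rewrite (box_split (fun y => h y * vm y)).
  have -> : stepf h0 y * vm y = \sum_z h0 z * (1[cx z] y * vm y).
    by have := congr1 (fun F => F y) stepf_vm.
  by rewrite -big_split; apply: eq_bigr => z _; rewrite /rest /=; ring.
have e2 : mixed_step n = fun y => stepf fX y * trunc u n y + D y.
  apply/funext => y; rewrite stepf_block /D mulr_suml.
  rewrite [X in _ + X]big_mkcond -big_split; apply: eq_bigr => p _ /=.
  by rewrite /mixed /tail; case: asboolP => _; ring.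
have S2 := bp_L2 bp M2.
rewrite e1 ipC ipDl// ipC [X in _ + X]ipC.
have -> : ip (S (mixed_step n)) (fun y => stepf h0 y * vm y) =
    ip (S (fun y => stepf fX y * trunc u n y)) (fun y => stepf h0 y * vm y) +
    ip (S D) (fun y => stepf h0 y * vm y).
  rewrite (bp_adj bp)// [in LHS]e2 (ipDl su2 L2r_tail_part); last exact: (bp_L2' bp).
  by rewrite (bp_adj bp su2 s2) (bp_adj bp L2r_tail_part s2).
apply: le_trans (ler_normD _ _) _.
apply: le_trans (lerD (ler_normD _ _) mean_zero_part_bound) _.
by have := truncated_part_bound; have := tail_part_bound; lra.
Qed.

End pairing.

(** [step_pairing] with h = S(mixed_step), so that the pairing is the square
of the norm to be estimated. The level [m] of [v] may be raised at will, which
makes the bound uniform in [m]. *)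
Theorem step_bound dl : 0 < dl -> \forall n \near \oo, forall m,
  itg (fun y => \1_(box M) y * (S (mixed_step n) y ^+ 2 * trunc v m y)) <=
  ((Bform r C + Num.sqrt C) * fnorm + dl) ^+ 2.
Proof.
move=> dl0.
have wu z : 0 <= wmass (trunc u 1) (@leaf_cube N M (l + r) z).
  by apply: itg_ge0 => y; rewrite mulr_ge0 ?ind_ge0 ?(trunc_ge0 lu).
have wv z : 0 <= wmass (trunc v 1) (@leaf_cube N M (l + r) z).
  by apply: itg_ge0 => y; rewrite mulr_ge0 ?ind_ge0 ?(trunc_ge0 lv).
have [ru ru0 hru] := positive_floor wu; have [rv rv0 hrv] := positive_floor wv.
pose rho := Num.min ru rv.
have rho0 : 0 < rho by rewrite lt_min ru0.
have fku : floor_ok M (l + r) u rho.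
  by move=> z; have [->|h] := hru z; [left|right; rewrite ge_min h].
have fkv : floor_ok M (l + r) v rho.
  by move=> z; have [->|h] := hrv z; [left|right; rewrite ge_min h orbT].
pose a1 := (nX + 2) * nX ^+ 2; pose a2 := (\sum_p `|f p|) * (nX * nX ^+ 2).
have a10 : 0 <= a1 by rewrite mulr_ge0 ?addr_ge0 ?sqr_ge0.
have a20 : 0 <= a2 by rewrite mulr_ge0 ?sumr_ge0// mulr_ge0 ?sqr_ge0.
have sr0 : 0 < Num.sqrt rho by rewrite sqrtr_gt0.
(* e is chosen for the two smallness conditions of step_pairing *)
pose e := Num.min (rho / (a1 + 1)) (dl * Num.sqrt rho / (a2 + 1)).
have e0 : 0 < e by rewrite lt_min !divr_gt0 ?mulr_gt0 ?ltr_wpDl.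
have small : (nX + 2) * (nX ^+ 2 * e) <= rho.
  rewrite mulrA -/a1; apply: (@le_trans _ _ (a1 * (rho / (a1 + 1)))).
    by apply: ler_wpM2l => //; rewrite ge_min lexx.
  by rewrite mulrA ler_pdivrMr ?ltr_wpDl// mulrC mulrDr mulr1 lerDl ltW.
have small3 : (\sum_p `|f p|) * (nX * (nX ^+ 2 * e)) <= dl * Num.sqrt rho.
  rewrite [nX * _]mulrA mulrA -/a2.
  apply: (@le_trans _ _ (a2 * (dl * Num.sqrt rho / (a2 + 1)))).
    by apply: ler_wpM2l => //; rewrite ge_min lexx orbT.
  by rewrite mulrA ler_pdivrMr ?ltr_wpDl// mulrC mulrDr mulr1 lerDl ltW// mulr_gt0.
have td' := testing_data_sym td.
near \oo => m1.
have m10 : (0 < m1)%N by near: m1; exact: nbhs_infty_gt.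
near=> n.
have n0 : (0 < n)%N by near: n; exact: nbhs_infty_gt.
have tsu : tail_small M (l + r) S u v n e by near: n; exact: (near_tail_small hN M (l + r) td e0).
have mku : mass_ok M (l + r) u n by near: n; exact: near_mass_ok.
move=> m.
pose F := mixed_step n.
have F2 : L2r F by apply: L2r_sum => p _; apply: L2rZ; exact: (L2r_mixed n0).
have SF2 := bp_L2 bp F2.
(* n may not depend on m, so m is replaced by a larger level that is high
   enough *)
have [m2 [m20 mm2 tsv mkv]] : exists m2, [/\ (0 < m2)%N, (m <= m2)%N,
    tail_small M (l + r) S' v u m2 e & mass_ok M (l + r) v m2].
  near \oo => m2; exists m2; split.
  - by near: m2; exact: nbhs_infty_gt.
  - by near: m2; exact: nbhs_infty_ge.
  - by near: m2; exact: (near_tail_small hN M (l + r) td' e0).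
  - by near: m2; exact: near_mass_ok.
have := step_pairing n0 m20 (ltW e0) rho0 tsu tsv mku mkv fku fkv small small3 SF2.
set H2 := itg (fun y => \1_(box M) y * (S F y ^+ 2 * trunc v m2 y)).
have vm0 y : 0 <= trunc v m2 y by exact: trunc_ge0.
have mb : measurable (box M : set T) by exact: measurable_box.
have H20 : 0 <= H2 by apply: itg_ge0 => y; rewrite mulr_ge0 ?ind_ge0// mulr_ge0 ?sqr_ge0.
have -> : ip (S (mixed_step n)) (fun y => \1_(box M) y * (S F y * trunc v m2 y)) = H2.
  by apply: eq_itg => y; rewrite /F; ring.
move=> h.
have hs : Num.sqrt H2 <= (Bform r C + Num.sqrt C) * fnorm + dl.
  have := sqrtr_ge0 H2; rewrite le_eqVlt => /orP[/eqP <-|s0].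
    have C0 := td_C td.
    rewrite addr_ge0 ?(ltW dl0)// mulr_ge0 ?sqrtr_ge0// addr_ge0 ?sqrtr_ge0//.
    by rewrite /Bform !mulr_ge0 ?addr_ge0 ?mulr_ge0 ?addr_ge0.
  rewrite -(ler_pM2r s0); apply: le_trans h.
  by rewrite -expr2 sqr_sqrtr// ger0_norm.
have : H2 <= ((Bform r C + Num.sqrt C) * fnorm + dl) ^+ 2.
  rewrite -[X in X <= _](sqr_sqrtr H20); apply: lerXn2r => //.
    by rewrite nnegrE sqrtr_ge0.
  by rewrite nnegrE; apply: le_trans hs; exact: sqrtr_ge0.
apply: le_trans; apply: itg_le.
- by apply: inte_ind => //; exact: (inte_h2v _ SF2).
- by apply: inte_ind => //; exact: (inte_h2v _ SF2).
- move=> y; apply: ler_wpM2l; rewrite ?ind_ge0//.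
  by apply: ler_wpM2l; rewrite ?sqr_ge0// trunc_mono.
Unshelve. all: by end_near. Qed.

End estimate.
End step.

(** * Step functions close to a bounded function *)

Section sufficiency.
Variables (R : realType) (N : nat).
Hypothesis hN : (0 < N)%N.
Local Notation mu := (lebesgue R N).
Local Notation T := (Rn R N).
Local Notation itg := (itg mu).
Local Notation inte := (inte mu).
Local Notation ip := (ip mu).
Local Notation nrm := (nrm mu).
Local Notation L2r := (L2r mu).
Local Notation Bform := (@Bform R N).
Implicit Types (Q P A B : dyadic N).
Local Notation "1[ Q ]" := (\1_(cube Q) : T -> R) (at level 0, format "1[ Q ]").

Lemma inte_bounded_sqr (w h : T -> R) m : measurable_fun setT w ->
  (forall x, 0 <= w x <= m) -> L2r h -> inte (fun x => w x * h x ^+ 2).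
Proof.
move=> mw wm [mh ih]; apply: (inte_le _ (inteZ m ih)).
  by apply: measurable_funM => //; exact: measurable_funX.
move=> x; have /andP[w0 w1] := wm x.
by rewrite ger0_norm ?(mulr_ge0 w0 (sqr_ge0 _))//; exact: ler_wpM2r (sqr_ge0 (h x)) _ _ w1.
Qed.

Section one_pair.
Variables (r : nat) (K : R) (S S' : (T -> R) -> T -> R).
Hypothesis bp : band_pair r K S S'.

(** [S] acts on representatives, so additivity only holds up to null
functions; it is read off the adjoint. *)
Lemma defect_null f g : L2r f -> L2r g ->
  let D x := S (fun y => f y + g y) x - S f x - S g x in L2r D /\ ip D D = 0.
Proof.
move=> f2 g2 D; have fg2 : L2r (fun y => f y + g y) by exact: L2rD.
have h1 := bp_L2 bp fg2; have h2 := bp_L2 bp f2; have h3 := bp_L2 bp g2.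
have D2 : L2r D by apply: L2rB => //; exact: L2rB.
have D2' := bp_L2' bp D2; split => //.
rewrite {1}/D (ipBl (L2rB h1 h2) h3 D2) (ipBl h1 h2 D2).
by rewrite !(bp_adj bp)// (ipDl f2 g2 D2'); ring.
Qed.

(** The factor 3, instead of 2, absorbs the null function of [defect_null]. *)
Lemma sqr_split f g (w : T -> R) m : L2r f -> L2r g -> measurable_fun setT w ->
  (forall x, 0 <= w x <= m) ->
  itg (fun x => w x * S (fun y => f y + g y) x ^+ 2) <=
  3 * (itg (fun x => w x * S f x ^+ 2) + itg (fun x => w x * S g x ^+ 2)).
Proof.
move=> f2 g2 mw wm; have [D2 D0] := defect_null f2 g2.
set D := fun x : T => _ in D2 D0.
have i1 := inte_bounded_sqr mw wm (bp_L2 bp f2).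
have i2 := inte_bounded_sqr mw wm (bp_L2 bp g2).
have i3 := inte_bounded_sqr mw wm (bp_L2 bp (L2rD f2 g2)).
have [_ iD] := D2.
have D0' : itg (fun x => D x ^+ 2) = 0 by rewrite -[RHS]D0; apply: eq_itg => x; rewrite expr2.
have -> : 3 * (itg (fun x => w x * S f x ^+ 2) + itg (fun x => w x * S g x ^+ 2)) =
    itg (fun x => 3 * (w x * S f x ^+ 2 + w x * S g x ^+ 2) + 3 * m * D x ^+ 2).
  rewrite itgD; [|by apply: inteZ; exact: inteD|exact: inteZ].
  by rewrite itgZ ?itgD ?itgZ ?D0' ?mulr0 ?addr0//; exact: inteD.
apply: itg_le => //.
  by apply: inteD; apply: inteZ => //; exact: inteD.
move=> x; have /andP[w0 w1] := wm x.
have -> : S (fun y => f y + g y) x = S f x + S g x + D x by rewrite /D; ring.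
apply: (@le_trans _ _ (3 * (w x * S f x ^+ 2 + w x * S g x ^+ 2) + 3 * w x * D x ^+ 2)).
  rewrite -subr_ge0; set a := S f x; set b := S g x; set e := D x.
  have -> : 3 * (w x * a ^+ 2 + w x * b ^+ 2) + 3 * w x * e ^+ 2 - w x * (a + b + e) ^+ 2 =
    w x * ((a - b) ^+ 2 + (a - e) ^+ 2 + (b - e) ^+ 2) by ring.
  by rewrite mulr_ge0// !addr_ge0 ?sqr_ge0.
by rewrite lerD2l; apply: ler_wpM2r; rewrite ?sqr_ge0// ler_wpM2l.
Qed.

End one_pair.

Section data.
Variables (r : nat) (K C : R) (S S' : (T -> R) -> T -> R) (u v : T -> R).
Hypothesis td : testing_data r K C S S' u v.
Let bp := td_bp td.
Let lu := td_u td.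
Let lv := td_v td.
Let u0 x : 0 <= u x. Proof. by case: lu. Qed.
Let mu_ : measurable_fun setT u. Proof. by case: lu. Qed.
Let Bq := Bform r C + Num.sqrt C.

Lemma weight_box M : inte (fun x => \1_(box M) x * u x).
Proof.
rewrite (_ : (fun x => _) = fun x => \sum_(p : leaf N M 0) 1[leaf_cube p] x * u x).
  by apply: inte_sum => p _; case: lu.
by apply/funext => x; rewrite (ind_box M 0) mulr_suml.
Qed.

Section approximation.
Variables (f : T -> R) (c : R) (M l : nat) (s : dyadic N -> R).
Hypotheses (mf : measurable_fun setT f) (fc : forall x, `|f x| <= c).
Hypotheses (fM : forall x, \1_(box M) x * f x = f x).
Hypothesis sc : forall Q, - c <= s Q <= c.
Local Notation Y := (leaf N M l).
Let fs (p : Y) := s (leaf_cube p).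
Let w x := \1_(box M) x * u x.
Let err := itg (fun x => `|f x - s (lat l x)| * w x).

Lemma gap_inte : inte (fun x => `|f x - s (lat l x)| * w x).
Proof.
have ms : measurable_fun setT (fun x : T => s (lat l x)) by exact: measurable_fun_step.
have iw : inte w by exact: weight_box.
apply: (inte_le _ (inteZ (2 * c) iw)).
  apply: measurable_funM; last exact: inteM iw.
  by apply: measurableT_comp => //; exact: measurable_funB.
move=> x; rewrite normrM normr_id (ger0_norm (mulr_ge0 (ind_ge0 _ x) (u0 x))).
apply: (ler_wpM2r (mulr_ge0 (ind_ge0 _ x) (u0 x))).
have := fc x; have /andP[] := sc (lat l x); rewrite !ler_norml; lra.
Qed.

Lemma step_norm : \sum_p wmass u (leaf_cube p) * fs p ^+ 2 <=
  itg (fun x => f x ^+ 2 * u x) + 2 * c * err.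
Proof.
have if2 : inte (fun x => f x ^+ 2 * u x).
  apply: (inte_le _ (inteZ (c ^+ 2) (weight_box M))).
    by apply: measurable_funM => //; exact: measurable_funX.
  move=> x; rewrite -{1}(fM x) exprMn ind_sqr -mulrA mulrCA /=.
  rewrite (ger0_norm (mulr_ge0 (sqr_ge0 _) (mulr_ge0 (ind_ge0 _ x) (u0 x)))).
  apply: (ler_wpM2r (mulr_ge0 (ind_ge0 _ x) (u0 x))).
  by rewrite -real_normK ?num_real//; apply: lerXn2r => //; rewrite nnegrE (le_trans (normr_ge0 _) (fc x)).
have ig := gap_inte.
have -> : \sum_p wmass u (leaf_cube p) * fs p ^+ 2 =
    itg (fun x => \sum_p fs p ^+ 2 * (1[leaf_cube p] x * u x)).
  rewrite itg_sum; last by move=> p _; apply: inteZ; case: lu.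
  by apply: eq_bigr => p _; rewrite itgZ ?(mulrC (_ ^+ 2))//; case: lu.
rewrite /err -(itgZ _ ig) -itgD//; last exact: inteZ.
apply: itg_le.
- by apply: inte_sum => p _; apply: inteZ; case: lu.
- by apply: inteD => //; exact: inteZ.
move=> x; have -> : \sum_p fs p ^+ 2 * (1[leaf_cube p] x * u x) = s (lat l x) ^+ 2 * w x.
  rewrite /w mulrA (step_box M l (fun Q => s Q ^+ 2)) mulr_suml.
  by apply: eq_bigr => p _; rewrite mulrA.
have -> : f x ^+ 2 * u x = f x ^+ 2 * w x.
  by rewrite /w -{1}(fM x) exprMn ind_sqr; ring.
rewrite (mulrA (2 * c)) -mulrDl; apply: (ler_wpM2r (mulr_ge0 (ind_ge0 _ x) (u0 x))).
have := fc x; have /andP[] := sc (lat l x); set a := s _; set b := f x.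
move=> h1 h2; rewrite ler_norml => /andP[h3 h4].
by have [h|h] := ger0P (b - a); nra.
Qed.

(** The error splits into the L^1(u) distance between [f] and the step
function and the tails on the blocks where [u] was truncated. *)
Lemma step_error n : (0 < n)%N ->
  let b x := f x * u x - mixed_step u fs n x in
  inte b /\ itg (fun x => `|b x|) <=
    err + \sum_p `|fs p| * itg (fun x => 1[leaf_cube p] x * tail u n x).
Proof.
move=> n0 b.
have ifu : inte (fun x => f x * u x).
  apply: (inte_le _ (inteZ c (weight_box M))).
    exact: measurable_funM.
  move=> x; rewrite -{1}(fM x) -mulrA mulrCA normrM /=.
  rewrite [X in _ * X]ger0_norm ?(mulr_ge0 (ind_ge0 _ x) (u0 x))//.
  exact: ler_wpM2r (mulr_ge0 (ind_ge0 _ x) (u0 x)) _ _ (fc x).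
have ib : inte b.
  apply: inteB => //; apply: inte_sum => p _; apply: inteZ.
  by have [] := sub_readingP lu (real_reading_sub (mixed_reading u p n0)).
have it p : inte (fun x => 1[leaf_cube p] x * tail u n x) by exact: inte_tail.
have ig := gap_inte.
split=> //; rewrite /err.
have -> : \sum_p `|fs p| * itg (fun x => 1[leaf_cube p] x * tail u n x) =
    itg (fun x => \sum_p `|fs p| * (1[leaf_cube p] x * tail u n x)).
  rewrite itg_sum; last by move=> p _; exact: inteZ.
  by apply: eq_bigr => p _; rewrite itgZ.
rewrite -itgD//; last by apply: inte_sum => p _; exact: inteZ.
apply: itg_le; first exact: inte_abs.
  by apply: inteD => //; apply: inte_sum => p _; exact: inteZ.
move=> x; have -> : `|f x - s (lat l x)| * w x =
    \sum_p 1[leaf_cube p] x * (`|f x - fs p| * u x).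
  rewrite /w mulrA (step_box M l (fun Q => `|f x - s Q|)) mulr_suml.
  by apply: eq_bigr => p _; rewrite mulrCA mulrA.
have -> : b x = \sum_p (1[leaf_cube p] x * ((f x - fs p) * u x) +
    fs p * (1[leaf_cube p] x * (if `[< good u (leaf_cube p) >] then 0 else tail u n x))).
  rewrite /b -{1}(fM x) -mulrA (ind_box M l) mulr_suml /mixed_step -sumrB.
  apply: eq_bigr => p _; rewrite /mixed /tail; case: asboolP => _; ring.
rewrite -big_split/=; apply: le_trans (ler_norm_sum _ _ _) _.
apply: ler_sum => p _; apply: le_trans (ler_normD _ _) _.
have I0 := ind_ge0 (cube (leaf_cube p)) x; have t0 := tail_ge0 u n x.
apply: lerD; rewrite !normrM (ger0_norm I0).
  by rewrite (ger0_norm (u0 x)).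
apply: ler_wpM2l => //; apply: ler_wpM2l => //.
by case: asboolP => _; rewrite ?normr0 ?(ger0_norm t0).
Qed.

End approximation.
End data.
End sufficiency.

(** * Bounded functions *)

Section sufficiency.
Variables (R : realType) (N : nat).
Hypothesis hN : (0 < N)%N.
Local Notation mu := (lebesgue R N).
Local Notation T := (Rn R N).
Local Notation itg := (itg mu).
Local Notation inte := (inte mu).
Local Notation ip := (ip mu).
Local Notation nrm := (nrm mu).
Local Notation L2r := (L2r mu).
Local Notation Bform := (@Bform R N).
Implicit Types (Q P A B : dyadic N).
Local Notation "1[ Q ]" := (\1_(cube Q) : T -> R) (at level 0, format "1[ Q ]").


Section data.
Variables (r : nat) (K C : R) (S S' : (T -> R) -> T -> R) (u v : T -> R).
Hypothesis td : testing_data r K C S S' u v.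
Let bp := td_bp td.
Let lu := td_u td.
Let lv := td_v td.
Let u0 x : 0 <= u x. Proof. by case: lu. Qed.
Let mu_ : measurable_fun setT u. Proof. by case: lu. Qed.
Let Bq := Bform r C + Num.sqrt C.

(** With F the mixed step function and b = f u - F, small in L^1: on the
exceptional set A of [weak_type] the integral is small by absolute continuity,
and off A the function S(f u) is S F + S b, where S F obeys [step_bound] and S
b is small in L^2. *)
Lemma bounded_in_box (f : T -> R) c M m : measurable_fun setT f -> (forall x, `|f x| <= c) ->
  (forall x, \1_(box M) x * f x = f x) -> L2r (fun x => f x * u x) ->
  itg (fun x => \1_(box M) x * trunc v m x * S (fun y => f y * u y) x ^+ 2) <=
  6 * Bq ^+ 2 * itg (fun x => f x ^+ 2 * u x).
Proof.
move=> mf fc fM fu2; apply/ler_addgt0Pr => eta eta0.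
have c0 : 0 <= c by exact: le_trans (normr_ge0 _) (fc (corner R (Dyadic 0 [tuple 0 | i < N]))).
pose W x := \1_(box M) x * trunc v m x.
have W0m x : 0 <= W x <= m%:R.
  rewrite /W; have /andP[i0 i1] : 0 <= (\1_(box M) x : R) <= 1.
    by rewrite indicE; case: (_ \in _); rewrite lexx ler01.
  rewrite (mulr_ge0 i0 (trunc_ge0 lv m x))/=; apply: le_trans (trunc_len v m x).
  by apply: ler_piMl => //; exact: trunc_ge0.
have mW : measurable_fun setT W.
  apply: measurable_funM; last exact: (measurable_trunc lv).
  by apply: measurable_indic; exact: measurable_box.
pose G x := W x * S (fun y => f y * u y) x ^+ 2.
have iG : inte G by exact: inte_bounded_sqr mW W0m (bp_L2 bp fu2).
rewrite -[leLHS]/(itg G).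
have G0 x : 0 <= G x by have /andP[h _] := W0m x; rewrite /G (mulr_ge0 h (sqr_ge0 _)).
have [dl dl0 hdl] := itg_abs_continuous iG (divr_gt0 eta0 (ltr0n R 4)).
pose q : R := (2 ^+ N) ^+ r.
have q0 : 0 < q by rewrite !exprn_gt0.
have K2 : 0 <= K ^+ 2 by exact: sqr_ge0.
have B2 : 0 <= Bq ^+ 2 by exact: sqr_ge0.
have N2 : 0 <= 2 ^+ N + 2 :> R by rewrite addr_ge0 ?exprn_ge0.
(* e bounds the L^1 norm of b: small enough for the measure of A to be below
   dl, and for the errors collected in Z to be below eta / 4 *)
pose Z := 6 * Bq ^+ 2 * c + 3 * m%:R * K ^+ 2 * (2 ^+ N + 2).
have Z0 : 0 <= Z.
  apply: addr_ge0; first exact: mulr_ge0 (mulr_ge0 _ B2) c0.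
  exact: mulr_ge0 (mulr_ge0 _ K2) N2.
pose e := Num.min (dl / (2 * q)) (eta / 4 / (Z + 1)).
have e0 : 0 < e by rewrite lt_min !divr_gt0 ?mulr_gt0 ?ltr_wpDl.
have eq_dl : q * e < dl.
  apply: (@le_lt_trans _ _ (q * (dl / (2 * q)))).
    by apply: ler_wpM2l; rewrite ?(ltW q0)// ge_min lexx.
  have -> : q * (dl / (2 * q)) = dl / 2 by field; rewrite gt_eqF.
  by rewrite ltr_pdivrMr// ltr_pMr// ltr1n.
have eZ : Z * e <= eta / 4.
  apply: (@le_trans _ _ (Z * (eta / 4 / (Z + 1)))).
    by apply: ler_wpM2l => //; rewrite ge_min lexx orbT.
  rewrite mulrA ler_pdivrMr ?ltr_wpDl// mulrC; apply: ler_wpM2l; first by rewrite divr_ge0 ?(ltW eta0).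
  by rewrite lerDl.
have e20 : 0 < e / 2 by rewrite divr_gt0.
have fab x : - c <= f x <= c by rewrite -ler_norml.
have w0 x : 0 <= \1_(box M) x * u x by exact: mulr_ge0 (ind_ge0 _ x) (u0 x).
have [l [s [sc hs]]] := step_approx w0 (weight_box td M) mf e20 fab.
pose fs (p : leaf N M l) := s (leaf_cube p).
pose d := Num.min 1 (eta / 24).
have d0 : 0 < d by rewrite lt_min ltr01 divr_gt0.
have d2 : 6 * d ^+ 2 <= eta / 4.
  have : d <= 1 by rewrite ge_min lexx.
  have : d <= eta / 24 by rewrite ge_min lexx orbT.
  by nra.
pose A0 := \sum_p `|fs p|.
have A00 : 0 <= A0 by rewrite sumr_ge0.
pose e' := e / 2 / (A0 + 1).
have e'0 : 0 < e' by rewrite !divr_gt0 ?ltr_wpDl.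
have [n [n0 hn tn]] : exists n, [/\ (0 < n)%N, forall m,
    itg (fun y => \1_(box M) y * (S (mixed_step u fs n) y ^+ 2 * trunc v m y)) <=
      (Bq * Num.sqrt (\sum_p wmass u (leaf_cube p) * fs p ^+ 2) + d) ^+ 2 &
    forall p : leaf N M l, itg (fun x => 1[leaf_cube p] x * tail u n x) <= e'].
  near \oo => n; exists n; split.
  - by near: n; exact: nbhs_infty_gt.
  - by near: n; exact: (step_bound hN td fs d0).
  - near: n; apply: filter_forall => p.
    have /cvgr0_norm_le /(_ _ e'0) := tail_mass_cvg lu (leaf_cube p).
    by apply: filterS => n; apply: le_trans; exact: ler_norm.
set F := mixed_step u fs n in hn *.
pose b x := f x * u x - F x.
have [ib nb] := step_error td l mf fc fM sc n0.
have nb' : itg (fun x => `|b x|) <= e.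
  apply: (le_trans nb); rewrite [leRHS](splitr e); apply: lerD; first exact: ltW.
  apply: (@le_trans _ _ (A0 * e')).
    by rewrite mulr_suml; apply: ler_sum => p _; apply: ler_wpM2l.
  rewrite /e' mulrA ler_pdivrMr ?ltr_wpDl// mulrC; apply: ler_wpM2l; first exact: ltW.
  by rewrite lerDl.
have F2 : L2r F by apply: L2r_sum => p _; apply: L2rZ; exact: (L2r_mixed td).
have b2 : L2r b by exact: L2rB.
have [A [mA muA hA]] := weak_type hN bp b2 ib ltr01 e0.
have muA' : (mu A < dl%:E)%E.
  apply: (le_lt_trans muA); rewrite lte_fin divr1; apply: le_lt_trans eq_dl.
  by apply: ler_wpM2l; rewrite ?(ltW q0).
have mCA := measurableC mA.
have GA : itg (fun x => \1_A x * G x) < eta / 4.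
  rewrite (eq_itg mu (g := fun x => \1_A x * `|G x|)); first exact: hdl.
  by move=> x; rewrite (ger0_norm (G0 x)).
have Gsplit : itg G = itg (fun x => \1_A x * G x) + itg (fun x => \1_(~` A) x * G x).
  rewrite -itgD; try exact: inte_ind.
  apply: eq_itg => x; rewrite -mulrDl !indicE in_setC.
  by case: (x \in A); rewrite /= ?addr0 ?add0r mul1r.
pose W' x := \1_(~` A) x * W x.
have I01 x : 0 <= (\1_(~` A) x : R) <= 1.
  by rewrite indicE; case: (_ \in _); rewrite lexx ler01.
have W'W x : W' x <= W x.
  by have /andP[h1 h2] := I01 x; have /andP[h3 _] := W0m x; apply: ler_piMl.
have W'0m x : 0 <= W' x <= m%:R.
  have /andP[h1 h2] := I01 x; have /andP[h3 h4] := W0m x.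
  by rewrite (mulr_ge0 h1 h3) (le_trans (W'W x)).
have mW' : measurable_fun setT W' by apply: measurable_funM => //; exact: measurable_indic.
have := sqr_split bp F2 b2 mW' W'0m.
rewrite (_ : (fun y => F y + b y) = fun y => f y * u y); last first.
  by apply/funext => y; rewrite /b addrC subrK.
have -> : itg (fun x => W' x * S (fun y => f y * u y) x ^+ 2) =
    itg (fun x => \1_(~` A) x * G x).
  by apply: eq_itg => x; rewrite /W' /G -mulrA.
have hF : itg (fun x => W' x * S F x ^+ 2) <=
    2 * Bq ^+ 2 * (itg (fun x => f x ^+ 2 * u x) + c * e) + 2 * d ^+ 2.
  apply: (@le_trans _ _ (itg (fun y => \1_(box M) y * (S F y ^+ 2 * trunc v m y)))).
    apply: itg_le; first exact: inte_bounded_sqr mW' W'0m (bp_L2 bp F2).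
      under eq_fun do rewrite (mulrC (_ ^+ 2)) mulrA.
      exact: inte_bounded_sqr mW W0m (bp_L2 bp F2).
    move=> x; rewrite (mulrC (_ ^+ 2) (trunc _ _ _)) (mulrA (\1_(box M) x)).
    exact: ler_wpM2r (sqr_ge0 _) _ _ (W'W x).
  apply: le_trans (hn m) _; set X := Num.sqrt _.
  have -> : 2 * Bq ^+ 2 * (itg (fun x => f x ^+ 2 * u x) + c * e) =
     2 * (Bq ^+ 2 * (itg (fun x => f x ^+ 2 * u x) + 2 * c * (e / 2))) by field.
  have hX : X ^+ 2 <= itg (fun x => f x ^+ 2 * u x) + 2 * c * (e / 2).
    rewrite sqr_sqrtr; last first.
      by apply: sumr_ge0 => p _; rewrite (mulr_ge0 (wmass_ge0 lu _) (sqr_ge0 _)).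
    apply: le_trans (step_norm td l mf fc fM sc) _.
    by rewrite lerD2l; apply: ler_wpM2l; [rewrite mulr_ge0|exact: ltW].
  have := ler_wpM2l B2 hX; have := sqr_ge0 (Bq * X - d); rewrite -exprMn => h1 h2.
  have -> : (Bq * X + d) ^+ 2 = 2 * (Bq * X) ^+ 2 + 2 * d ^+ 2 - (Bq * X - d) ^+ 2 by ring.
  lra.
have hb : itg (fun x => W' x * S b x ^+ 2) <= m%:R * K ^+ 2 * ((2 ^+ N + 2) * e).
  apply: (@le_trans _ _ (itg (fun x => m%:R * (\1_(~` A) x * S b x ^+ 2)))).
    apply: itg_le; first exact: inte_bounded_sqr mW' W'0m (bp_L2 bp b2).
      by apply: inteZ; apply: inte_ind => //; case: (bp_L2 bp b2).
    move=> x; rewrite (mulrA m%:R); apply: ler_wpM2r; first exact: sqr_ge0.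
    have /andP[h1 _] := I01 x; have /andP[_ h2] := W0m x.
    by rewrite [leRHS]mulrC /W'; exact: ler_wpM2l.
  rewrite itgZ; last by apply: inte_ind => //; case: (bp_L2 bp b2).
  rewrite -mulrA; apply: ler_wpM2l => //; apply: (le_trans hA).
  apply: ler_wpM2l => //; rewrite mulr1.
  have h : 0 <= 2 ^+ N + 1 :> R by rewrite addr_ge0 ?exprn_ge0.
  have := ler_wpM2l h nb'; lra.
move: eZ; rewrite /Z => eZ hS; rewrite Gsplit.
move: hF hb GA d2 hS eZ; move: (Bq ^+ 2) (2 ^+ N + 2) (K ^+ 2) => B k1 k2.
move: (itg (fun x => W' x * S F x ^+ 2)) (itg (fun x => W' x * S b x ^+ 2)) => x1 x2.
move: (itg (fun x => \1_A x * G x)) (itg (fun x => \1_(~` A) x * G x)) => x3 x4.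
move: (itg _) (m%:R : R) (d ^+ 2) => I m' d'; lra.
Unshelve. all: by end_near. Qed.

End data.
End sufficiency.

(** * Square integrable functions *)

Section sufficiency.
Variables (R : realType) (N : nat).
Hypothesis hN : (0 < N)%N.
Local Notation mu := (lebesgue R N).
Local Notation T := (Rn R N).
Local Notation itg := (itg mu).
Local Notation inte := (inte mu).
Local Notation ip := (ip mu).
Local Notation nrm := (nrm mu).
Local Notation L2r := (L2r mu).
Local Notation Bform := (@Bform R N).
Implicit Types (Q P A B : dyadic N).
Local Notation "1[ Q ]" := (\1_(cube Q) : T -> R) (at level 0, format "1[ Q ]").



Section root.
Variable w : T -> R.
Hypothesis lw : lweight w.
Let w0 x : 0 <= w x. Proof. by case: lw. Qed.
Let mw : measurable_fun setT w. Proof. by case: lw. Qed.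

Lemma measurable_root : measurable_fun setT (fun x => Num.sqrt (w x)).
Proof.
rewrite (_ : (fun x => _) = (fun a : R => a `^ 2^-1) \o w).
  by apply: measurableT_comp => //; exact: measurable_powR.
by apply/funext => x /=; rewrite powR12_sqrt.
Qed.

Lemma measurable_div_root (f : T -> R) : measurable_fun setT f ->
  measurable_fun setT (fun x => f x / Num.sqrt (w x)).
Proof.
move=> mf; apply: measurable_funM => //.
rewrite (_ : (fun x => _) = (fun a : R => a `^ (- 1)) \o (fun x => Num.sqrt (w x))).
  by apply: measurableT_comp; [exact: measurable_powR|exact: measurable_root].
by apply/funext => x /=; rewrite powR_inv1// sqrtr_ge0.
Qed.

(** Where [w] vanishes both sides are zero. *)
Lemma div_rootM (a : R) x : a / Num.sqrt (w x) * w x = Num.sqrt (w x) * a.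
Proof.
have [h|h] := eqVneq (Num.sqrt (w x)) 0.
  by rewrite h invr0 mulr0 !mul0r.
by rewrite -{2}(sqr_sqrtr (w0 x)); field.
Qed.

Lemma div_root_sqr (a : R) x : (a / Num.sqrt (w x)) ^+ 2 * w x <= a ^+ 2.
Proof.
have [h|h] := eqVneq (Num.sqrt (w x)) 0.
  by rewrite h invr0 mulr0 expr0n mul0r sqr_ge0.
by rewrite le_eqVlt; apply/orP; left; apply/eqP; rewrite -{2}(sqr_sqrtr (w0 x)); field.
Qed.

End root.

(** Monotone convergence. *)
Lemma weighted_sup (v G : T -> R) c : lweight v -> L2r G ->
  (forall m, itg (fun x => trunc v m x * G x ^+ 2) <= c) ->
  (\int[mu]_x (G x ^+ 2 * v x)%:E <= c%:E)%E.
Proof.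
move=> lv G2 hc; have mS := L2rM G2.
pose g m x := (G x ^+ 2 * trunc v m x)%:E.
have g_cvg x : (g m x @[m --> \oo] --> (G x ^+ 2 * v x)%:E)%E.
  by apply: cvg_near_cst; near=> m; congr (_ * _)%:E; near: m; exact: trunc_cvg.
have mg m : measurable_fun setT (g m).
  apply/measurable_EFinP; apply: measurable_funM; last exact: measurable_trunc.
  exact: measurable_funX.
have := cvg_monotone_convergence (mu := mu) measurableT mg.
have -> : (\int[mu]_x (G x ^+ 2 * v x)%:E = \int[mu]_x limn (g ^~ x))%E.
  by apply: eq_integral => x _; apply/esym/cvg_lim => //; exact: g_cvg.
move=> h.
have {h} h : (\int[mu]_x g m x)%E @[m --> \oo] --> (\int[mu]_x limn (g ^~ x))%E.
  apply: h.
  - by move=> m x _; rewrite lee_fin (mulr_ge0 (sqr_ge0 _) (trunc_ge0 lv m x)).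
  - move=> x _ m n mn; rewrite lee_fin; apply: ler_wpM2l; first exact: sqr_ge0.
    exact: trunc_mono.
rewrite -(cvg_lim _ h)//; apply: lime_le; first by apply/cvg_ex; eexists; exact: h.
apply: nearW => m.
have vm x : 0 <= trunc v m x <= m%:R by rewrite (trunc_ge0 lv) trunc_len.
have iS := inte_bounded_sqr (measurable_trunc lv m) vm G2.
rewrite -[X in (X <= _)%E](_ : (itg (fun x => trunc v m x * G x ^+ 2))%:E = _).
  by rewrite lee_fin; exact: hc.
by rewrite itg_EFin//; apply: eq_integral => x _; rewrite /g mulrC.
Unshelve. all: by end_near. Qed.

Section data.
Variables (r : nat) (K C : R) (S S' : (T -> R) -> T -> R) (u v : T -> R).
Hypothesis td : testing_data r K C S S' u v.
Let bp := td_bp td.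
Let lu := td_u td.
Let lv := td_v td.
Let u0 x : 0 <= u x. Proof. by case: lu. Qed.
Let mu_ : measurable_fun setT u. Proof. by case: lu. Qed.
Let Bq := Bform r C + Num.sqrt C.

Variable phi : T -> R.
Hypotheses (p2 : L2r phi).
Let F x := Num.sqrt (u x) * phi x.
Hypothesis F2 : L2r F.

Let f k := cutoff k (fun x => phi x / Num.sqrt (u x)).
Let fu k x := f k x * u x.
Let rest k x := F x - fu k x.

Lemma measurable_cut k : measurable_fun setT (f k).
Proof. by apply: measurable_cutoff; apply: (measurable_div_root lu); exact: L2rM p2. Qed.

Lemma fuE k x : fu k x = \1_(box k `&` [set x | `|phi x / Num.sqrt (u x)| <= k%:R]) x * F x.
Proof. by rewrite /fu /f /cutoff -mulrA div_rootM. Qed.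

Lemma L2_fu k : L2r (fu k).
Proof.
apply: (L2r_le _ F2); first by apply: measurable_funM => //; exact: measurable_cut.
by move=> x; rewrite fuE norm_ind_le.
Qed.

Lemma rest_le k x : `|rest k x| <= `|F x|.
Proof.
rewrite /rest fuE indicE; case: (_ \in _); rewrite ?mul1r ?mul0r ?subr0//.
by rewrite subrr normr0.
Qed.

Lemma L2_rest k : L2r (rest k). Proof. by apply: L2rB => //; exact: L2_fu. Qed.

Lemma rest_cvg0 : ip (rest k) (rest k) @[k --> \oo] --> (0 : R).
Proof.
have [_ iF] := F2; rewrite -[X in _ --> X](itg0 mu); apply: (itg_dominated iF).
- exact: measurable_cst.
- by move=> k; apply: measurable_funM; exact: L2rM (L2_rest k).
- move=> x; apply: cvg_near_cst; near=> k.
  have -> : rest k x = 0; last by rewrite mulr0.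
  rewrite /rest /fu (_ : f k x = phi x / Num.sqrt (u x)); first by rewrite div_rootM// subrr.
  by near: k; exact: cutoff_near.
- move=> k x; rewrite -expr2 normrX -[leRHS]real_normK ?num_real//.
  by apply: lerXn2r; rewrite ?nnegrE ?rest_le.
Unshelve. all: by end_near. Qed.

(** In the box of size 2^k the function [fu k] obeys [bounded_in_box]; the
remainder tends to zero in L^2, which is enough since [v] is truncated at [m].
*)
Lemma truncated_bound m :
  itg (fun x => trunc v m x * S F x ^+ 2) <= 18 * Bq ^+ 2 * ip phi phi.
Proof.
have vm x : 0 <= trunc v m x <= m%:R by rewrite (trunc_ge0 lv) trunc_len.
have mv := measurable_trunc lv m.
have I01 (k : nat) (x : T) : 0 <= (\1_(box k) x : R) <= 1.
  by rewrite indicE; case: (_ \in _); rewrite lexx ler01.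
pose W k x := \1_(box k) x * trunc v m x.
have Wm k x : 0 <= W k x <= m%:R.
  have /andP[h1 h2] := I01 k x; have /andP[h3 h4] := vm x.
  by rewrite (mulr_ge0 h1 h3) (le_trans _ h4)//; exact: ler_piMl.
have mW k : measurable_fun setT (W k).
  by apply: measurable_funM => //; apply: measurable_indic; exact: measurable_box.
have iS := inte_bounded_sqr mv vm (bp_L2 bp F2).
have S0 x : 0 <= trunc v m x * S F x ^+ 2.
  by have /andP[h _] := vm x; exact: mulr_ge0 h (sqr_ge0 _).
have hL : itg (fun x => W k x * S F x ^+ 2) @[k --> \oo] -->
    itg (fun x => trunc v m x * S F x ^+ 2).
  apply: itg_monotone => //.
  - by move=> k; exact: inteM (inte_bounded_sqr (mW k) (Wm k) (bp_L2 bp F2)).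
  - move=> k x; rewrite /W -mulrA; have /andP[h1 h2] := I01 k x.
    by rewrite (mulr_ge0 h1 (S0 x)) ler_piMl.
  - move=> x; apply: cvg_near_cst; near=> k.
    rewrite /W indicE mem_set ?mul1r//; near: k; exact: near_box.
have hR : 18 * Bq ^+ 2 * ip phi phi + 3 * m%:R * K ^+ 2 * ip (rest k) (rest k)
    @[k --> \oo] --> 18 * Bq ^+ 2 * ip phi phi + 3 * m%:R * K ^+ 2 * 0.
  by apply: cvgD; [exact: cvg_cst|apply: cvgM; [exact: cvg_cst|exact: rest_cvg0]].
rewrite mulr0 addr0 in hR.
apply: ler_cvg_to hL hR _; apply: nearW => k.
have r2 := L2_rest k; have fu2 := L2_fu k.
have := sqr_split bp fu2 r2 (mW k) (Wm k).
rewrite (_ : (fun y => fu k y + rest k y) = F); last first.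
  by apply/funext => x; rewrite /rest addrC subrK.
have h1 : itg (fun x => W k x * S (fu k) x ^+ 2) <= 6 * Bq ^+ 2 * ip phi phi.
  apply: le_trans (bounded_in_box hN td (c := k%:R) _ (measurable_cut k) _ _ fu2) _.
  - by move=> x; exact: cutoff_bound.
  - by move=> x; rewrite mulrC cutoff_box.
  - apply: ler_wpM2l; first by rewrite (mulr_ge0 _ (sqr_ge0 _)).
    have fle x : 0 <= f k x ^+ 2 * u x <= phi x * phi x.
      rewrite (mulr_ge0 (sqr_ge0 _) (u0 x)) -expr2.
      apply: le_trans (div_root_sqr lu (phi x) x); apply: ler_wpM2r => //.
      rewrite -real_normK ?num_real// -[leRHS]real_normK ?num_real//.
      by apply: lerXn2r; rewrite ?nnegrE// cutoff_le.
    apply: itg_le; last by move=> x; have /andP[] := fle x.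
      apply: (inte_le _ (L2r_inte p2 p2)).
        by apply: measurable_funM => //; apply: measurable_funX; exact: measurable_cut.
      by move=> x; have /andP[h1 h2] := fle x; rewrite ger0_norm.
    exact: L2r_inte.
have h2 : itg (fun x => W k x * S (rest k) x ^+ 2) <= m%:R * K ^+ 2 * ip (rest k) (rest k).
  have Sr2 := bp_L2 bp r2; have [_ iSr] := Sr2.
  apply: (@le_trans _ _ (itg (fun x => m%:R * S (rest k) x ^+ 2))).
    apply: itg_le; [exact: inte_bounded_sqr (mW k) (Wm k) Sr2|exact: inteZ|].
    by move=> x; apply: ler_wpM2r; [exact: sqr_ge0|have /andP[] := Wm k x].
  rewrite itgZ// -mulrA; apply: ler_wpM2l => //.
  have -> : itg (fun x => S (rest k) x ^+ 2) = nrm (S (rest k)) ^+ 2.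
    by rewrite nrm2; apply: eq_itg => x; rewrite expr2.
  rewrite -nrm2 -exprMn; apply: lerXn2r; rewrite ?nnegrE ?sqrtr_ge0//.
    by rewrite mulr_ge0 ?(bp_K bp) ?sqrtr_ge0.
  exact: (bp_bound bp).
move: h1 h2; move: (itg _) => x1; move: (itg _) => x2; lra.
Unshelve. all: by end_near. Qed.

Theorem real_sufficiency :
  (\int[mu]_x (S F x ^+ 2 * v x)%:E <= (18 * Bq ^+ 2 * ip phi phi)%:E)%E.
Proof. by apply: weighted_sup => //; [exact: (bp_L2 bp F2)|exact: truncated_bound]. Qed.

End data.
End sufficiency.

(** * Complex functions *)

Section dictionary.
Variables (R : realType) (N : nat).
Local Notation mu := (lebesgue R N).
Local Notation T := (Rn R N).
Local Notation itg := (itg mu).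
Local Notation inte := (inte mu).
Local Notation ip := (ip mu).
Local Notation nrm := (nrm mu).
Local Notation L2r := (L2r mu).
Local Notation C := R[i].
Implicit Types (f g : T -> C) (a b : T -> R) (Q : dyadic N).
Local Notation "1[ Q ]" := (\1_(cube Q) : T -> R) (at level 0, format "1[ Q ]").

Definition re f : T -> R := fun x => complex.Re (f x).
Definition im f : T -> R := fun x => complex.Im (f x).
Definition cst_of a : T -> C := fun x => (a x)%:C%C.

Lemma normc_sqr (z : C) : Normc.normc z ^+ 2 = complex.Re z ^+ 2 + complex.Im z ^+ 2.
Proof. by case: z => x y /=; rewrite sqr_sqrtr// addr_ge0 ?sqr_ge0. Qed.

(** The square of the L^2 norm. *)
Definition energy f : \bar R := (\int[mu]_x (Normc.normc (f x) ^+ 2)%:E)%E.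

Lemma energy_ge0 f : (0 <= energy f)%E.
Proof. by apply: integral_ge0 => x _; rewrite lee_fin sqr_ge0. Qed.

Lemma L2norm_energy f : L2norm f = sqrte (energy f).
Proof.
rewrite /L2norm unlock -poweR12_sqrt ?energy_ge0//; congr (poweR _ _).
apply: eq_integral => x _; rewrite abse_EFin poweR_EFin.
by rewrite (powR_mulrn 2)// real_normK ?num_real.
Qed.

Lemma L2norm_le f (B : R) : 0 <= B ->
  (L2norm f <= B%:E)%E <-> (energy f <= (B ^+ 2)%:E)%E.
Proof.
move=> B0; rewrite L2norm_energy; have := energy_ge0 f.
case: (energy f) => [e||] //=; rewrite !lee_fin => e0.
split=> h; first by rewrite -(sqr_sqrtr e0); apply: lerXn2r; rewrite ?nnegrE ?sqrtr_ge0.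
by rewrite -[leRHS](ger0_norm B0) -sqrtr_sqr ler_wsqrtr.
Qed.

Lemma energy_split f : cmeasurable f -> energy f =
  (\int[mu]_x (re f x ^+ 2)%:E + \int[mu]_x (im f x ^+ 2)%:E)%E.
Proof.
move=> [m1 m2]; rewrite -ge0_integralD//; last 4 first.
- by move=> x _; rewrite lee_fin sqr_ge0.
- by apply/measurable_EFinP; exact: measurable_funX.
- by move=> x _; rewrite lee_fin sqr_ge0.
- by apply/measurable_EFinP; exact: measurable_funX.
by apply: eq_integral => x _; rewrite normc_sqr EFinD.
Qed.

Lemma inte_ge0_fin a : measurable_fun setT a -> (forall x, 0 <= a x) ->
  inte a <-> (\int[mu]_x (a x)%:E < +oo)%E.
Proof.
move=> ma a0; split=> [ia|h]; first by rewrite -itg_EFin// ltry.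
have h0 : (0 <= \int[mu]_x (a x)%:E)%E by apply: integral_ge0 => x _; rewrite lee_fin.
have hf : (\int[mu]_x (a x)%:E)%E \is a fin_num by rewrite ge0_fin_numE.
have h1 : (\int[mu]_x (a x)%:E <= (fine (\int[mu]_x (a x)%:E))%:E)%E by rewrite fineK.
by have [] := inte_le_fin ma a0 h1.
Qed.

Lemma L2P f : L2 f <-> L2r (re f) /\ L2r (im f).
Proof.
have s0 b x : 0 <= b x ^+ 2 :> R by rewrite sqr_ge0.
have mX b : measurable_fun setT b -> measurable_fun setT (fun x : T => b x ^+ 2 : R).
  by move=> mb; exact: measurable_funX.
have fin (e : \bar R) : (0 <= e)%E -> (sqrte e < +oo)%E <-> (e < +oo)%E.
  by case: e => //= e _; rewrite !ltry.
rewrite /L2 L2norm_energy fin ?energy_ge0//; split.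
  move=> [mf]; have [m1 m2] := mf; rewrite energy_split// => h.
  have i0 b : (0 <= \int[mu]_x (b x ^+ 2)%:E)%E.
    by apply: integral_ge0 => x _; rewrite lee_fin.
  split; split=> //.
  - by apply/(inte_ge0_fin (mX _ m1) (s0 _)); apply: le_lt_trans h; exact: leeDl.
  - by apply/(inte_ge0_fin (mX _ m2) (s0 _)); apply: le_lt_trans h; exact: leeDr.
move=> [[m1 i1] [m2 i2]]; have mf : cmeasurable f by [].
split=> //; rewrite energy_split//; apply: lte_add_pinfty.
  by apply/(inte_ge0_fin (mX _ m1) (s0 _)).
by apply/(inte_ge0_fin (mX _ m2) (s0 _)).
Qed.

Lemma energyE f : L2 f -> energy f = (ip (re f) (re f) + ip (im f) (im f))%:E.
Proof.
move=> f2; rewrite energy_split; last by case: f2.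
by have /L2P[[_ i1] [_ i2]] := f2; rewrite -!itg_EFin// -EFinD.
Qed.

Lemma L2norm_le_mul f g (B : R) : L2 g -> 0 <= B ->
  (L2norm f <= B%:E * L2norm g)%E <->
  (energy f <= (B ^+ 2 * (ip (re g) (re g) + ip (im g) (im g)))%:E)%E.
Proof.
move=> g2 B0; have G0 : 0 <= ip (re g) (re g) + ip (im g) (im g) by rewrite addr_ge0 ?ip_ge0.
rewrite (L2norm_energy g) energyE//= -EFinM L2norm_le ?mulr_ge0 ?sqrtr_ge0//.
by rewrite exprMn sqr_sqrtr.
Qed.

Lemma im_cst a : im (cst_of a) = fun=> 0. Proof. by []. Qed.

Lemma L2_cst a : L2 (cst_of a) <-> L2r a.
Proof.
by rewrite L2P im_cst; split=> [[]//|h]; split => //; exact: L2r0.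
Qed.

Lemma inner_cstr f a : inner f (cst_of a) =
  (ip (re f) a +i* ip (im f) a)%C.
Proof.
rewrite /inner /cintegral; congr (_ +i* _)%C; apply: eq_itg => x;
  rewrite /re /im /cst_of; case: (f x) => p q /=; ring.
Qed.

Lemma inner_cstl f a : L2 f -> L2r a -> inner (cst_of a) f =
  (ip a (re f) +i* - ip a (im f))%C.
Proof.
move=> /L2P[_ f2] a2; rewrite ipE -itgN; last exact: L2r_inte.
by rewrite /inner /cintegral; congr (_ +i* _)%C; apply: eq_itg => x;
  rewrite /re /im /cst_of; case: (f x) => p q /=; ring.
Qed.

End dictionary.

(** * From weights and readings to their real counterparts *)

Section parts.
Variables (R : realType) (N : nat).
Hypothesis hN : (0 < N)%N.
Local Notation mu := (lebesgue R N).
Local Notation T := (Rn R N).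
Local Notation itg := (itg mu).
Local Notation inte := (inte mu).
Local Notation ip := (ip mu).
Local Notation nrm := (nrm mu).
Local Notation L2r := (L2r mu).
Implicit Types (a b : T -> R) (A B P Q : dyadic N).
Local Notation "1[ Q ]" := (\1_(cube Q) : T -> R) (at level 0, format "1[ Q ]").

(** The bound and the band condition for the adjoint follow from those of the
operator. *)
Lemma build_band_pair r K (S S' : (T -> R) -> T -> R) : 0 <= K ->
  (forall a, L2r a -> L2r (S a)) -> (forall a, L2r a -> L2r (S' a)) ->
  (forall a b, L2r a -> L2r b -> ip (S a) b = ip a (S' b)) ->
  (forall a, L2r a -> nrm (S a) <= K * nrm a) ->
  (forall A B, (r%:R%:E < dtree R (parent A) (parent B))%E ->
    ip (S (child_haar A)) (child_haar B) = 0) ->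
  band_pair r K S S'.
Proof.
move=> K0 S2 S2' adj bnd band; split=> //.
- move=> a a2; have s2 := S2' _ a2; have := sqrtr_ge0 (ip (S' a) (S' a)).
  rewrite -/(nrm _) le_eqVlt => /orP[/eqP <-|s0]; first by rewrite mulr_ge0 ?sqrtr_ge0.
  rewrite -(ler_pM2l s0) -expr2 nrm2 -(adj _ _ s2 a2).
  apply: le_trans (ler_norm _) _; apply: le_trans (ip_CS (S2 _ s2) a2) _.
  by rewrite mulrA (mulrC _ K); apply: ler_wpM2r; [exact: sqrtr_ge0|exact: bnd].
- move=> A B P AP BP; apply: band.
  by have [] := dtree_outside R AP BP.
- move=> A B P AP BP; rewrite ipC -adj; [|exact: L2r_child_haar|exact: L2r_child_haar].
  by apply: band; have [] := dtree_outside R AP BP.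
Qed.

Lemma child_haar_is_haar A : haar (parent A) (cst_of (child_haar A : T -> R)).
Proof.
split.
- move=> x nx; rewrite /cst_of /child_haar !indicE (memNset nx) memNset; first by rewrite mulr0 subr0.
  by move=> hx; apply: nx; exact: (cube_anc 1 hx).
- move=> S hS; have eS := child_parent hS.
  have lS : level S = level A by move/(congr1 (@level N)): eS => /=; lia.
  have [->|SA] := pselect (S = A).
    exists (2 ^+ N - 1)%:C%C => x hx; rewrite /cst_of /child_haar !indicE mem_set//.
    by rewrite mem_set ?mulr1//; exact: (cube_anc 1 hx).
  exists (- 1)%:C%C => x hx; rewrite /cst_of /child_haar !indicE memNset; last first.
    by move=> hA; apply: SA; exact: cube_inj hx hA lS.
  by rewrite mem_set ?mulr0 ?sub0r// eS; exact: (cube_anc 1 hx).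
- rewrite /cintegral !itg_restrict; congr (_ +i* _)%C; last first.
    by rewrite -[RHS](itg0 mu); apply: eq_itg => x; rewrite mulr0.
  rewrite (eq_itg mu (g := child_haar A)); last first.
    move=> x; rewrite /cst_of /child_haar /= mulrBr mulrCA -expr2 ind_sqr ind_below//.
    by exists 1%N.
  rewrite itgB; [|by apply: inteZ; exact: inte_cube|exact: inte_cube].
  by rewrite itgZ ?itg_cube ?vol_parent ?subrr//; exact: inte_cube.
Qed.

Lemma weight_lweight (w : T -> R) : weight w -> lweight w.
Proof.
move=> [w0 [mw iw]]; split=> // Q; apply/inte_ge0_fin.
- by apply: measurable_funM => //; apply: measurable_indic; exact: measurable_cube.
- by move=> x; rewrite mulr_ge0 ?ind_ge0.
rewrite -eint_restrict; have mQ : measurable (cube Q : set T) by exact: measurable_cube.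
have : mu.-integrable (cube Q) (EFin \o w).
  apply: iw => //; exists (\sum_i (`|(tnth (pos Q) i)%:~R| + 1) * side R Q) => x hx i.
  have s0 : 0 < side R Q by rewrite exprz_gt0.
  apply: (@le_trans _ _ ((`|(tnth (pos Q) i)%:~R| + 1) * side R Q)); last first.
    rewrite (bigD1 i)//= lerDl sumr_ge0// => j _.
    by rewrite mulr_ge0 ?addr_ge0 ?(ltW s0).
  have /andP[h1 h2] := hx i; move: h1 h2; move: (_%:~R : R) => z h1 h2.
  rewrite ler_norml; have := ler_norm z; have := ler_norm (- z); rewrite normrN.
  by move=> ? ?; nra.
case/integrableP => _ h; apply: le_lt_trans h.
rewrite le_eqVlt; apply/orP; left; apply/eqP; apply: eq_integral => x _.
by rewrite abse_EFin ger0_norm.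
Qed.

Lemma real_reading_readings (w : T -> R) Q a : real_reading w Q a -> readings Q w (cst_of a).
Proof.
case=> [[g ->]|[ng [n n0 ->]]]; [left|right].
  by split=> //; exact/L2_cst.
by split; [move/(@L2_cst R N (fun x => 1[Q] x * w x))|exists n].
Qed.

Lemma readings_real_reading (w : T -> R) Q f : readings Q w f -> exists2 a, real_reading w Q a & f = cst_of a.
Proof.
case=> [[/(@L2_cst R N (fun x => 1[Q] x * w x)) g ->]|[ng [n n0 ->]]].
  by exists (fun x => 1[Q] x * w x) => //; left.
exists (fun x => 1[Q] x * trunc w n x) => //; right; split; last by exists n.
by move=> g; apply: ng; exact/L2_cst.
Qed.

Lemma side_ratio r Q P : level Q <= level P + r%:Z -> level P <= level Q + r%:Z ->
  2 ^- r * side R Q <= side R P <= 2 ^+ r * side R Q.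
Proof.
move=> h1 h2; have two : (2 : R) != 0 by [].
have e (k : int) : (2 : R) ^ (k + r%:Z) = 2 ^+ r * 2 ^ k by rewrite expfzDr// mulrC.
rewrite ler_pdivrMl ?exprn_gt0// /side -!e; apply/andP; split.
  by apply: ler_weXz2l; rewrite ?ler1n.
by apply: ler_weXz2l; rewrite ?ler1n.
Qed.

End parts.

(** * Sufficiency *)

Section operator.
Variables (R : realType) (N r : nat).
Hypothesis hN : (0 < N)%N.
Local Notation mu := (lebesgue R N).
Local Notation T := (Rn R N).
Local Notation itg := (itg mu).
Local Notation inte := (inte mu).
Local Notation ip := (ip mu).
Local Notation nrm := (nrm mu).
Local Notation L2r := (L2r mu).
Implicit Types (a b : T -> R) (A B P Q : dyadic N).
Local Notation "1[ Q ]" := (\1_(cube Q) : T -> R) (at level 0, format "1[ Q ]").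

Variables Op Ad : (T -> R[i]) -> T -> R[i].
Hypotheses (hO : band_operator r Op) (hA : is_adjoint Op Ad).

Definition reO a := re (Op (cst_of a)).
Definition reA a := re (Ad (cst_of a)).
Definition imO a := im (Op (cst_of a)).
(** The inner product conjugates its second argument, so the adjoint of [imO]
carries a sign. *)
Definition imA a := fun x => - im (Ad (cst_of a)) x.

Lemma L2O a : L2r a -> L2 (Op (cst_of a)).
Proof. by move=> /L2_cst a2; case: hO => -[h _ _] _; exact: h. Qed.

Lemma L2A a : L2r a -> L2 (Ad (cst_of a)).
Proof. by move=> /L2_cst a2; case: hA => h _; exact: h. Qed.

Lemma L2_reO a : L2r a -> L2r (reO a). Proof. by move=> /L2O /L2P[]. Qed.
Lemma L2_imO a : L2r a -> L2r (imO a). Proof. by move=> /L2O /L2P[]. Qed.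
Lemma L2_reA a : L2r a -> L2r (reA a). Proof. by move=> /L2A /L2P[]. Qed.
Lemma L2_imA a : L2r a -> L2r (imA a).
Proof.
move=> /L2A /L2P[_ h]; rewrite /imA (_ : (fun x => _) = fun x => (-1) * im (Ad (cst_of a)) x).
  exact: L2rZ.
by apply/funext => x; rewrite mulN1r.
Qed.

Lemma adjoint_parts a b : L2r a -> L2r b ->
  ip (reO a) b = ip a (reA b) /\ ip (imO a) b = ip a (imA b).
Proof.
move=> a2 b2; have [_ /(_ (cst_of a) (cst_of b))] := hA.
move=> /(_ (proj2 (L2_cst a) a2) (proj2 (L2_cst b) b2)).
rewrite inner_cstr inner_cstl//; last exact: L2A.
move=> [h1 h2]; split=> //.
rewrite /imO h2 ipE -itgN; last by apply: L2r_inte => //; have /L2P[] := L2A b2.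
by apply: eq_itg => x; rewrite /imA mulrN.
Qed.

Lemma operator_bound : exists2 K : R, 0 <= K & forall a, L2r a ->
  nrm (reO a) <= K * nrm a /\ nrm (imO a) <= K * nrm a.
Proof.
have [[_ _ [K hK]] _] := hO; exists `|K| => // a a2.
have c2 : L2 (cst_of a) by exact/L2_cst.
have e0 : ip (im (cst_of a)) (im (cst_of a)) = 0.
  by rewrite -[RHS](itg0 mu); apply: eq_itg => x; rewrite mulr0.
have h : (energy (Op (cst_of a)) <=
    (`|K| ^+ 2 * (ip a a + ip (im (cst_of a)) (im (cst_of a))))%:E)%E.
  apply/(L2norm_le_mul (Op (cst_of a)) c2 (normr_ge0 K)).
  apply: le_trans (hK _ c2) _; apply: lee_wpmul2r; first exact: Lnorm_ge0.
  by rewrite lee_fin ler_norm.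
rewrite energyE in h; last exact: L2O.
move: h; rewrite lee_fin e0 addr0 -/(reO a) -/(imO a) => h.
have I1 := ip_ge0 mu (reO a); have I2 := ip_ge0 mu (imO a).
have s : Num.sqrt (`|K| ^+ 2 * ip a a) = `|K| * nrm a.
  by rewrite sqrtrM ?sqr_ge0// sqrtr_sqr normr_id.
by split; rewrite -s ler_wsqrtr//; lra.
Qed.

Lemma band_parts : exists2 K : R, band_pair r K reO reA & band_pair r K imO imA.
Proof.
have [K K0 hK] := operator_bound.
have haarO A B : (r%:R%:E < dtree R (parent A) (parent B))%E ->
    ip (reO (child_haar A)) (child_haar B) = 0 /\ ip (imO (child_haar A)) (child_haar B) = 0.
  move=> d; have [_ /(_ _ _ _ _ d (child_haar_is_haar R hN A) (child_haar_is_haar R hN B))] := hO.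
  by rewrite inner_cstr => -[h1 h2].
exists K; apply: build_band_pair => //.
- exact: L2_reO. - exact: L2_reA.
- by move=> a b a2 b2; have [] := adjoint_parts a2 b2.
- by move=> a /hK[].
- by move=> A B /haarO[].
- exact: L2_imO. - exact: L2_imA.
- by move=> a b a2 b2; have [] := adjoint_parts a2 b2.
- by move=> a /hK[].
- by move=> A B /haarO[].
Qed.

Section weights.
Variables (u v : T -> R).
Hypotheses (wu : weight u) (wv : weight v).
Let lu := weight_lweight wu.
Let lv := weight_lweight wv.

Lemma testing_part (Z : (T -> R[i]) -> T -> R[i]) (S : (T -> R) -> T -> R) (p q : T -> R) C Q g :
  weight p -> weight q ->
  testing Z p q C -> (forall a, L2r a -> L2r (S a)) ->
  (forall a x, S a x ^+ 2 <= Normc.normc (Z (cst_of a) x) ^+ 2) ->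
  (forall a, L2r a -> L2 (Z (cst_of a))) ->
  real_reading p Q g ->
  inte (fun x => 1[Q] x * (S g x ^+ 2 * q x)) /\
  itg (fun x => 1[Q] x * (S g x ^+ 2 * q x)) <= `|C| * wmass p Q.
Proof.
move=> wp wq ht S2 SZ Z2 rg; have lp := weight_lweight wp; have [q0 mq _] := weight_lweight wq.
have [g2 _ _ _ _] := sub_readingP lp (real_reading_sub rg).
have [mS _] := S2 _ g2; have mQ : measurable (cube Q : set T) by exact: measurable_cube.
have /L2P[[m1 _] [m2 _]] := Z2 _ g2.
have mI : measurable_fun setT (1[Q]) by exact: measurable_indic.
apply: inte_le_fin.
- by apply: measurable_funM => //; apply: measurable_funM => //; exact: measurable_funX.
- by move=> x; rewrite (mulr_ge0 (ind_ge0 _ x))// (mulr_ge0 (sqr_ge0 _)).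
have := ht Q _ (real_reading_readings rg).
have [_ _ ip] := lp.
rewrite [X in (X <= _)%E]eint_restrict [X in (_ <= _ * X)%E]eint_restrict.
rewrite -(itg_EFin (ip Q)) -/(wmass p Q) -EFinM.
have h : (\int[mu]_x (1[Q] x * (S g x ^+ 2 * q x))%:E <=
    \int[mu]_x (1[Q] x * (Normc.normc (Z (cst_of g) x) ^+ 2 * q x))%:E)%E.
  apply: ge0_le_integral => //.
  - by move=> x _; rewrite lee_fin (mulr_ge0 (ind_ge0 _ x))// (mulr_ge0 (sqr_ge0 _)).
  - by apply/measurable_EFinP; apply: measurable_funM => //; apply: measurable_funM => //; exact: measurable_funX.
  - apply/measurable_EFinP; apply: measurable_funM => //; apply: measurable_funM => //.
    under eq_fun do rewrite normc_sqr.
    by apply: measurable_funD; exact: measurable_funX.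
  move=> x _; rewrite lee_fin; apply: (ler_wpM2l (ind_ge0 _ x)).
  by apply: (ler_wpM2r (q0 x)); exact: SZ.
move=> h'; apply: le_trans h _; apply: le_trans h' _.
by rewrite lee_fin; apply: ler_wpM2r; [exact: wmass_ge0|exact: ler_norm].
Qed.

Lemma weak_parts C Q P g h : weak_bound r Op u v C ->
  level Q <= level P + r%:Z -> level P <= level Q + r%:Z ->
  real_reading u Q g -> real_reading v P h ->
  `|ip (reO g) h| <= `|C| * (Num.sqrt (wmass u Q) * Num.sqrt (wmass v P)) /\
  `|ip (imO g) h| <= `|C| * (Num.sqrt (wmass u Q) * Num.sqrt (wmass v P)).
Proof.
move=> hw l1 l2 rg rh.
have := hw Q P (side_ratio R l1 l2) _ _ (real_reading_readings rg) (real_reading_readings rh).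
rewrite inner_cstr !itg_restrict -/(wmass u Q) -/(wmass v P) -mulrA /= => hC.
have s0 : 0 <= Num.sqrt (wmass u Q) * Num.sqrt (wmass v P) by rewrite mulr_ge0 ?sqrtr_ge0.
have := le_trans hC (ler_wpM2r s0 (ler_norm C)) => {}hC.
rewrite -/(reO g) -/(imO g) in hC.
by split; apply: le_trans hC; rewrite -sqrtr_sqr ler_wsqrtr// ?lerDl ?lerDr sqr_ge0.
Qed.

Lemma re_le (z : R[i]) : complex.Re z ^+ 2 <= Normc.normc z ^+ 2.
Proof. by rewrite normc_sqr lerDl sqr_ge0. Qed.

Lemma im_le (z : R[i]) : complex.Im z ^+ 2 <= Normc.normc z ^+ 2.
Proof. by rewrite normc_sqr lerDr sqr_ge0. Qed.

Lemma testing_parts C : weak_bound r Op u v C -> testing Op u v C ->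
  testing Ad v u C -> exists2 K : R,
  testing_data r K `|C| reO reA u v & testing_data r K `|C| imO imA u v.
Proof.
move=> hw ht ht'; have [K b1 b2] := band_parts; exists K; split=> //.
- by move=> Q P g h l1 l2 rg rh; have [] := weak_parts hw l1 l2 rg rh.
- move=> Q g; apply: (testing_part wu wv ht) => //; first exact: L2_reO.
  by move=> a x; exact: re_le.
  exact: L2O.
- move=> Q g; apply: (testing_part wv wu ht') => //; first exact: L2_reA.
  by move=> a x; exact: re_le.
  exact: L2A.
- by move=> Q P g h l1 l2 rg rh; have [] := weak_parts hw l1 l2 rg rh.
- move=> Q g; apply: (testing_part wu wv ht) => //; first exact: L2_imO.
  by move=> a x; exact: im_le.
  exact: L2O.
- move=> Q g; apply: (testing_part wv wu ht') => //; first exact: L2_imA.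
  by move=> a x; rewrite sqrrN; exact: im_le.
  exact: L2A.
Qed.

(** The real bound has constant 18. Passing to complex functions multiplies it
by 4 = 2 * 2: one factor for |T a + i T b|^2 <= 2 |T a|^2 + 2 |T b|^2, one for
the real and imaginary parts of each image. *)
Definition norm_constant (C : R) := Num.sqrt 72 * (Bform N r `|C| + Num.sqrt `|C|).

Lemma sufficiency C : weak_bound r Op u v C -> testing Op u v C ->
  testing Ad v u C -> two_weight_bound Op u v (norm_constant C).
Proof.
move=> hw ht ht' f f2 uf2.
have [K t1 t2] := testing_parts hw ht ht'.
have B0 : 0 <= Bform N r `|C| + Num.sqrt `|C|.
  by rewrite addr_ge0 ?sqrtr_ge0// /Bform !mulr_ge0 ?addr_ge0 ?mulr_ge0 ?addr_ge0.
have c0 : 0 <= norm_constant C by rewrite mulr_ge0 ?sqrtr_ge0.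
have /L2P[a2 b2] := f2; set a := re f in a2 *; set b := im f in b2 *.
apply/(L2norm_le_mul _ f2 c0).
pose ua x := Num.sqrt (u x) * a x; pose ub x := Num.sqrt (u x) * b x.
have ufE x : mult (sqrtw u) f x = (ua x +i* ub x)%C.
  by rewrite /mult /sqrtw /ua /ub /a /b /re /im; case: (f x) => p q /=; congr (_ +i* _)%C; ring.
have [ua2 ub2] : L2r ua /\ L2r ub.
  have /L2P[h1 h2] := uf2; split.
    by move: h1; congr L2r; apply/funext => x; rewrite /re ufE.
  by move: h2; congr L2r; apply/funext => x; rewrite /im ufE.
set g := mult _ _ in ufE uf2 *.
have gE : g = fun x => ('i%C : R[i]) * cst_of ub x + cst_of ua x.
  apply/funext => x; rewrite ufE /cst_of; apply/eqP; rewrite eq_complex /=.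
  by apply/andP; split; apply/eqP; ring.
have [[_ hlin _] _] := hO.
have hae := hlin 'i%C _ _ (proj2 (L2_cst ub) ub2) (proj2 (L2_cst ua) ua2).
rewrite -gE in hae.
have [v0 mv _] := lv.
have Og2 : L2 (Op g) by case: hO => -[h _ _] _; exact: h.
have /L2P[[mg1 _] [mg2 _]] := Og2.
have [r1 r2] := (L2_reO ua2, L2_reO ub2); have [i1 i2] := (L2_imO ua2, L2_imO ub2).
pose H x := 2 * (reO ua x ^+ 2 * v x) + 2 * (imO ua x ^+ 2 * v x) +
  (2 * (reO ub x ^+ 2 * v x) + 2 * (imO ub x ^+ 2 * v x)).
have mG z : L2r z -> measurable_fun setT (fun x : T => 2 * (z x ^+ 2 * v x) : R).
  move=> [mz _]; apply: measurable_funM => //; apply: measurable_funM => //.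
  exact: measurable_funX.
have G0 z x : 0 <= 2 * (z x ^+ 2 * v x) :> R.
  by rewrite mulr_ge0// (mulr_ge0 (sqr_ge0 _)).
have e1 : (energy (mult (sqrtw v) (Op g)) <= \int[mu]_x (H x)%:E)%E.
  apply: ae_ge0_le_integral => //.
  - by move=> x _; rewrite lee_fin sqr_ge0.
  - apply/measurable_EFinP; under eq_fun do rewrite normc_sqr.
    have ms := measurable_root lv.
    apply: measurable_funD; apply: measurable_funX.
      rewrite (_ : (fun x => _) = fun x => Num.sqrt (v x) * re (Op g) x).
        exact: measurable_funM.
      by apply/funext => x; rewrite /mult /sqrtw /re; case: (Op g x) => p q /=; ring.
    rewrite (_ : (fun x => _) = fun x => Num.sqrt (v x) * im (Op g) x).
      exact: measurable_funM.
    by apply/funext => x; rewrite /mult /sqrtw /im; case: (Op g x) => p q /=; ring.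
  - by move=> x _; rewrite lee_fin !addr_ge0.
  - by apply/measurable_EFinP; apply: measurable_funD; apply: measurable_funD; exact: mG.
  apply: filterS hae => x hx _; rewrite lee_fin normc_sqr /mult /sqrtw hx /H /reO /imO /re /im.
  case: (Op (cst_of ub) x) => p q; case: (Op (cst_of ua) x) => p' q' /=.
  have := sqr_sqrtr (v0 x); move: (Num.sqrt (v x)) => s <-; rewrite -subr_ge0.
  set lhs := (X in 0 <= X).
  have -> : lhs = s ^+ 2 * ((p' + q) ^+ 2 + (q' - p) ^+ 2) by rewrite /lhs; ring.
  by rewrite mulr_ge0 ?addr_ge0 ?sqr_ge0.
apply: le_trans e1 _.
have dbl z c : L2r z -> (\int[mu]_x (z x ^+ 2 * v x)%:E <= c%:E)%E ->
    (\int[mu]_x (2 * (z x ^+ 2 * v x))%:E <= (2 * c)%:E)%E.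
  move=> z2 h; under eq_integral do rewrite EFinM.
  rewrite ge0_integralZl//; first by rewrite EFinM; exact: lee_wpmul2l.
    apply/measurable_EFinP; apply: measurable_funM => //; apply: measurable_funX.
    by case: z2.
  by move=> x _; rewrite lee_fin (mulr_ge0 (sqr_ge0 _)).
have addb (p q : T -> R) c d : measurable_fun setT p -> measurable_fun setT q ->
    (forall x, 0 <= p x) -> (forall x, 0 <= q x) ->
    (\int[mu]_x (p x)%:E <= c%:E)%E -> (\int[mu]_x (q x)%:E <= d%:E)%E ->
    (\int[mu]_x (p x + q x)%:E <= (c + d)%:E)%E.
  move=> mp mq p0 q0 hp hq; under eq_integral do rewrite EFinD.
  rewrite ge0_integralD//; first by rewrite EFinD; exact: leeD.
  - by move=> x _; rewrite lee_fin.
  - exact/measurable_EFinP.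
  - by move=> x _; rewrite lee_fin.
  - exact/measurable_EFinP.
have s1 := dbl _ _ r1 (real_sufficiency hN t1 a2 ua2).
have s2 := dbl _ _ i1 (real_sufficiency hN t2 a2 ua2).
have s3 := dbl _ _ r2 (real_sufficiency hN t1 b2 ub2).
have s4 := dbl _ _ i2 (real_sufficiency hN t2 b2 ub2).
have m12 := measurable_funD (mG _ r1) (mG _ i1).
have m34 := measurable_funD (mG _ r2) (mG _ i2).
have z12 x : 0 <= 2 * (reO ua x ^+ 2 * v x) + 2 * (imO ua x ^+ 2 * v x) by rewrite addr_ge0.
have z34 x : 0 <= 2 * (reO ub x ^+ 2 * v x) + 2 * (imO ub x ^+ 2 * v x) by rewrite addr_ge0.
have s12 := addb _ _ _ _ (mG _ r1) (mG _ i1) (G0 _) (G0 _) s1 s2.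
have s34 := addb _ _ _ _ (mG _ r2) (mG _ i2) (G0 _) (G0 _) s3 s4.
apply: le_trans (addb _ _ _ _ m12 m34 z12 z34 s12 s34) _.
rewrite lee_fin /norm_constant exprMn sqr_sqrtr//.
by rewrite le_eqVlt; apply/orP; left; apply/eqP; ring.
Qed.

End weights.
End operator.

(** * Duality with square roots of weights *)

Section duality.
Variables (R : realType) (N : nat).
Local Notation mu := (lebesgue R N).
Local Notation T := (Rn R N).
Local Notation itg := (itg mu).
Local Notation inte := (inte mu).
Local Notation ip := (ip mu).
Local Notation nrm := (nrm mu).
Local Notation L2r := (L2r mu).
Implicit Types (a b : T -> R) (A B P Q : dyadic N).
Local Notation "1[ Q ]" := (\1_(cube Q) : T -> R) (at level 0, format "1[ Q ]").

(** Since t <= w, the square of t z / w^(1/2) is at most t z^2. *)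
Lemma root_quotient (w z t : T -> R) : lweight w -> measurable_fun setT z ->
  (forall x, 0 <= t x <= w x) -> measurable_fun setT t -> inte (fun x => t x * z x ^+ 2) ->
  let q x := t x * z x / Num.sqrt (w x) in
  [/\ L2r q, forall x, Num.sqrt (w x) * q x = t x * z x &
      ip q q <= itg (fun x => t x * z x ^+ 2)].
Proof.
move=> lw mz tw mt itz q.
have [w0 mw _] := lw.
have mq : measurable_fun setT q.
  by apply: (measurable_div_root lw); exact: measurable_funM.
have qle x : q x ^+ 2 <= t x * z x ^+ 2.
  have /andP[t0 t1] := tw x; rewrite /q.
  have [h|h] := eqVneq (Num.sqrt (w x)) 0.
    by rewrite h invr0 mulr0 expr0n (mulr_ge0 t0 (sqr_ge0 _)).
  have wp : 0 < w x by rewrite -sqrtr_gt0 lt_neqAle eq_sym h sqrtr_ge0.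
  rewrite expr_div_n sqr_sqrtr// ler_pdivrMr// exprMn.
  have -> : t x ^+ 2 * z x ^+ 2 = (t x * z x ^+ 2) * t x by ring.
  by apply: (ler_wpM2l (mulr_ge0 t0 (sqr_ge0 _))).
have q2 : L2r q.
  split=> //; apply: (inte_le _ itz); first exact: measurable_funX.
  by move=> x; rewrite ger0_norm ?sqr_ge0.
split=> //.
- move=> x; have /andP[t0 t1] := tw x; rewrite /q.
  have [h|h] := eqVneq (Num.sqrt (w x)) 0; last by field.
  have wx : w x = 0 by rewrite -(sqr_sqrtr (w0 x)) h expr0n.
  by rewrite h mul0r (_ : t x = 0) ?mul0r//; apply/eqP; rewrite eq_le t0 -wx t1.
- by apply: itg_le => //; exact: L2r_inte.
Qed.

Lemma reading_quotient (w z : T -> R) Q : lweight w -> real_reading w Q z ->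
  exists q : T -> R, [/\ L2r q, forall x, Num.sqrt (w x) * q x = z x & ip q q <= wmass w Q].
Proof.
move=> lw rz; have [z2 iz _ z0 zw] := sub_readingP lw (real_reading_sub rz).
have [w0 mw iw] := lw.
have tw x : 0 <= z x <= w x.
  rewrite z0 (le_trans (zw x))// indicE; case: (_ \in _); rewrite ?mul1r ?mul0r//.
have e : (fun x => z x * 1 ^+ 2) = z by apply/funext => x; rewrite expr1n mulr1.
have i1 : inte (fun x => z x * 1 ^+ 2) by rewrite e.
have m1 : measurable_fun setT ((fun=> 1) : T -> R) by exact: measurable_cst.
have [q2 qE qle] := root_quotient lw m1 tw (L2rM z2) i1.
exists (fun x => z x * 1 / Num.sqrt (w x)); split=> //.
- by move=> x; rewrite qE mulr1.
- by apply: le_trans qle _; rewrite e; apply: sub_reading_mass => //; exact: real_reading_sub.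
Qed.

Section real_pair.
Variables (S S' : (T -> R) -> T -> R) (u v : T -> R) (c : R).
Hypotheses (S2 : forall a, L2r a -> L2r (S a)) (S2' : forall a, L2r a -> L2r (S' a)).
Hypothesis adj : forall a b, L2r a -> L2r b -> ip (S a) b = ip a (S' b).
Hypotheses (lu : lweight u) (lv : lweight v) (c0 : 0 <= c).
Hypothesis bound : forall p, L2r p -> L2r (fun x => Num.sqrt (u x) * p x) ->
  (\int[mu]_x (S (fun y => Num.sqrt (u y) * p y) x ^+ 2 * v x)%:E <=
   (c ^+ 2 * ip p p)%:E)%E.

Lemma necessary_test Q z : real_reading u Q z ->
  (\int[mu]_x (S z x ^+ 2 * v x)%:E <= (c ^+ 2 * wmass u Q)%:E)%E.
Proof.
move=> rz; have [q [q2 qE qle]] := reading_quotient lu rz.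
have [z2 _ _ _ _] := sub_readingP lu (real_reading_sub rz).
have e : (fun x => Num.sqrt (u x) * q x) = z by apply/funext.
have := bound q2; rewrite e => /(_ z2) h; apply: le_trans h _.
by rewrite lee_fin; apply: ler_wpM2l; rewrite ?sqr_ge0.
Qed.

(** [z] is moved to v^(1/2) times its quotient by v^(1/2), and the norm
inequality is applied to the other factor. *)
Lemma pairing_bound p P z : L2r p -> L2r (fun x => Num.sqrt (u x) * p x) ->
  real_reading v P z -> `|ip (S (fun x => Num.sqrt (u x) * p x)) z| <=
  c * nrm p * Num.sqrt (wmass v P).
Proof.
move=> p2 up2 rz; have [q [q2 qE qle]] := reading_quotient lv rz.
set F := fun x => _ in up2 *; have [mS _] := S2 up2; have [v0 mv _] := lv.
pose G x := Num.sqrt (v x) * S F x.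
have mG : measurable_fun setT G by apply: measurable_funM => //; exact: measurable_root.
have GE x : G x ^+ 2 = S F x ^+ 2 * v x by rewrite exprMn sqr_sqrtr// mulrC.
have [iG Gle] : inte (fun x => G x ^+ 2) /\ itg (fun x => G x ^+ 2) <= c ^+ 2 * ip p p.
  apply: inte_le_fin; first exact: measurable_funX.
    by move=> x; exact: sqr_ge0.
  by under eq_integral do rewrite GE; exact: bound.
have G2 : L2r G by [].
have -> : ip (S F) z = ip G q.
  by apply: eq_itg => x; rewrite -qE /G; ring.
apply: le_trans (ip_CS G2 q2) _; apply: ler_pM; rewrite ?sqrtr_ge0// nrmE; last first.
  by rewrite ler_wsqrtr.
by rewrite -[X in X * _](ger0_norm c0) -sqrtr_sqr -sqrtrM ?sqr_ge0// ler_wsqrtr//.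
Qed.

Lemma necessary_weak Q P g h : real_reading u Q g -> real_reading v P h ->
  `|ip (S g) h| <= c * (Num.sqrt (wmass u Q) * Num.sqrt (wmass v P)).
Proof.
move=> rg rh; have [q [q2 qE qle]] := reading_quotient lu rg.
have [g2 _ _ _ _] := sub_readingP lu (real_reading_sub rg).
have e : (fun x => Num.sqrt (u x) * q x) = g by apply/funext.
have := pairing_bound q2; rewrite e => /(_ _ _ g2 rh) hh; apply: le_trans hh _.
rewrite -mulrA; apply: ler_wpM2l => //; apply: ler_wpM2r; rewrite ?sqrtr_ge0//.
by rewrite ler_wsqrtr.
Qed.

(** With t the truncation of [u] at [m] and G = S' z, the function t G /
u^(1/2) is an admissible test function: its pairing with S' z is the integral
X of t G^2, and its norm is at most the square root of X. *)
Lemma necessary_adjoint_test Q z : real_reading v Q z ->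
  (\int[mu]_x (S' z x ^+ 2 * u x)%:E <= (c ^+ 2 * wmass v Q)%:E)%E.
Proof.
move=> rz; have [z2 _ _ _ _] := sub_readingP lv (real_reading_sub rz).
have G2 := S2' z2; set G := S' z in G2 *; have mG := L2rM G2.
have [u0 mu_ _] := lu.
apply: weighted_sup => // m; set t := trunc u m.
have tm x : 0 <= t x <= m%:R by rewrite (trunc_ge0 lu) trunc_len.
have tu x : 0 <= t x <= u x by rewrite (trunc_ge0 lu) trunc_le.
have mt : measurable_fun setT t := measurable_trunc lu m.
have it := inte_bounded_sqr mt tm G2.
have [q2 qE qle] := root_quotient lu mG tu mt it.
set q := fun x => _ in q2 qE qle.
have tG2 : L2r (fun x => t x * G x).
  apply: (L2r_le _ (L2rZ m%:R G2)); first exact: measurable_funM.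
  move=> x; have /andP[h1 h2] := tm x.
  by rewrite !normrM (ger0_norm h1) normr_nat; apply: ler_wpM2r.
have e : (fun x => Num.sqrt (u x) * q x) = fun x => t x * G x by apply/funext.
have := pairing_bound q2; rewrite e => /(_ _ _ tG2 rz).
rewrite adj// -/G.
have -> : ip (fun x => t x * G x) G = itg (fun x => t x * G x ^+ 2).
  by apply: eq_itg => x; rewrite -mulrA -expr2.
set X := itg _ in qle *; move=> h.
have X0 : 0 <= X by apply: le_trans qle; exact: ip_ge0.
have W0 : 0 <= wmass v Q by exact: wmass_ge0.
have h1 : X <= c * Num.sqrt X * Num.sqrt (wmass v Q).
  rewrite -{1}(ger0_norm X0); apply: le_trans h _.
  apply: ler_wpM2r; first exact: sqrtr_ge0.
  by apply: ler_wpM2l => //; rewrite nrmE ler_wsqrtr.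
have := sqrtr_ge0 X; rewrite le_eqVlt => /orP[/eqP X00|Xp].
  by rewrite -(sqr_sqrtr X0) -X00 expr0n (mulr_ge0 (sqr_ge0 _)).
have h2 : Num.sqrt X <= c * Num.sqrt (wmass v Q).
  by rewrite -(ler_pM2r Xp) -expr2 sqr_sqrtr// mulrAC.
rewrite -(sqr_sqrtr X0) -(sqr_sqrtr W0) -exprMn; apply: lerXn2r => //.
  by rewrite nnegrE sqrtr_ge0.
by rewrite nnegrE mulr_ge0 ?sqrtr_ge0.
Qed.

End real_pair.
End duality.

(** * Necessity, and the theorem *)

Section necessity.
Variables (R : realType) (N r : nat).
Local Notation mu := (lebesgue R N).
Local Notation T := (Rn R N).
Local Notation itg := (itg mu).
Local Notation inte := (inte mu).
Local Notation ip := (ip mu).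
Local Notation nrm := (nrm mu).
Local Notation L2r := (L2r mu).
Implicit Types (a b : T -> R) (A B P Q : dyadic N).
Local Notation "1[ Q ]" := (\1_(cube Q) : T -> R) (at level 0, format "1[ Q ]").
Variables Op Ad : (T -> R[i]) -> T -> R[i].
Hypotheses (hO : band_operator r Op) (hA : is_adjoint Op Ad).
Variables (u v : T -> R).
Hypotheses (wu : weight u) (wv : weight v).
Let lu := weight_lweight wu.
Let lv := weight_lweight wv.
Variable B : R.
Hypothesis hB : two_weight_bound Op u v B.

Lemma measurable_weighted (f : T -> R[i]) (w : T -> R) : cmeasurable f ->
  measurable_fun setT w ->
  measurable_fun setT (fun x => Normc.normc (f x) ^+ 2 * w x : R).
Proof.
move=> [m1 m2] mw; apply: measurable_funM => //; under eq_fun do rewrite normc_sqr.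
by apply: measurable_funD; exact: measurable_funX.
Qed.

Lemma real_bound p : L2r p -> L2r (fun x => Num.sqrt (u x) * p x) ->
  (\int[mu]_x (Normc.normc (Op (cst_of (fun y => Num.sqrt (u y) * p y)) x) ^+ 2 * v x)%:E
   <= (`|B| ^+ 2 * ip p p)%:E)%E.
Proof.
move=> p2 up2; have c2 : L2 (cst_of p) by exact/L2_cst.
have e : mult (sqrtw u) (cst_of p) = cst_of (fun y => Num.sqrt (u y) * p y).
  apply/funext => x; rewrite /mult /sqrtw /cst_of; apply/eqP; rewrite eq_complex /=.
  by apply/andP; split; apply/eqP; ring.
have := hB c2; rewrite e => /(_ (proj2 (L2_cst _) up2)) h.
have e0 : ip (im (cst_of p)) (im (cst_of p)) = 0.
  by rewrite -[RHS](itg0 mu); apply: eq_itg => x; rewrite mulr0.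
have h' : (energy (mult (sqrtw v) (Op (cst_of (fun y => Num.sqrt (u y) * p y)%R))) <=
    (`|B| ^+ 2 * (ip p p + ip (im (cst_of p)) (im (cst_of p))))%:E)%E.
  apply/(L2norm_le_mul _ c2 (normr_ge0 B)); apply: le_trans h _.
  by apply: lee_wpmul2r; [exact: Lnorm_ge0|rewrite lee_fin ler_norm].
move: h'; rewrite e0 addr0; apply: le_trans.
have [v0 _ _] := lv.
rewrite le_eqVlt; apply/orP; left; apply/eqP; apply: eq_integral => x _.
rewrite !normc_sqr /mult /sqrtw; case: (Op _ x) => z1 z2 /=; congr _%:E.
by rewrite -{1}(sqr_sqrtr (v0 x)); ring.
Qed.

Lemma part_bound (S : (T -> R) -> T -> R) :
  (forall a, L2r a -> L2r (S a)) ->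
  (forall a x, S a x ^+ 2 <= Normc.normc (Op (cst_of a) x) ^+ 2) ->
  forall p, L2r p -> L2r (fun x => Num.sqrt (u x) * p x) ->
  (\int[mu]_x (S (fun y => Num.sqrt (u y) * p y) x ^+ 2 * v x)%:E <=
   (`|B| ^+ 2 * ip p p)%:E)%E.
Proof.
move=> S2 SO p p2 up2; apply: le_trans (real_bound p2 up2).
have [v0 mv _] := lv; have [mS _] := S2 _ up2; have [m2 _] := L2O hO up2.
apply: ge0_le_integral => //.
- by move=> x _; rewrite lee_fin (mulr_ge0 (sqr_ge0 _)).
- by apply/measurable_EFinP; apply: measurable_funM => //; exact: measurable_funX.
- by apply/measurable_EFinP; exact: measurable_weighted.
- by move=> x _; rewrite lee_fin; apply: (ler_wpM2r (v0 x)).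
Qed.

Let c0 := normr_ge0 B.
Let bre := part_bound (L2_reO hO) (fun a x => re_le (Op (cst_of a) x)).
Let bim := part_bound (L2_imO hO) (fun a x => im_le (Op (cst_of a) x)).

Lemma testing_join (Z : (T -> R[i]) -> T -> R[i]) (S1 S2 : (T -> R) -> T -> R)
    (p q : T -> R) : weight p -> weight q ->
  (forall a, L2r a -> L2 (Z (cst_of a))) ->
  (forall a x, Normc.normc (Z (cst_of a) x) ^+ 2 = S1 a x ^+ 2 + S2 a x ^+ 2) ->
  (forall a, L2r a -> L2r (S1 a)) -> (forall a, L2r a -> L2r (S2 a)) ->
  (forall Q a, real_reading p Q a ->
    (\int[mu]_x (S1 a x ^+ 2 * q x)%:E <= (`|B| ^+ 2 * wmass p Q)%:E)%E) ->
  (forall Q a, real_reading p Q a ->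
    (\int[mu]_x (S2 a x ^+ 2 * q x)%:E <= (`|B| ^+ 2 * wmass p Q)%:E)%E) ->
  testing Z p q (2 * `|B| ^+ 2).
Proof.
move=> wp wq Z2 Zsq h1 h2 t1 t2 Q g /readings_real_reading[a ra ->].
have lp := weight_lweight wp; have [q0 mq _] := weight_lweight wq.
have [a2 _ _ _ _] := sub_readingP lp (real_reading_sub ra).
have [m1 _] := h1 _ a2; have [m2 _] := h2 _ a2; have [mZ _] := Z2 _ a2.
have mQ : measurable (cube Q : set T) by exact: measurable_cube.
have [_ _ ip_] := lp.
rewrite [X in (_ <= _ * X)%E]eint_restrict -(itg_EFin (ip_ Q)) -/(wmass p Q) -EFinM.
apply: (@le_trans _ _ (\int[mu]_x (Normc.normc (Z (cst_of a) x) ^+ 2 * q x)%:E)%E).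
  apply: ge0_subset_integral => //.
    by apply/measurable_EFinP; exact: measurable_weighted.
  by move=> x _; rewrite lee_fin (mulr_ge0 (sqr_ge0 _)).
under eq_integral do rewrite Zsq mulrDl EFinD.
rewrite ge0_integralD//.
- rewrite (_ : 2 * `|B| ^+ 2 * wmass p Q = `|B| ^+ 2 * wmass p Q + `|B| ^+ 2 * wmass p Q); last by ring.
  by rewrite EFinD; apply: leeD; [exact: t1|exact: t2].
- by move=> x _; rewrite lee_fin (mulr_ge0 (sqr_ge0 _)).
- by apply/measurable_EFinP; apply: measurable_funM => //; exact: measurable_funX.
- by move=> x _; rewrite lee_fin (mulr_ge0 (sqr_ge0 _)).
- by apply/measurable_EFinP; apply: measurable_funM => //; exact: measurable_funX.
Qed.

Lemma adj_re a b : L2r a -> L2r b -> ip (reO Op a) b = ip a (reA Ad b).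
Proof. by move=> a2 b2; have [] := adjoint_parts hA a2 b2. Qed.

Lemma adj_im a b : L2r a -> L2r b -> ip (imO Op a) b = ip a (imA Ad b).
Proof. by move=> a2 b2; have [] := adjoint_parts hA a2 b2. Qed.

Lemma necessity : [/\ weak_bound r Op u v (2 * `|B|),
  testing Op u v (2 * `|B| ^+ 2) & testing Ad v u (2 * `|B| ^+ 2)].
Proof.
split.
- move=> Q P _ f h /readings_real_reading[a ra ->] /readings_real_reading[b rb ->].
  rewrite inner_cstr !itg_restrict -/(wmass u Q) -/(wmass v P) -mulrA -(mulrA 2) /=.
  have h1 := necessary_weak (L2_reO hO) lu lv c0 bre ra rb.
  have h2 := necessary_weak (L2_imO hO) lu lv c0 bim ra rb.
  rewrite -/(reO Op a) -/(imO Op a).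
  move: h1 h2; move: (ip _ _) (ip (imO Op a) b) (_ * _) => x y z h1 h2.
  have t0 : 0 <= `|x| + `|y| by rewrite addr_ge0.
  apply: (@le_trans _ _ (`|x| + `|y|)); last by lra.
  rewrite -[leRHS](ger0_norm t0) -sqrtr_sqr ler_wsqrtr//.
  rewrite sqrrD !real_normK ?num_real//.
  have := mulr_ge0 (normr_ge0 x) (normr_ge0 y); lra.
- apply: (testing_join wu wv (L2O hO) (S1 := reO Op) (S2 := imO Op)) => //.
  + by move=> a x; exact: normc_sqr.
  + exact: (L2_reO hO).
  + exact: (L2_imO hO).
  + by move=> Q a; exact: (necessary_test lu bre).
  + by move=> Q a; exact: (necessary_test lu bim).
- apply: (testing_join wv wu (L2A hA) (S1 := reA Ad) (S2 := imA Ad)) => //.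
  + by move=> a x; rewrite sqrrN; exact: normc_sqr.
  + exact: (L2_reA hA).
  + exact: (L2_imA hA).
  + move=> Q a; exact: (necessary_adjoint_test (L2_reO hO) (L2_reA hA) adj_re lu lv c0 bre).
  + move=> Q a; exact: (necessary_adjoint_test (L2_imO hO) (L2_imA hA) adj_im lu lv c0 bim).
Qed.

End necessity.

Section monotone.
Variables (R : realType) (N r : nat).
Local Notation mu := (lebesgue R N).
Local Notation T := (Rn R N).
Variables (Op : (T -> R[i]) -> T -> R[i]) (u v : T -> R) (C D : R).
Hypothesis CD : C <= D.

Lemma weak_bound_le : weak_bound r Op u v C -> weak_bound r Op u v D.
Proof.
move=> h Q S QS f g rf rg; apply: le_trans (h Q S QS f g rf rg) _.
by apply: ler_wpM2r; rewrite ?sqrtr_ge0//; apply: ler_wpM2r; rewrite ?sqrtr_ge0.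
Qed.

Lemma testing_le : weight u -> testing Op u v C -> testing Op u v D.
Proof.
move=> [u0 _] h Q g rg; apply: le_trans (h Q g rg) _; apply: lee_wpmul2r.
  by apply: integral_ge0 => x _; rewrite lee_fin.
by rewrite lee_fin.
Qed.

End monotone.

Theorem theorem1p5 (R : realType) (N r : nat) (hN : (0 < N)%N) :
  (forall (T Tstar : (Rn R N -> R[i]) -> (Rn R N -> R[i])) (u v : Rn R N -> R),
     band_operator r T -> is_adjoint T Tstar -> weight u -> weight v ->
     ((exists B : R, two_weight_bound T u v B) <->
      (exists C : R,
         [/\ weak_bound r T u v C, testing T u v C & testing Tstar v u C])))
  /\
  (forall C : R, exists B : R,
     forall (T Tstar : (Rn R N -> R[i]) -> (Rn R N -> R[i]))
            (u v : Rn R N -> R),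
     band_operator r T -> is_adjoint T Tstar -> weight u -> weight v ->
     weak_bound r T u v C -> testing T u v C -> testing Tstar v u C ->
     two_weight_bound T u v B).
Proof.
split=> [T Tstar u v hO hA wu wv|C]; last first.
  exists (norm_constant N r C) => T Tstar u v hO hA wu wv.
  exact: (sufficiency hN hO hA wu wv).
split=> [[B hB]|[C [hw ht ht']]]; last first.
  by exists (norm_constant N r C); exact: (sufficiency hN hO hA wu wv).
have [hw ht ht'] := necessity hO hA wu wv hB.
have B1 : 0 <= `|B| by []; have B2 : 0 <= `|B| ^+ 2 by exact: sqr_ge0.
exists (2 * `|B| + 2 * `|B| ^+ 2); split.
- by apply: weak_bound_le hw; lra.
- by apply: testing_le ht => //; lra.
- by apply: testing_le ht' => //; lra.
Qed.
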